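(* Suppose that the vector-function $\mathbf{g}=(g_1,\dots,g_d)$ is such that the following regularity conditions hold. (i) For any $\nu>0$ and any $\vartheta_0\in\Theta$, $$\inf_{\vartheta\in\Theta,\ |\vartheta-\vartheta_0|>\nu}\bigl|\mathbf{M}(\vartheta)-\mathbf{M}(\vartheta_0)\bigr|>0 .$$ (ii) The inverse function $\mathbf{H}=\mathbf{M}^{-1}$ is continuously differentiable. Then for every true value $\vartheta_0\in\Theta$ the method of moments estimator $\vartheta_n^*=\mathbf{H}(\mathbf{a}_n)$ is consistent, i.e. $\vartheta_n^*\to\vartheta_0$ in probability as $n\to\infty$, and asymptotically normal: $$\sqrt{n}\,\bigl(\vartheta_n^*-\vartheta_0\bigr)\Longrightarrow\mathcal{N}\bigl(0,\mathbb{D}(\vartheta_0)\bigr)\qquad (n\to\infty),$$ where $\mathbb{D}(\vartheta)=\mathbf{J}(\vartheta)\,\mathbb{G}(\vartheta)\,\mathbf{J}(\vartheta)^{\top}$, with $$\mathbf{J}(\vartheta)_{lk}=\frac{\partial H_l}{\partial a_k}(\mathbf{a})\Big|_{\mathbf{a}=\mathbf{M}(\vartheta)},\qquad \mathbb{G}(\vartheta)_{lk}=\int_{\mathbb{T}}g_l(s)g_k(s)\lambda(\vartheta,s)\,ds,\qquad l,k=1,\dots,d.$$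
   Context: Model: $\mathbb{T}$ is an interval of observations, either finite, $\mathbb{T}=[0,T]$, or infinite, $\mathbb{T}=[0,\infty)$ or $\mathbb{T}=(-\infty,\infty)$. The parameter set $\Theta\subset\mathbb{R}^d$ is open, convex and bounded. For each $\vartheta\in\Theta$, $X_1,X_2,\dots$ are, under the probability $\mathbf{P}_\vartheta$, independent inhomogeneous Poisson (counting) processes $X_j=(X_j(t),t\in\mathbb{T})$ with the same intensity function $\lambda(\vartheta,t)$, $t\in\mathbb{T}$. One observes $X^{(n)}=(X_1,\dots,X_n)$, and all convergences are under $\mathbf{P}_{\vartheta_0}$, where $\vartheta_0\in\Theta$ is the true value. Method of moments: $\mathbf{g}(s)=(g_1(s),\dots,g_d(s))$, $s\in\mathbb{T}$, is a given deterministic vector-function, with the integrals below well defined and finite. Put $$\mathbf{M}(\vartheta)=\mathbf{E}_\vartheta\int_{\mathbb{T}}\mathbf{g}(s)\,dX_1(s)=\int_{\mathbb{T}}\mathbf{g}(s)\lambda(\vartheta,s)\,ds\in\mathbb{R}^d .$$ It is supposed that $\mathbf{g}$ is such that, for every $\mathbf{a}\in\mathbf{M}(\Theta)$, the equation $\mathbf{M}(\vartheta)=\mathbf{a}$ has a unique solution $\vartheta=\mathbf{M}^{-1}(\mathbf{a})=\mathbf{H}(\mathbf{a})$ in $\Theta$; thus $\mathbf{H}=(H_1,\dots,H_d)$ is the inverse function of $\mathbf{M}$. Its domain $\mathbf{M}(\Theta)$ is understood to be open, so that continuous differentiability makes sense. The method of moments estimator is $$\vartheta_n^*=\mathbf{H}(\mathbf{a}_n),\qquad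 \mathbf{a}_n=\frac1n\sum_{j=1}^n\int_{\mathbb{T}}\mathbf{g}(s)\,dX_j(s),$$ where $\vartheta_n^*$ is given an arbitrary (measurable) value if $\mathbf{a}_n$ is not in the domain of $\mathbf{H}$. The symbol $\Longrightarrow$ denotes convergence in distribution. *)

(* Defs.v *)
From HB Require Import structures.
From mathcomp Require Import all_boot all_order all_algebra finmap.
From mathcomp Require Import all_classical all_reals all_analysis.

Set Implicit Arguments.
Unset Strict Implicit.
Unset Printing Implicit Defensive.

Import Order.TTheory GRing.Theory Num.Theory.
Import numFieldNormedType.Exports.

Local Open Scope classical_set_scope.
Local Open Scope ring_scope.

(* The library norm of 'rV[R]_d is the sup norm. *)
Definition enorm (R : realType) (d : nat) (x : 'rV[R]_d) : R :=
  Num.sqrt (\sum_(i < d) x 0 i ^+ 2).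

Definition borel_rV (R : realType) (d : nat) :=
  g_sigma_algebraType (@open 'rV[R]_d).

Definition mutually_independent (R : realType) (dO : measure_display)
    (Omega : measurableType dO) (P : probability Omega R)
    (I : choiceType) (F : I -> set (set Omega)) : Prop :=
  forall (J : {fset I}) (A : I -> set Omega),
    (forall i, i \in J -> F i (A i)) ->
    P (\bigcap_(i in [set` J]) A i) = (\prod_(i <- J) P (A i))%E.

Section PoissonProcesses.
Context (R : realType) (dO : measure_display) (Omega : measurableType dO).

Definition observation_interval (T : set R) : Prop :=
  [\/ exists2 T0 : R, 0 < T0 & T = `[0, T0]%classic,
      T = `[0, +oo[%classic
    | T = [set: R]].

(* The path t |-> X w t of a process indexed by T is carried by a
   nondecreasing right-continuous function on the whole line; only its values
   on T matter. When T starts at 0, the path is extended by 0 to the left of 0,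
   so that its Lebesgue-Stieltjes measure has no atom at 0. On the whole line
   only the increments are constrained (there may be infinitely many points in
   ]-oo, 0], so X w need not be normalized at -oo). *)
Definition counting_process (T : set R) (X : Omega -> cumulative R R) : Prop :=
  [/\ forall t, T t -> measurable_fun setT (fun w => X w t : R),
      forall w s t, T s -> T t -> s <= t -> X w t - X w s \is a Num.nat
    & T `<=` `[0, +oo[ -> forall w t, t <= 0 -> X w t = 0].

Definition process_sigma_algebra (T : set R) (X : Omega -> cumulative R R) :
    set (set Omega) :=
  <<s \bigcup_(t in T)
        preimage_set_system setT (fun w => X w t : R) measurable >>.

Definition intensity (T : set R) (lam : R -> R) : Prop :=
  [/\ measurable_fun T lam, forall t, T t -> 0 <= lam t
    & forall s t, T s -> T t ->
        lebesgue_measure.-integrable `[s, t] (EFin \o lam)].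

(* The library's poisson_pmf is not used because its value at rate 0 is not the
   Dirac mass at 0. *)
Definition poisson_mass (m : R) (k : nat) : R := m ^+ k / k`!%:R * expR (- m).

Definition poisson_process (P : probability Omega R) (T : set R) (lam : R -> R)
    (X : Omega -> cumulative R R) : Prop :=
  [/\ counting_process T X,
      forall s t, T s -> T t -> s <= t -> forall k : nat,
        P [set w | X w t - X w s = k%:R] =
        (poisson_mass (\int[lebesgue_measure]_(u in `]s, t]) lam u)%R k)%:E
    & forall t : nat -> R, (forall i, T (t i)) ->
        (forall i, t i <= t i.+1) ->
        mutually_independent P (fun i =>
          preimage_set_system setT (fun w => X w (t i.+1) - X w (t i) : R)
            measurable)].

Definition iid_poisson_processes (P : probability Omega R) (T : set R)
    (lam : R -> R) (X : nat -> Omega -> cumulative R R) : Prop :=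
  (forall j, poisson_process P T lam (X j)) /\
  mutually_independent P (fun j => process_sigma_algebra T (X j)).

End PoissonProcesses.

Section Convergence.
Context (R : realType) (d : nat).
Context (dO : measure_display) (Omega : measurableType dO).
Variable P : probability Omega R.

Definition cvg_in_probability (Y : nat -> Omega -> 'rV[R]_d) (y : 'rV[R]_d) :
    Prop :=
  forall e : R, 0 < e ->
    (fun n => P [set w | e < enorm (Y n w - y)]) @ \oo --> 0%E.

Definition cvg_in_distribution (Y : nat -> Omega -> 'rV[R]_d)
    (mu : probability (borel_rV R d) R) : Prop :=
  forall f : 'rV[R]_d -> R, continuous f -> (exists C, forall x, `|f x| <= C) ->
    (fun n => (\int[P]_w f (Y n w))%R) @ \oo --> (\int[mu]_x f x)%R.

End Convergence.

(* The library's normal_prob takes the standard deviation and, when it is 0, is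
   a uniform law by convention; here variance 0 gives the Dirac mass. *)
Definition normal_law (R : realType) (m v : R) (A : set R) : \bar R :=
  if v == 0 then dirac m A else normal_prob m (Num.sqrt v) A.

(* mu is N(m, D), possibly degenerate: every linear form <u, x> has under mu
   the law N(<u, m>, u D u^T). *)
Definition multivariate_normal (R : realType) (d : nat)
    (mu : probability (borel_rV R d) R) (m : 'rV[R]_d) (D : 'M[R]_d) : Prop :=
  forall (u : 'rV[R]_d) (A : set R), measurable A ->
    mu [set x | A ((u *m (x : 'rV[R]_d)^T) 0 0)] =
    normal_law ((u *m m^T) 0 0) ((u *m D *m u^T) 0 0) A.

Definition continuously_differentiable (R : realType) (d : nat)
    (U : set 'rV[R]_d) (H : 'rV[R]_d -> 'rV[R]_d) : Prop :=
  forall a, U a -> differentiable H a /\ {for a, continuous (jacobian H)}.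

Section MethodOfMoments.
Context (R : realType) (d : nat).
Variables (T : set R) (g : R -> 'rV[R]_d).

Definition moment (lam : 'rV[R]_d -> R -> R) (theta : 'rV[R]_d) : 'rV[R]_d :=
  \row_k (\int[lebesgue_measure]_(s in T) (g s 0 k * lam theta s))%R.

Definition moment_cov (lam : 'rV[R]_d -> R -> R) (theta : 'rV[R]_d) : 'M[R]_d :=
  \matrix_(l, k)
    (\int[lebesgue_measure]_(s in T) (g s 0 l * g s 0 k * lam theta s))%R.

Definition moments_finite (lam : 'rV[R]_d -> R -> R) (theta : 'rV[R]_d) : Prop :=
  (forall k, lebesgue_measure.-integrable T
     (fun s => (g s 0 k * lam theta s)%:E)) /\
  (forall l k, lebesgue_measure.-integrable T
     (fun s => (g s 0 l * g s 0 k * lam theta s)%:E)).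

Definition inverse_on (Theta : set 'rV[R]_d) (M H : 'rV[R]_d -> 'rV[R]_d) :
    Prop :=
  forall a, (M @` Theta) a ->
    [/\ Theta (H a), M (H a) = a
      & forall theta, Theta theta -> M theta = a -> theta = H a].

Definition partials (H : 'rV[R]_d -> 'rV[R]_d) (a : 'rV[R]_d) : 'M[R]_d :=
  \matrix_(l, k) 'D_(delta_mx 0 k : 'rV[R]_d) (fun b => H b 0 l) a.

Definition limit_cov (lam : 'rV[R]_d -> R -> R) (H : 'rV[R]_d -> 'rV[R]_d)
    (theta : 'rV[R]_d) : 'M[R]_d :=
  let J := partials H (moment lam theta) in
  J *m moment_cov lam theta *m J^T.

Context (dO : measure_display) (Omega : measurableType dO).

(* The n-sample consists of X 0, ..., X (n - 1). *)
Definition empirical_moment (X : nat -> Omega -> cumulative R R) (n : nat)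
    (w : Omega) : 'rV[R]_d :=
  \row_k (n%:R^-1 * \sum_(j < n)
    (\int[lebesgue_stieltjes_measure (X j w)]_(s in T) g s 0 k)%R).

(* Outside the domain A of H the estimator is an arbitrary measurable value. *)
Definition moment_estimator (A : set 'rV[R]_d) (H : 'rV[R]_d -> 'rV[R]_d)
    (X : nat -> Omega -> cumulative R R) (thetan : nat -> Omega -> 'rV[R]_d) :
    Prop :=
  forall n, measurable_fun setT (thetan n : Omega -> borel_rV R d) /\
    forall w, A (empirical_moment X n w) ->
      thetan n w = H (empirical_moment X n w).

End MethodOfMoments.

(* Main.v *)
Require Import Defs.
From HB Require Import structures.
From mathcomp Require Import all_boot all_order all_algebra finmap.
From mathcomp Require Import all_classical all_reals all_analysis.
From mathcomp Require Import measurable_realfun ring lra.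
Set Implicit Arguments.
Unset Strict Implicit.
Unset Printing Implicit Defensive.
Import Order.TTheory GRing.Theory Num.Theory.
Import numFieldNormedType.Exports.
Local Open Scope classical_set_scope.
Local Open Scope ring_scope.

(* The proof goes through characteristic functions. Campbell's formula
     E cos (int h dX) = exp (int (cos h - 1) lam) * cos (int (sin h) lam),
   and its analogue for the sine, hold for dyadic step functions h by independence of
   the increments, extend to bounded h on a bounded window by closure under bounded
   limits, and then to every h integrable against lam by truncation. Independence of
   the n processes then gives the characteristic function of
   Y_n = sqrt n (a_n - M(theta0)) in closed form; it converges to that of N(0, G), and
   1 - E cos (t Y_n) = O(t^2) uniformly in n bounds the truncated second moments of
   Y_n, hence gives tightness.
   Convergence of the characteristic functions plus tightness implies convergence in
   distribution because a bounded continuous function is, on a compact box, uniformly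
   close to a trigonometric polynomial with the same bound: apply Bernstein's
   approximation in the variables (1 + sin (c x_i)) / 2. The same fact shows that a law
   on the line is determined by its characteristic function.
   Finally theta_n^* - theta0 = H(a_n) - H(M(theta0)) is handled by the
   differentiability of H at M(theta0), uniformly on the events |Y_n| <= K. *)

(** * Integration and expectations *)

(** Everything stays real: a characteristic function is a pair of identities with right-hand sides
    [expR a * cos b] and [expR a * sin b], and products become addition formulas. The definition of
    the processes speaks of increments between times of [T], while a path may have infinite mass on
    [T]. So a path integral is under control for every path as long as the integrand is bounded and
    lives on a window; for an integrand that is only integrable against the intensity it converges
    almost surely. The null set comes from the mean of the truncations of |h|, which is why the mean
    is proved along with Campbell's formula. Second moments of path integrals are never computed:
    integrability of the products g_l g_k against the intensity enters as a dominating function h^2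
    for n (cos (h / sqrt n) - 1) and n (sin (h / sqrt n) - h / sqrt n). Consistency is read off from
    the tightness of sqrt n (thetan - theta0). The arbitrary values of the estimator are harmless
    because M(theta0) is interior to the domain of H: for large n, |Y_n| <= K forces a_n into it. *)

Lemma Rintegral_dominated_cvg d (T : measurableType d) (R : realType)
    (mu : {measure set T -> \bar R}) (D : set T) (mD : measurable D)
    (f_ : nat -> T -> R) (f g : T -> R) :
  (forall n, measurable_fun D (f_ n)) -> measurable_fun D f ->
  {ae mu, forall x, D x -> f_ ^~ x @ \oo --> f x} ->
  mu.-integrable D (EFin \o g) ->
  {ae mu, forall x n, D x -> `|f_ n x| <= g x} ->
  mu.-integrable D (EFin \o f) /\
  (fun n => \int[mu]_(x in D) f_ n x) @ \oo --> \int[mu]_(x in D) f x.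
Proof.
move=> mf_ mf f_f ig f_g.
have mEF (h : T -> R) : measurable_fun D h -> measurable_fun D (fun x => (h x)%:E : \bar R).
  by move=> mh; exact: measurableT_comp.
have cE : {ae mu, forall x, D x -> EFin \o f_ ^~ x @ \oo --> (EFin \o f) x}.
  by apply: filterS f_f => x Hx Dx; apply: cvg_EFin; [exact: nearW|exact: Hx].
have cg : {ae mu, forall x n, D x -> (`|(EFin \o f_ n) x| <= (EFin \o g) x)%E}.
  by apply: filterS f_g => x Hx n Dx; exact: Hx.
have [iF _ cF] := @dominated_convergence _ _ _ mu D mD
  (fun n => EFin \o f_ n) _ _ (fun n => mEF _ (mf_ n)) (mEF _ mf) cE ig cg.
split=> //.
apply: fine_cvg; rewrite fineK//; exact: integrable_fin_num.
Qed.

Lemma integrable_scale d (T : measurableType d) (R : realType)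
    (mu : {measure set T -> \bar R}) (D : set T) (c : R) (f : T -> R) : measurable D ->
  mu.-integrable D (EFin \o f) -> mu.-integrable D (EFin \o (fun x => c * f x)).
Proof.
move=> mD fI; rewrite (_ : EFin \o _ = fun x => (c%:E * (EFin \o f) x)%E).
  exact: integrableZl.
by apply/funext => x /=; rewrite EFinM.
Qed.

Lemma norm_cvg_le (R : realType) (u : nat -> R) (l C : R) :
  (forall n, `|u n| <= C) -> u @ \oo --> l -> `|l| <= C.
Proof.
move=> uC /cvg_norm ul; rewrite -(cvg_lim _ ul)//.
by apply: limr_le; [apply/cvg_ex; exists `|l| | exact: nearW].
Qed.

Section bounded_functions.
Import HBSimple HBNNSimple.
Context d (T : measurableType d) (R : realType).

(** A functional monotone class principle. Adding the constant [C] makes the function nonnegative,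
    hence a pointwise limit of simple functions lying below it, all bounded by [2 * C]. *)
Lemma bounded_measurable_ind (K : (T -> R) -> Prop) :
  (forall A, measurable A -> K \1_A) ->
  (forall f g : T -> R, K f -> K g -> K (f \+ g)) ->
  (forall (a : R) f, K f -> K (fun x => a * f x)) ->
  (forall (f_ : nat -> T -> R) (f : T -> R) (C : R), (forall n, K (f_ n)) ->
     (forall n, measurable_fun setT (f_ n)) ->
     (forall n x, `|f_ n x| <= C) -> (forall x, f_ ^~ x @ \oo --> f x) -> K f) ->
  forall (f : T -> R) (C : R), measurable_fun setT f -> (forall x, `|f x| <= C) -> K f.
Proof.
move=> Kind KD KZ Klim f C mf fC.
have Ksum (I : Type) (s : seq I) (h : I -> T -> R) : (forall i, K (h i)) ->
    K (fun x => \sum_(i <- s) h i x).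
  move=> Kh; elim: s => [|i s IH].
    suff -> : (fun x => \sum_(i <- [::]) h i x) = fun x => 0 * \1_set0 x.
      by apply: KZ; exact: Kind.
    by apply/funext => x; rewrite big_nil mul0r.
  rewrite (_ : (fun x => _) = (h i \+ fun x => \sum_(i <- s) h i x)); first exact: KD.
  by apply/funext => x; rewrite big_cons.
pose g x := ((f x + C)%:E : \bar R).
have mg : measurable_fun setT g.
  by apply/measurable_EFinP; apply: measurable_funD.
have g0 x : setT x -> (0 <= g x)%E.
  by move=> _; rewrite lee_fin; have := fC x; rewrite ler_norml => /andP[]; lra.
have -> : f = (fun x => f x + C) \+ (fun x => (- C) * \1_setT x).
  by apply/funext => x /=; rewrite indicE in_setT mulr1 addrK.
apply: (KD); last exact/KZ/Kind.
pose h n : {nnsfun T >-> R} := nnsfun_approx measurableT mg n.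
have hg n x : 0 <= h n x <= f x + C.
  apply/andP; split => //.
  by rewrite /h nnsfun_approxE -lee_fin; exact: le_approx.
apply: (Klim (fun n x => h n x) _ (2 * C)).
- move=> n; rewrite (_ : (fun x => h n x) = fun x => \sum_(i < #|` fset_set (h n @` setT)|)
      ((fset_set (h n @` setT))`_i * \1_(h n @^-1` [set (fset_set (h n @` setT))`_i]) x)).
    by apply: Ksum => i; apply: KZ; apply: Kind; exact: measurable_funPTI.
  by apply/funext => x; exact: fimfunEord.
- by move=> n; exact: measurable_funPT.
- move=> n x; have /andP[h0 h1] := hg n x.
  by rewrite ger0_norm// (le_trans h1)//; have := fC x; rewrite ler_norml => /andP[]; lra.
- move=> x; have /= := @cvg_nnsfun_approx _ _ _ _ measurableT _ mg g0 x I.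
  by move=> /fine_cvg.
Qed.

End bounded_functions.

(** * Taylor bounds for the sine and the cosine *)

Section sin_cos_bounds.
Context {R : realType}.
Implicit Type x : R.

(** Mean value theorem. The Taylor bounds below follow from one another by it: the difference to be
    bounded vanishes at 0 and its derivative is an earlier such difference. *)
Lemma ge0_of_derive_ge0 (f f' : R -> R) :
  (forall x, is_derive x 1 f (f' x)) -> 0 <= f 0 ->
  (forall x, 0 <= x -> 0 <= f' x) -> forall x, 0 <= x -> 0 <= f x.
Proof.
move=> ff' f0 f'0 x x0.
have [|c c0 fc] := @MVT_segment _ f f' 0 x x0 (fun x _ => ff' x).
  apply: derivable_within_continuous => y _; exact: ex_derive.
move: fc; rewrite subr0 => fx; have -> : f x = f 0 + f' c * x by rewrite -fx; ring.
rewrite addr_ge0// mulr_ge0// f'0//.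
by move: c0; rewrite in_itv/= => /andP[].
Qed.

Lemma sin_le x : 0 <= x -> sin x <= x.
Proof.
move=> x0; rewrite -subr_ge0.
apply: (@ge0_of_derive_ge0 (fun y => y - sin y) (fun y => 1 - cos y)) => //.
- by rewrite sin0 subr0.
Qed.

Lemma ler_abs_sin x : `|sin x| <= `|x|.
Proof.
wlog x0 : x / 0 <= x => [H|].
  by have [/H//|/ltW x0] := leP 0 x; rewrite -normrN -sinN -(normrN x); apply: H; rewrite oppr_ge0.
rewrite (ger0_norm x0) ler_norml sin_le// andbT.
rewrite lerNl -subr_ge0.
apply: (@ge0_of_derive_ge0 (fun y => y - - sin y) (fun y => 1 - - cos y)) => //.
- by rewrite sin0 oppr0 subr0.
Qed.

Lemma cos_ge1Bsqr x : 1 - x ^+ 2 / 2 <= cos x.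
Proof.
wlog x0 : x / 0 <= x => [H|].
  by have [/H//|/ltW x0] := leP 0 x; rewrite -cosN -sqrrN; apply: H; rewrite oppr_ge0.
rewrite -subr_ge0.
apply: (@ge0_of_derive_ge0 (fun y => cos y - (1 - y ^+ 2 / 2)) (fun y => y - sin y)) => //.
- move=> y; apply: is_derive_eq; rewrite /GRing.scale/=; lra.
- by rewrite cos0; lra.
- by move=> y y0; rewrite subr_ge0 sin_le.
Qed.

Lemma ler_abs_cosB1 x : `|cos x - 1| <= x ^+ 2 / 2.
Proof.
have := cos_ge1Bsqr x; have := cos_le1 x => c1 c2.
by rewrite ler0_norm; lra.
Qed.

(** Interpolates between x^2 / 2, for |x| <= 2, and the trivial bound 2. It makes cos h - 1
    integrable against the intensity as soon as h is. *)
Lemma ler_abs_cosB1_id x : `|cos x - 1| <= `|x|.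
Proof.
have h1 := ler_abs_cosB1 x; rewrite -(real_normK (num_real x)) in h1.
have h2 : `|cos x - 1| <= 2.
  by rewrite (le_trans (ler_normB _ _))// normr1 -[2]/(1 + 1) lerD2r cos_max.
have := normr_ge0 x; move: h1 h2; move: `|x| `|_| => a b h1 h2 a0.
by have [a2|a2] := leP 2 a; nra.
Qed.

Lemma ler_abs_sinBid x : `|sin x - x| <= `|x| ^+ 3 / 6.
Proof.
wlog x0 : x / 0 <= x => [H|].
  have [/H//|/ltW x0] := leP 0 x; rewrite -normrN opprB addrC -sinN -(normrN x).
  by rewrite -[X in sin _ + X]opprK; apply: H; rewrite oppr_ge0.
rewrite (ger0_norm x0) ler0_norm ?subr_le0 ?sin_le// -subr_ge0.
apply: (@ge0_of_derive_ge0 (fun y => y ^+ 3 / 6 - - (sin y - y))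
   (fun y => cos y - (1 - y ^+ 2 / 2))) => //.
- move=> y; apply: is_derive_eq; rewrite /GRing.scale/= ; lra.
- by rewrite sin0; lra.
- by move=> y y0; rewrite subr_ge0 cos_ge1Bsqr.
Qed.

(** Interpolates between |x|^3 / 6, for |x| <= 2, and 2 |x|. A quadratic bound is wanted because h^2
    is the available dominating function. *)
Lemma ler_abs_sinBid_sqr x : `|sin x - x| <= x ^+ 2.
Proof.
have h3 := ler_abs_sinBid x; rewrite -(real_normK (num_real x)).
have h1 : `|sin x - x| <= 2 * `|x|.
  by rewrite (le_trans (ler_normB _ _))// mulr2n mulrDl mul1r lerD// ler_abs_sin.
have := normr_ge0 x; move: h3 h1; move: `|x| `|_| => a b h3 h1 a0.
have [a2|a2] := leP 2 a; nra.
Qed.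

Lemma ler_abs_cosB1D x : `|cos x - 1 + x ^+ 2 / 2| <= `|x| ^+ 4 / 24.
Proof.
have -> : `|x| ^+ 4 = x ^+ 4 by rewrite -[4%N]/(2 * 2)%N exprM exprM real_normK ?num_real.
wlog x0 : x / 0 <= x => [H|].
  have [/H//|/ltW x0] := leP 0 x; rewrite -cosN -[x ^+ 2]sqrrN.
  have -> : x ^+ 4 = (- x) ^+ 4 by ring.
  by apply: H; rewrite oppr_ge0.
have := cos_ge1Bsqr x => c1; rewrite ger0_norm; last lra.
rewrite -subr_ge0.
apply: (@ge0_of_derive_ge0 (fun y => y ^+ 4 / 24 - (cos y - 1 + y ^+ 2 / 2))
   (fun y => y ^+ 3 / 6 - (y - sin y))) => //.
- move=> y; apply: is_derive_eq; rewrite /GRing.scale/= ; lra.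
- by rewrite cos0; lra.
- move=> y y0; have := ler_abs_sinBid y; rewrite (ger0_norm y0) ler0_norm ?subr_le0 ?sin_le//; lra.
Qed.

End sin_cos_bounds.

Section bounded_expectation.
Context d (T : measurableType d) (R : realType) (P : probability T R).
Implicit Types f g : T -> R.

Lemma bounded_integrable (A : set T) f (C : R) : measurable A -> measurable_fun setT f ->
  (forall x, `|f x| <= C) -> P.-integrable A (EFin \o f).
Proof.
move=> mA mf fC; apply: measurable_bounded_integrable => //.
- by rewrite (le_lt_trans (probability_le1 _ _))// ltry.
- exact: measurable_funTS.
- exists C; split; first exact: num_real.
  by move=> M CM x _ /=; rewrite (le_trans (fC x))// ltW.
Qed.

Lemma bounded_cvg (f_ : nat -> T -> R) f (C : R) :
  (forall n, measurable_fun setT (f_ n)) ->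
  (forall n x, `|f_ n x| <= C) -> (forall x, f_ ^~ x @ \oo --> f x) ->
  measurable_fun setT f /\ (fun n => \int[P]_x f_ n x) @ \oo --> \int[P]_x f x.
Proof.
move=> mf_ fC ff.
have mf : measurable_fun setT f.
  by apply: (measurable_fun_cvg mf_) => x _; exact: ff.
split=> //.
have ig : P.-integrable setT (EFin \o cst C).
  apply: (@bounded_integrable _ _ `|C|) => //.
by have [] := @Rintegral_dominated_cvg _ _ _ P setT measurableT f_ f (cst C)
  mf_ mf (aeW _ (fun x _ => ff x)) ig (aeW _ (fun x n _ => fC n x)).
Qed.

End bounded_expectation.

(** * Expectations under independence *)

Section independence.
Context d (T : measurableType d) (R : realType) (P : probability T R).

Lemma Rintegral_indicM (A : set T) (f : T -> R) : measurable A ->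
  \int[P]_x (\1_A x * f x) = \int[P]_(x in A) f x.
Proof.
move=> mA; rewrite [RHS]Rintegral_mkcond; apply: eq_Rintegral => x _.
by rewrite patchE indicE; case: (x \in A); rewrite ?mul1r ?mul0r.
Qed.

(** Independence is assumed only against one fixed [Q], and is extended from events to bounded
    functions of [psi] by the monotone class principle. In the application [Q] is an indicator times
    the cosine or sine of a partial sum. *)
Lemma independent_expectation (psi Q : T -> R) (C : R) :
  measurable_fun setT psi -> measurable_fun setT Q -> (forall x, `|Q x| <= C) ->
  (forall B : set R, measurable B -> \int[P]_(x in psi @^-1` B) Q x =
     fine (P (psi @^-1` B)) * \int[P]_x Q x) ->
  forall (phi : R -> R) (K : R), measurable_fun setT phi -> (forall y, `|phi y| <= K) ->
  \int[P]_x (phi (psi x) * Q x) = \int[P]_x phi (psi x) * \int[P]_x Q x.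
Proof.
move=> mpsi mQ QC ind phi K mphi phiK.
have C0 : 0 <= C by rewrite (le_trans _ (QC point)).
have QI (A : set T) : measurable A -> P.-integrable A (EFin \o Q).
  by move=> mA; exact: bounded_integrable QC.
pose good (phi : R -> R) := exists K : R, measurable_fun setT phi /\ (forall y, `|phi y| <= K) /\
  \int[P]_x (phi (psi x) * Q x) = \int[P]_x phi (psi x) * \int[P]_x Q x.
have mc (f : R -> R) : measurable_fun setT f -> measurable_fun setT (fun x => f (psi x)).
  by move=> mf; exact: measurableT_comp.
have bI (f : R -> R) (M : R) : measurable_fun setT f -> (forall y, `|f y| <= M) ->
    P.-integrable setT (EFin \o (fun x => f (psi x))).
  move=> mf fM; by apply: (@bounded_integrable _ _ _ _ _ _ M) => //; exact: mc.
have bQI (f : R -> R) (M : R) : measurable_fun setT f -> (forall y, `|f y| <= M) ->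
    P.-integrable setT (EFin \o (fun x => f (psi x) * Q x)).
  move=> mf fM; apply: (@bounded_integrable _ _ _ _ _ _ (M * C)) => //.
    by apply: measurable_funM => //; exact: mc.
  by move=> x; rewrite normrM ler_pM.
suff : good phi by case => ? [_ [_]].
apply: (bounded_measurable_ind (K := good)) mphi phiK.
- move=> A mA; exists 1; split; first exact: measurable_indic.
  split; first by move=> y; rewrite indicE; case: (_ \in _); rewrite ?normr1 ?normr0.
  have mA' : measurable (psi @^-1` A) by rewrite -[_ @^-1` _]setTI; exact: mpsi.
  have e x : \1_A (psi x) = \1_(psi @^-1` A) x :> R.
    by rewrite !indicE; congr (nat_of_bool _)%:R; apply/idP/idP; rewrite !inE.
  under eq_Rintegral do rewrite e.
  rewrite Rintegral_indicM// ind//; congr (_ * _).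
  under eq_Rintegral do rewrite e -[\1__ _]mulr1.
  by rewrite Rintegral_indicM// Rintegral_cst// mul1r.
- move=> f g [M [mf [fM ef]]] [N [mg [gN eg]]]; exists (M + N); split; first exact: measurable_funD.
  split; first by move=> y; rewrite (le_trans (ler_normD _ _))// lerD.
  under eq_Rintegral do rewrite /= mulrDl.
  rewrite RintegralD ?ef ?eg//; [|exact: bQI fM|exact: bQI gN].
  by rewrite RintegralD ?mulrDl//; [exact: bI fM|exact: bI gN].
- move=> a f [M [mf [fM ef]]]; exists (`|a| * M); split; first by apply: measurable_funM.
  split; first by move=> y; rewrite normrM ler_wpM2l.
  under eq_Rintegral do rewrite -mulrA.
  by rewrite RintegralZl ?ef ?RintegralZl ?mulrA//; [exact: bI fM|exact: bQI fM].
- move=> f_ f M good_f mf_ fM ff.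
  have mf : measurable_fun setT f by apply: (measurable_fun_cvg mf_) => x _; exact: ff.
  have fM' y : `|f y| <= M.
    by apply: (norm_cvg_le (fun n => fM n y) (ff y)).
  exists M; split => //; split => //.
  have [_ c1] := @bounded_cvg _ _ _ P (fun n x => f_ n (psi x)) _ M (fun n => mc _ (mf_ n)) (fun n x => fM n _) (fun x => ff _).
  have [|||_ c2] := @bounded_cvg _ _ _ P (fun n x => f_ n (psi x) * Q x) (fun x => f (psi x) * Q x) (M * C).
  + by move=> n; apply: measurable_funM => //; exact: mc.
  + by move=> n x; rewrite normrM ler_pM.
  + by move=> x; apply: cvgMr_tmp; exact: ff.
  have c3 : (fun n => \int[P]_x f_ n (psi x) * \int[P]_x Q x) @ \oo -->
      \int[P]_x f (psi x) * \int[P]_x Q x by apply: cvgMr_tmp; exact: c1.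
  rewrite (_ : (fun n => _) = fun n => \int[P]_x f_ n (psi x) * \int[P]_x Q x) in c2.
    exact: (cvg_unique _ c2 c3).
  by apply/funext => n; have [? [_ [_ ->]]] := good_f n.
Qed.

(** Independence is given through finite intersections with one event per index, so a partial sum
    and the next variable are not known to be independent as such. Carrying an arbitrary event [B]
    built from the remaining indices through the induction replaces a grouping argument. *)
Lemma independent_charfun (F : nat -> set (set T)) (Z : nat -> T -> R) (a b : nat -> R) :
  mutually_independent P F ->
  (forall j, measurable_fun setT (Z j)) ->
  (forall j B, measurable B -> F j (Z j @^-1` B)) ->
  (forall j A, F j A -> measurable A) ->
  (forall j, \int[P]_x cos (Z j x) = expR (a j) * cos (b j)) ->
  (forall j, \int[P]_x sin (Z j x) = expR (a j) * sin (b j)) ->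
  forall n,
    \int[P]_x cos (\sum_(j < n) Z j x) = expR (\sum_(j < n) a j) * cos (\sum_(j < n) b j) /\
    \int[P]_x sin (\sum_(j < n) Z j x) = expR (\sum_(j < n) a j) * sin (\sum_(j < n) b j).
Proof.
move=> indF mZ FZ mF Zcos Zsin n.
pose S n x := \sum_(j < n) Z j x.
have mS m : measurable_fun setT (S m) by exact: measurable_sum.
have mcos (f : T -> R) : measurable_fun setT f -> measurable_fun setT (fun x => cos (f x)).
  move=> mf; apply: measurableT_comp mf; apply: continuous_measurable_fun; exact: continuous_cos.
have msin (f : T -> R) : measurable_fun setT f -> measurable_fun setT (fun x => sin (f x)).
  move=> mf; apply: measurableT_comp mf; apply: continuous_measurable_fun; exact: continuous_sin.
have bI (A : set T) (f : T -> R) : measurable A -> measurable_fun setT f -> (forall x, `|f x| <= 1) ->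
    P.-integrable A (EFin \o f).
  by move=> mA mf f1; exact: bounded_integrable f1.
have claim (m : nat) : forall (J : {fset nat}) (A : nat -> set T), (forall i, i \in J -> (m <= i)%N /\ F i (A i)) ->
   let B := \bigcap_(i in [set` J]) A i in
   \int[P]_(x in B) cos (S m x) = expR (\sum_(j < m) a j) * cos (\sum_(j < m) b j) * fine (P B) /\
   \int[P]_(x in B) sin (S m x) = expR (\sum_(j < m) a j) * sin (\sum_(j < m) b j) * fine (P B).
  elim: m => [|m IH] J A JA B.
    rewrite !big_ord0 expR0 cos0 sin0 !mul1r mul0r.
    have mB : measurable B.
      by apply: fin_bigcap_measurable => // i iJ; apply: (mF i); exact: (JA _ iJ).2.
    under eq_Rintegral do rewrite /S big_ord0 cos0.
    under [X in _ /\ X = _]eq_Rintegral do rewrite /S big_ord0 sin0.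
    by rewrite !Rintegral_cst// mul1r mul0r.
  have mB : measurable B.
    by apply: fin_bigcap_measurable => // i iJ; apply: (mF i); exact: (JA _ iJ).2.
  have mNJ : m \notin J by apply/negP => /JA[]; rewrite ltnn.
  have [IHc IHs] := IH J A (fun i iJ => conj (ltnW (JA i iJ).1) (JA i iJ).2).
  have ind (phi : R -> R) : measurable_fun setT phi -> (forall y, `|phi y| <= 1) ->
      \int[P]_(x in B) (phi (Z m x) * cos (S m x)) =
        \int[P]_x phi (Z m x) * \int[P]_(x in B) cos (S m x) /\
      \int[P]_(x in B) (phi (Z m x) * sin (S m x)) =
        \int[P]_x phi (Z m x) * \int[P]_(x in B) sin (S m x).
    move=> mphi phi1.
    have key (f : T -> R) : measurable_fun setT f -> (forall x, `|f x| <= 1) ->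
        (forall C, measurable C -> \int[P]_(x in Z m @^-1` C `&` B) f x =
            fine (P (Z m @^-1` C)) * \int[P]_(x in B) f x) ->
        \int[P]_(x in B) (phi (Z m x) * f x) = \int[P]_x phi (Z m x) * \int[P]_(x in B) f x.
      move=> mf f1 fC.
      transitivity (\int[P]_x (phi (Z m x) * (\1_B x * f x))).
        by rewrite -Rintegral_indicM//; apply: eq_Rintegral => x _; rewrite mulrCA.
      rewrite -[X in _ = _ * X]Rintegral_indicM//.
      apply: (@independent_expectation _ _ 1) mphi phi1 => //.
      - by apply: measurable_funM => //; exact: measurable_indic.
      - move=> x; rewrite normrM -[1]mulr1 ler_pM// indicE.
        by case: (_ \in _); rewrite ?normr1 ?normr0.
      - move=> C mC; have mZC : measurable (Z m @^-1` C) by rewrite -[_ @^-1` _]setTI; exact: mZ.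
        rewrite Rintegral_indicM// -fC// -Rintegral_indicM// -[RHS]Rintegral_indicM//; last exact: measurableI.
        by apply: eq_Rintegral => x _; rewrite indicI mulrA.
    (* Intersecting [B] with an event on [Z m] gives again an intersection over indices at least
       [m], so the induction hypothesis for [m] covers it too. *)
    have JC (C : set R) : measurable C -> let A' i := if i == m then Z m @^-1` C else A i in
        (forall i, i \in (m |` J)%fset -> (m <= i)%N /\ F i (A' i)) /\
        \bigcap_(i in [set` (m |` J)%fset]) A' i = Z m @^-1` C `&` B /\
        P (Z m @^-1` C `&` B) = (P (Z m @^-1` C) * P B)%E.
      move=> mC A'.
      have A'J i : i \in J -> A' i = A i.
        by move=> iJ; rewrite /A'; case: eqP => // e; move: mNJ; rewrite -e iJ.
      have H1 i : i \in (m |` J)%fset -> (m <= i)%N /\ F i (A' i).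
        rewrite in_fset1U => /orP[/eqP ->|iJ]; first by rewrite /A' eqxx; split => //; exact: FZ.
        by rewrite A'J//; have [/ltnW] := JA _ iJ.
      have H2 : \bigcap_(i in [set` (m |` J)%fset]) A' i = Z m @^-1` C `&` B.
        apply/seteqP; split => [x h|x [h1 h2] i /=].
          split; first by have := h m; rewrite /A' eqxx; apply; rewrite /= in_fset1U eqxx.
          by move=> i iJ; rewrite -(A'J i iJ); apply: h; rewrite /= in_fset1U iJ orbT.
        rewrite in_fset1U => /orP[/eqP ->|iJ]; first by rewrite /A' eqxx.
        by rewrite A'J//; exact: h2.
      split=> //; split=> //; rewrite -H2 indF; last by move=> i /H1[].
      rewrite big_fsetU1//= /A' eqxx; congr (_ * _)%E.
      rewrite /B indF; last by move=> i /JA[].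
      by apply: eq_fbigr => i iJ _; congr (P _); exact: (A'J i iJ).
    have fPM C : measurable C -> fine (P (Z m @^-1` C `&` B)) = fine (P (Z m @^-1` C)) * fine (P B).
      move=> mC; have [_ [_ ->]] := JC _ mC; rewrite fineM//; apply: fin_num_measure => //.
      by rewrite -[_ @^-1` _]setTI; exact: mZ.
    split; apply: key => //; try (by move=> x; rewrite ?cos_max ?sin_max); [exact: mcos| |exact: msin|].
      move=> C mC; have [JA' [JB _]] := JC _ mC; have [hc _] := IH _ _ JA'.
      by move: hc; rewrite /= JB => ->; rewrite IHc fPM//; ring.
    move=> C mC; have [JA' [JB _]] := JC _ mC; have [_ hs] := IH _ _ JA'.
    by move: hs; rewrite /= JB => ->; rewrite IHs fPM//; ring.
  have mc : measurable_fun setT (@cos R) by apply: continuous_measurable_fun; exact: continuous_cos.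
  have ms : measurable_fun setT (@sin R) by apply: continuous_measurable_fun; exact: continuous_sin.
  have [cc cs] := ind _ mc (@cos_max _).
  have [sc ss] := ind _ ms (@sin_max _).
  have I2 (f g : T -> R) : measurable_fun setT f -> measurable_fun setT g ->
     (forall x, `|f x| <= 1) -> (forall x, `|g x| <= 1) ->
     P.-integrable B (EFin \o (fun x => f x * g x)).
    move=> mf mg f1 g1; apply: bI => //; first exact: measurable_funM.
    by move=> x; rewrite normrM -[1]mulr1 ler_pM.
  have mcZ := mcos _ (mZ m); have msZ := msin _ (mZ m).
  have mcS := mcos _ (mS m); have msS := msin _ (mS m).
  have cZ x : `|cos (Z m x)| <= 1 by exact: cos_max.
  have sZ x : `|sin (Z m x)| <= 1 by exact: sin_max.
  have cS x : `|cos (S m x)| <= 1 by exact: cos_max.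
  have sS x : `|sin (S m x)| <= 1 by exact: sin_max.
  rewrite !big_ord_recr/= expRD cosD sinD; split.
    under eq_Rintegral do rewrite /S big_ord_recr/= addrC cosD.
    rewrite RintegralB//; [|exact: I2|exact: I2].
    by rewrite cc ss Zcos Zsin IHc IHs; ring.
  under eq_Rintegral do rewrite /S big_ord_recr/= addrC sinD.
  rewrite RintegralD//; [|exact: I2|exact: I2].
  by rewrite sc cs Zcos Zsin IHc IHs; ring.
have /= := claim n fset0 (fun _ => setT) (fun i (h : i \in fset0) => False_ind _ (notF h)).
rewrite set_fset0 bigcap_set0 (probability_setT P) !mulr1.
by [].

Qed.

End independence.

(** * Poisson variables *)

Section poisson.
Context {R : realType}.
Implicit Types (al : nat -> R) (t c m : R).

(** Exponential generating function of [al]. Differentiation shifts the sequence, which turns the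
    addition formulas for cos and sin into a linear differential system. *)
Definition fps al t : R := limn (pseries (fun k => al k / k`!%:R) t).

Lemma fps_cvg al t : (forall k, `|al k| <= 1) ->
  pseries (fun k => al k / k`!%:R) t @ \oo --> fps al t.
Proof.
move=> al1; apply: normed_cvg.
apply: series_le_cvg (is_cvg_series_exp_coeff `|t|) => n /=; first by [].
  by rewrite exp_coeff_ge0.
rewrite /exp_coeff/= -mulrA normrM -[leRHS]mul1r ler_pM//.
by rewrite normrM normrX normfV normr_nat mulrC.
Qed.

Lemma pseries_diffs_fps al :
  pseries_diffs (fun k => al k / k`!%:R) = (fun k => al k.+1 / k`!%:R).
Proof.
apply/funext => k; rewrite /pseries_diffs factS natrM; field.
by rewrite nat1r !pnatr_eq0 -lt0n fact_gt0.
Qed.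

Lemma is_derive_fps al t : (forall k, `|al k| <= 1) ->
  is_derive t 1 (fps al) (fps (fun k => al k.+1) t).
Proof.
move=> al1; rewrite /fps -pseries_diffs_fps.
have cv (be : nat -> R) : (forall k, `|be k| <= 1) ->
    cvgn (pseries (fun k => be k / k`!%:R) (`|t| + 1)).
  by move=> be1; apply/cvg_ex; eexists; exact: fps_cvg.
apply: (@pseries_snd_diffs _ _ (`|t| + 1)); rewrite ?pseries_diffs_fps//; [exact: cv..|].
by rewrite [ltRHS]ger0_norm// ltrDl.
Qed.

Lemma fps_lin al be t a b : (forall k, `|al k| <= 1) -> (forall k, `|be k| <= 1) ->
  fps (fun k => a * al k + b * be k) t = a * fps al t + b * fps be t.
Proof.
move=> al1 be1; apply/cvg_lim => //.
rewrite (_ : pseries _ _ = fun n => a * pseries (fun k => al k / k`!%:R) t n +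
   b * pseries (fun k => be k / k`!%:R) t n).
  by apply: cvgD; apply: cvgMl_tmp; exact: fps_cvg.
apply/funext => n; rewrite /pseries/series/= !mulr_sumr -big_split/=.
by apply: eq_bigr => i _; ring.
Qed.

Lemma fps0 al : fps al 0 = al 0%N.
Proof.
apply/cvg_lim => //; rewrite -cvg_shiftS/=.
rewrite (_ : (fun n => _) = cst (al 0%N)); first exact: cvg_cst.
apply/funext => n; rewrite /pseries/series/= big_nat_recl//= expr0 fact0 mulr1 divr1.
by rewrite big1 ?addr0// => i _; rewrite exprS mul0r mulr0.
Qed.

(** Real and imaginary parts of sum_k e^(ick) t^k / k! = exp (t e^(ic)), obtained by solving the
    system for the two generating functions. *)
Lemma fps_cos_sin c t :
  fps (fun k => cos (c * k%:R)) t = expR (t * cos c) * cos (t * sin c) /\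
  fps (fun k => sin (c * k%:R)) t = expR (t * cos c) * sin (t * sin c).
Proof.
pose A := fps (fun k => cos (c * k%:R)); pose B := fps (fun k => sin (c * k%:R)).
have c1 k : `|cos (c * k%:R)| <= 1 by exact: cos_max.
have s1 k : `|sin (c * k%:R)| <= 1 by exact: sin_max.
have dA (s : R) : is_derive s 1 A (cos c * A s + (- sin c) * B s).
  rewrite -fps_lin//; apply: is_derive_eq; first exact: is_derive_fps.
  by congr (fps _ s); apply/funext => k; rewrite -natr1 mulrDr mulr1 addrC cosD; ring.
have dB (s : R) : is_derive s 1 B (sin c * A s + cos c * B s).
  rewrite -fps_lin//; apply: is_derive_eq; first exact: is_derive_fps.
  by congr (fps _ s); apply/funext => k; rewrite -natr1 mulrDr mulr1 addrC sinD; ring.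
have dl (a s : R) : is_derive s 1 (fun x : R => x * a) a by apply: is_derive_eq; rewrite /GRing.scale/=; ring.
have dcos (s : R) : is_derive s 1 (fun x : R => cos (x * sin c)) (- sin (s * sin c) * sin c).
  exact: (@is_derive1_comp _ cos (fun x : R => x * sin c)).
have dsin (s : R) : is_derive s 1 (fun x : R => sin (x * sin c)) (cos (s * sin c) * sin c).
  exact: (@is_derive1_comp _ sin (fun x : R => x * sin c)).
have dexp (s : R) : is_derive s 1 (fun x : R => expR (x * - cos c)) (expR (s * - cos c) * - cos c).
  exact: (@is_derive1_comp _ expR (fun x : R => x * - cos c)).
(* [U] and [V] are the real and imaginary parts of (A + iB) exp (- s e^(ic)), which is constant. *)
pose U (s : R) : R := expR (s * - cos c) * (A s * cos (s * sin c) + B s * sin (s * sin c)).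
pose V (s : R) : R := expR (s * - cos c) * (B s * cos (s * sin c) - A s * sin (s * sin c)).
have dU (s : R) : is_derive s 1 U 0 by apply: is_derive_eq; rewrite /GRing.scale/=; ring.
have dV (s : R) : is_derive s 1 V 0 by apply: is_derive_eq; rewrite /GRing.scale/=; ring.
have := is_derive_0_is_cst 0 t dU; have := is_derive_0_is_cst 0 t dV.
rewrite /U /V !mul0r expR0 cos0 sin0 /A /B !fps0 !mulr0 cos0 sin0 -/A -/B.
rewrite mulrN expRN => hV hU.
have e0 : expR (t * cos c) != 0 by rewrite expR_eq0.
have hU' : A t * cos (t * sin c) + B t * sin (t * sin c) = expR (t * cos c).
  by apply: (mulfI (invr_neq0 e0)); rewrite -hU mulVf//; ring.
have hV' : B t * cos (t * sin c) - A t * sin (t * sin c) = 0.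
  apply: (mulfI (invr_neq0 e0)); rewrite -hV; ring.
have := cos2Dsin2 (t * sin c); move: hU' hV'.
rewrite -/A -/B; move: (A t) (B t) (cos (t * sin c)) (sin (t * sin c)) (expR _) => a b p q e h1 h2 h3.
(* [h1] and [h2] say that (a, b) rotated by the angle - t sin c is (e, 0); expanding with p^2 + q^2
   = 1 rotates it back. *)
split.
- transitivity (a * (p ^+ 2 + q ^+ 2)); first by rewrite h3 mulr1.
  by rewrite -h1 -[RHS]subr0 -[X in _ - X](mulr0 q) -h2; ring.
- transitivity (b * (p ^+ 2 + q ^+ 2)); first by rewrite h3 mulr1.
  by rewrite -h1 -[RHS]addr0 -[X in _ = _ + X](mulr0 p) -h2; ring.
Qed.

End poisson.

Section poisson_variable.
Context d (T : measurableType d) (R : realType) (P : probability T R).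
Variables (N : T -> R) (m : R).
Hypotheses (mN : measurable_fun setT N) (N_nat : forall x, N x \is a Num.nat).
Hypothesis N_poisson : forall k, P [set x | N x = k%:R] = (poisson_mass m k)%:E.

Let Ntrunc x : N x = (Num.truncn (N x))%:R.
Proof. by have /natrP[k ->] := N_nat x; rewrite natrK. Qed.

(** The partial sums are the expectations of phi (N) on the event N < n; this variable is bounded by
    [C] and equals phi (N) as soon as n exceeds N. *)
Lemma poisson_expectation (phi : R -> R) (C : R) : measurable_fun setT phi ->
  (forall y, `|phi y| <= C) ->
  series (fun k => phi k%:R * poisson_mass m k) @ \oo --> \int[P]_x phi (N x).
Proof.
move=> mphi phiC.
pose f n x := \sum_(0 <= k < n) phi k%:R * \1_[set x | N x = k%:R] x.
have fE n x : f n x = if (Num.truncn (N x) < n)%N then phi (N x) else 0.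
  rewrite /f; set k := Num.truncn (N x).
  have ne i : i != k -> \1_[set x | N x = i%:R] x = 0 :> R.
    move=> ik; rewrite indicE memNset//= Ntrunc -/k => /eqP.
    by rewrite eqr_nat eq_sym (negbTE ik).
  case: ltnP => [kn|nk].
    rewrite (bigD1_seq k)/=; last 2 first.
      by rewrite mem_index_iota.
      exact: iota_uniq.
    rewrite big1 ?addr0; last by move=> i ik; rewrite ne ?mulr0.
    by rewrite indicE mem_set ?mulr1 /k -?Ntrunc.
  rewrite big_nat big1// => i /andP[_ iN]; rewrite ne ?mulr0//.
  by rewrite neq_ltn (leq_trans iN).
have mset k : measurable [set x | N x = k%:R].
  by rewrite -[X in measurable X]setTI; exact: (mN measurableT (measurable_set1 k%:R)).
have mind k : measurable_fun setT (fun x => phi k%:R * \1_[set x | N x = k%:R] x).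
  by apply: measurable_funM => //; exact: measurable_indic.
have mf n : measurable_fun setT (f n) by exact: measurable_sum.
have C0 : 0 <= C by rewrite (le_trans _ (phiC 0)).
have [_] : measurable_fun setT (fun x => phi (N x)) /\
     (fun n => \int[P]_x f n x) @ \oo --> \int[P]_x phi (N x).
  apply: (@bounded_cvg _ _ _ P f _ C mf).
    by move=> n x; rewrite fE; case: ifP => _ //; rewrite normr0.
  move=> x; apply: cvg_near_cst; exists (Num.truncn (N x)).+1 => // n /= kn.
  by rewrite fE kn.
rewrite (_ : (fun n => _) = series (fun k => phi k%:R * poisson_mass m k))//.
apply/funext => n; rewrite /series/=; elim: n => [|n IH].
  by rewrite big_nil /f; under eq_Rintegral do rewrite big_nil; rewrite Rintegral_cst// mul0r.
rewrite big_nat_recr//= -IH /f; under eq_Rintegral do rewrite big_nat_recr//=.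
have bI n' : P.-integrable setT (EFin \o f n').
  apply: (@bounded_integrable _ _ _ _ _ _ C) => // x.
  by rewrite fE; case: ifP => _ //; rewrite normr0.
have iI : P.-integrable setT (EFin \o (\1_[set x | N x = n%:R] : T -> R)).
  apply: (@bounded_integrable _ _ _ _ _ _ 1) => // x; rewrite indicE; by case: (_ \in _); rewrite ?normr1 ?normr0.
rewrite RintegralD//=; first last.
- apply: (@bounded_integrable _ _ _ _ _ _ C) => // x.
  rewrite normrM -[C]mulr1 ler_pM// indicE; by case: (_ \in _); rewrite ?normr1 ?normr0.
- exact: bI.
congr (_ + _); rewrite RintegralZl//; congr (_ * _).
by rewrite /Rintegral integral_indic// setIT [X in fine X](N_poisson n).
Qed.

Lemma poisson_charfun c :
  \int[P]_x cos (c * N x) = expR (m * (cos c - 1)) * cos (m * sin c) /\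
  \int[P]_x sin (c * N x) = expR (m * (cos c - 1)) * sin (m * sin c).
Proof.
have mul : measurable_fun setT (fun y : R => c * y) by exact: measurable_funM.
have [hc hs] := fps_cos_sin c m.
have key (phi : R -> R) : measurable_fun setT phi -> (forall y, `|phi y| <= 1) ->
    \int[P]_x phi (c * N x) = fps (fun k => phi (c * k%:R)) m * expR (- m).
  move=> mphi phi1.
  have := @poisson_expectation (fun y => phi (c * y)) 1 (measurableT_comp mphi mul) (fun y => phi1 _).
  move=> /cvg_unique; apply => //.
  rewrite (_ : series _ = fun n => pseries (fun k => phi (c * k%:R) / k`!%:R) m n * expR (- m)).
    by apply: cvgMr_tmp; exact: fps_cvg.
  apply/funext => n; rewrite /pseries /series/= mulr_suml; apply: eq_bigr => i _.
  by rewrite /poisson_mass; ring.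
have e : expR (m * (cos c - 1)) = expR (m * cos c) * expR (- m).
  by rewrite mulrBr mulr1 expRD.
rewrite e; split.
- by rewrite (key cos) ?hc; [ring|apply: continuous_measurable_fun; exact: continuous_cos|exact: cos_max].
- by rewrite (key sin) ?hs; [ring|apply: continuous_measurable_fun; exact: continuous_sin|exact: sin_max].
Qed.

Lemma poisson_mean : 0 <= m -> (\int[P]_x (N x)%:E = m%:E)%E.
Proof.
move=> m0.
have N0 x : 0 <= N x by rewrite Ntrunc.
pose F k := [set x | N x = k%:R].
have mF k : measurable (F k).
  by rewrite -[X in measurable X]setTI; exact: (mN measurableT (measurable_set1 k%:R)).
have UF : setT = \bigcup_k F k.
  by apply/seteqP; split => // x _; exists (Num.truncn (N x)) => //; exact: Ntrunc.
have tF : trivIset setT F.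
  apply/trivIsetP => i j _ _ ij; apply/seteqP; split => // x [].
  by rewrite /F/= => -> /eqP; rewrite eqr_nat (negbTE ij).
have mNE : measurable_fun (\bigcup_k F k) (EFin \o N) by rewrite -UF; exact/measurable_EFinP.
rewrite UF ge0_integral_bigcup//=.
  have FE k : (\int[P]_(x in F k) (N x)%:E = (k%:R * poisson_mass m k)%:E)%E.
    rewrite (eq_integral (cst k%:R%:E)); last by move=> x; rewrite inE /F /= => ->.
    by rewrite integral_cst// [X in (_ * X)%E](N_poisson k).
  under eq_eseriesr do rewrite FE.
  apply/cvg_lim => //.
  have : (EFin \o (fun n => m * expR (- m) * series (exp_coeff m) n)) @ \oo --> m%:E.
    apply: cvg_EFin; first exact: nearW.
    rewrite [X in _ --> X](_ : m = m * expR (- m) * expR m); last first.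
      by rewrite -mulrA -expRD addNr expR0 mulr1.
    apply: cvgMl_tmp; exact: is_cvg_series_exp_coeff.
  (* The term k = 0 vanishes; after the shift, k m^k / k! gives m times the exponential series. *)
  rewrite -(cvg_shiftS (fun n => (\sum_(0 <= k < n) _)%E)).
  apply: cvg_trans; apply: near_eq_cvg; near=> n => /=.
  rewrite big_nat_recl//= mul0r add0e sumEFin; congr EFin.
  rewrite /series/= mulr_sumr; apply: eq_bigr => i _.
  rewrite /poisson_mass /exp_coeff/= factS exprS natrM; field.
  by rewrite nat1r !pnatr_eq0 -lt0n fact_gt0.
by move=> x _; rewrite lee_fin.
Unshelve. all: by end_near. Qed.

End poisson_variable.

(** * Step functions and their bounded closure *)

Section dyadic_steps.
Context {R : realType} (s t : R).
Implicit Types (x : R) (N i : nat) (c : nat -> R).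

Definition grid N i : R := s + (t - s) * i%:R / 2 ^+ N.

(** Open on the left and closed on the right: on such intervals the path measure is exactly an
    increment of the path. *)
Definition cell N i : set R := `]grid N i, grid N i.+1]%classic.

Definition step N c x : R := \sum_(i < 2 ^ N) c i * \1_(cell N i) x.

Lemma grid0 N : grid N 0 = s.
Proof. by rewrite /grid mulr0 mul0r addr0. Qed.

Lemma gridT N : grid N (2 ^ N) = t.
Proof. by rewrite /grid natrX mulfK ?subrKC// expf_neq0. Qed.

Lemma gridS N i : grid N i.+1 = grid N i + (t - s) / 2 ^+ N.
Proof. by rewrite /grid -natr1; ring. Qed.

Lemma grid_double N i : grid N.+1 i.*2 = grid N i.
Proof.
rewrite /grid exprS -muln2 natrM; field.
by rewrite expf_neq0.
Qed.

Hypothesis st : s < t.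

Lemma grid_le N i j : (grid N i <= grid N j) = (i <= j)%N.
Proof.
rewrite /grid lerD2l ler_pM2r ?invr_gt0 ?exprn_gt0// ler_pM2l ?subr_gt0//.
by rewrite ler_nat.
Qed.

Lemma cell_uniq N i j x : cell N i x -> cell N j x -> i = j.
Proof.
rewrite /cell /= !in_itv/= => /andP[a b] /andP[c e].
have : ~~ (grid N i.+1 <= grid N j) by rewrite -ltNge (lt_le_trans c).
have : ~~ (grid N j.+1 <= grid N i) by rewrite -ltNge (lt_le_trans a).
by rewrite !grid_le -!leqNgt => ? ?; apply/eqP; rewrite eqn_leq; apply/andP.
Qed.

Lemma cell_exists N x : `]s, t]%classic x -> exists2 i, (i < 2 ^ N)%N & cell N i x.
Proof.
rewrite /= in_itv/= => /andP[sx xt].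
have ex : exists k, x <= grid N k by exists (2 ^ N)%N; rewrite gridT.
case: (ex_minnP ex) => -[|k] xk kmin; first by move: xk; rewrite grid0 leNgt sx.
exists k; first by apply: kmin; rewrite gridT.
by rewrite /cell/= in_itv/= xk andbT ltNge; apply/negP => /kmin; rewrite ltnn.
Qed.

Lemma cell_sub N i : (i < 2 ^ N)%N -> cell N i `<=` `]s, t].
Proof.
move=> iN x; rewrite /cell /= !in_itv/= => /andP[a b].
rewrite (le_lt_trans _ a)/=; last by rewrite -(grid0 N) grid_le.
by rewrite (le_trans b)// -(gridT N) grid_le.
Qed.

Lemma step_cell N c i x : (i < 2 ^ N)%N -> cell N i x -> step N c x = c i.
Proof.
move=> iN ix; rewrite /step (bigD1 (Ordinal iN))//= indicE mem_set// mulr1.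
rewrite big1 ?addr0// => j ji; rewrite indicE memNset ?mulr0// => jx.
by move/eqP: ji; apply; apply: val_inj => /=; exact: cell_uniq jx ix.
Qed.

Lemma step_out N c x : ~ `]s, t]%classic x -> step N c x = 0.
Proof.
move=> xst; rewrite /step big1// => i _; rewrite indicE memNset ?mulr0// => ix.
by apply: xst; apply: cell_sub ix.
Qed.

Lemma step_comp N c (phi : R -> R) x : phi 0 = 0 ->
  phi (step N c x) = step N (phi \o c) x.
Proof.
move=> phi0; have [|xst] := pselect (`]s, t]%classic x); last by rewrite !step_out.
by move=> /(cell_exists N)[i iN ix]; rewrite !(step_cell _ iN ix).
Qed.

Lemma step_refine N c : step N c = step N.+1 (fun i => c i./2).
Proof.
apply/funext => x; have [|xst] := pselect (`]s, t]%classic x); last by rewrite !step_out.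
move=> /(cell_exists N.+1)[i iN ix]; rewrite (step_cell _ iN ix).
have iN2 : (i./2 < 2 ^ N)%N by rewrite ltn_half_double -mul2n -expnS.
(* Twice [i./2] is [i] up to its parity, so the coarse cell contains the fine one in both cases. *)
apply: step_cell iN2 _; move: ix; rewrite /cell/= !in_itv/= => /andP[a b].
apply/andP; split.
  by apply: le_lt_trans a; rewrite -grid_double grid_le -[leqRHS]odd_double_half leq_addl.
by apply: (le_trans b); rewrite -[leRHS]grid_double grid_le doubleS -[in leqLHS](odd_double_half i); case: odd.
Qed.

Lemma step_refine_le M N c : (N <= M)%N -> exists c', step N c = step M c'.
Proof.
move=> /subnK <-; elim: (M - N)%N => [|k [c' ->]]; first by exists c.
by exists (fun i => c' i./2); rewrite addSn step_refine.
Qed.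

(* The closure of the dyadic step functions under bounded pointwise limits. Being
   defined inductively, it inherits closure under sums from the step functions. *)
Inductive step_closure : (R -> R) -> Prop :=
| step_closure_step N c : step_closure (step N c)
| step_closure_lim (f_ : nat -> R -> R) (f : R -> R) (C : R) :
    (forall n, step_closure (f_ n)) -> (forall n x, `|f_ n x| <= C) ->
    (forall x, f_ ^~ x @ \oo --> f x) -> step_closure f.

Lemma step_bounded N c : exists C, forall x, `|step N c x| <= C.
Proof.
exists (\sum_(i < 2 ^ N) `|c i|) => x; rewrite /step (le_trans (ler_norm_sum _ _ _))//.
apply: ler_sum => i _; rewrite normrM ler_piMr// indicE.
by case: (_ \in _); rewrite ?normr1 ?normr0.
Qed.

Lemma step_closure_bounded f : step_closure f -> exists C, forall x, `|f x| <= C.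
Proof.
move=> [N c|f_ g C _ fC fg]; first exact: step_bounded.
by exists C => x; apply: norm_cvg_le (fg x) => n; exact: fC.
Qed.

Lemma step_closure_out f x : step_closure f -> ~ `]s, t]%classic x -> f x = 0.
Proof.
move=> Vf xst; elim: Vf => [N c|f_ g C _ fE _ fg]; first exact: step_out.
by have := fg x; under eq_fun do rewrite fE; move=> /cvg_unique; apply => //; exact: cvg_cst.
Qed.

Lemma step_closure_measurable f : step_closure f -> measurable_fun setT f.
Proof.
elim=> [N c|f_ g C _ mf _ fg].
  apply: measurable_sum => i; apply: measurable_funM => //.
  by apply: measurable_indic; exact: measurable_itv.
by apply: (measurable_fun_cvg mf) => x _; exact: fg.
Qed.

(** Induction on both derivations. Two step functions are brought to the finer of their levels; in a
    limit case the other summand is kept fixed, and its bound is needed to keep the sums uniformly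
    bounded. *)
Lemma step_closureD f g : step_closure f -> step_closure g -> step_closure (f \+ g).
Proof.
move=> Vf; elim: Vf g => [N c|f_ f' C _ IH fC ff'] g Vg.
  elim: Vg => [M c'|g_ g' C _ IH gC gg'].
    have [c1 ->] := step_refine_le c (leq_maxl N M).
    have [c2 ->] := step_refine_le c' (leq_maxr N M).
    rewrite (_ : _ \+ _ = step (maxn N M) (c1 \+ c2)); first exact: step_closure_step.
    by apply/funext => x /=; rewrite /step -big_split; apply: eq_bigr => i _ /=; rewrite mulrDl.
  have [K cK] := step_bounded N c.
  apply: (step_closure_lim (C := K + C) IH) => [n x|x].
    by rewrite (le_trans (ler_normD _ _))// lerD.
  by apply: cvgD; [exact: cvg_cst|exact: gg'].
have [K gK] := step_closure_bounded Vg.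
apply: (step_closure_lim (C := C + K) (fun n => IH n _ Vg)) => [n x|x].
  by rewrite (le_trans (ler_normD _ _))// lerD.
by apply: cvgD; [exact: ff'|exact: cvg_cst].
Qed.

Lemma step_closureZ a f : step_closure f -> step_closure (fun x => a * f x).
Proof.
elim => [N c|f_ f' C _ IH fC ff'].
  rewrite (_ : (fun x => _) = step N (fun i => a * c i)); first exact: step_closure_step.
  by apply/funext => x; rewrite /step mulr_sumr; apply: eq_bigr => i _; rewrite mulrA.
apply: (step_closure_lim (C := `|a| * C) IH) => [n x|x].
  by rewrite normrM ler_wpM2l.
by apply: cvgMl_tmp; exact: ff'.
Qed.

(** At level N keep the cells whose left end is at least [a]. No point x <= a is ever covered, and a
    point x > a of the window is covered once the mesh is at most x - a. *)
Lemma step_closure_ray a : step_closure \1_(`]a, +oo[ `&` `]s, t]).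
Proof.
pose c N i : R := (a <= grid N i)%R%:R.
apply: (@step_closure_lim (fun N => step N (c N)) _ 1).
- by move=> N; exact: step_closure_step.
- move=> N x; have [|xst] := pselect (`]s, t]%classic x); last by rewrite step_out// normr0.
  move=> /(cell_exists N)[i iN ix]; rewrite (step_cell _ iN ix) /c.
  by case: (a <= _); rewrite ?normr1 ?normr0.
- move=> x; have [xst|xst] := pselect (`]s, t]%classic x); last first.
    rewrite indicE memNset; last by case.
    by under eq_fun do rewrite step_out//; exact: cvg_cst.
  have [ax|xa] := ltP a x; last first.
    rewrite indicE memNset; last by case=> /=; rewrite in_itv/= andbT ltNge xa.
    rewrite (_ : (fun N => _) = cst 0); first exact: cvg_cst.
    apply/funext => N; have [i iN ix] := cell_exists N xst.
    rewrite (step_cell _ iN ix) /c leNgt.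
    by move: ix; rewrite /cell/= in_itv/= => /andP[/lt_le_trans -> ].
  rewrite indicE mem_set; last by split => //=; rewrite in_itv/= andbT.
  apply: cvg_near_cst; near=> N.
  have [i iN ix] := cell_exists N xst; rewrite (step_cell _ iN ix) /c.
  suff -> : a <= grid N i by [].
  move: ix; rewrite /cell/= in_itv/= gridS => /andP[_ xi].
  suff : (t - s) / 2 ^+ N <= x - a by move: xi; lra.
  rewrite ler_pdivrMr ?exprn_gt0// -ler_pdivrMl ?subr_gt0//.
  apply: (@le_trans _ _ N%:R).
    by near: N; exact: nbhs_infty_ger.
  by rewrite -natrX ler_nat ltnW// ltn_expl.
Unshelve. all: by end_near. Qed.

(** Dynkin's theorem: the rays ]a, +oo[ are stable under intersection and generate the Borel sets;
    proper differences come from the linear structure of the closure, increasing unions from its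
    bounded limits. *)
Lemma step_closure_indic A : measurable A -> step_closure \1_(A `&` `]s, t]).
Proof.
pose H := [set A : set R | step_closure \1_(A `&` `]s, t])].
move=> mA; have : (@RGenOInfty.G R).-sigma.-measurable A by rewrite -RGenOInfty.measurableE.
apply: (@lambda_system_subset _ _ _ setT H) => //.
- move=> _ _ [a ->] [b ->]; exists (Num.max a b); apply/seteqP; split => x /=;
    rewrite !in_itv/= !andbT gt_max; first by case=> -> ->.
  by move=> /andP[].
- split => //.
  + rewrite /H/= setTI (_ : \1_ _ = step 0 (cst 1)); first exact: step_closure_step.
    apply/funext => x; have [xst|xst] := pselect (`]s, t]%classic x); last first.
      by rewrite step_out// indicE memNset.
    by have [i iN ix] := cell_exists 0 xst; rewrite (step_cell _ iN ix) indicE mem_set.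
  + move=> {A mA} A B BA VA VB; rewrite /H/=.
    rewrite (_ : \1_ _ = \1_(A `&` `]s, t]) \+ (fun x => (-1) * \1_(B `&` `]s, t]) x)).
      by apply: step_closureD => //; exact: step_closureZ.
    apply/funext => x /=; rewrite !indicE setDE !in_setI in_setC.
    have : x \in B -> x \in A by rewrite !inE; exact: BA.
    by case: (x \in A); case: (x \in B); case: (x \in _) => //= h; try ring; have := h erefl.
  + move=> F ndF VF; rewrite /H/=.
    apply: (@step_closure_lim (fun n => \1_(F n `&` `]s, t])) _ 1) => //.
      by move=> n x; rewrite indicE; case: (_ \in _); rewrite ?normr1 ?normr0.
    move=> x; have [[n _ Fn]|nF] := pselect ((\bigcup_i F i) x).
      apply: cvg_near_cst; exists n => // m /= nm; rewrite !indicE !in_setI.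
      rewrite (@mem_set _ (\bigcup_i F i)); last by exists n.
      by rewrite mem_set//; have /subsetPset := ndF _ _ nm; exact.
    apply: cvg_near_cst; near=> m; rewrite !indicE !in_setI (memNset nF).
    by rewrite memNset// => Fm; apply: nF; exists m.
- by move=> _ [a ->]; exact: step_closure_ray.
Unshelve. all: by end_near. Qed.

Lemma step_closure_bounded_measurable (f : R -> R) (C : R) : measurable_fun setT f ->
  (forall x, `|f x| <= C) -> step_closure (fun x => f x * \1_`]s, t] x).
Proof.
apply: (bounded_measurable_ind (K := fun f => step_closure (fun x => f x * \1_`]s, t] x))).
- move=> A mA; rewrite (_ : (fun x => _) = \1_(A `&` `]s, t])); first exact: step_closure_indic.
  by apply/funext => x; rewrite indicI.
- move=> g h Vg Vh; rewrite (_ : (fun x => _) = (fun x => g x * \1_`]s, t] x) \+ (fun x => h x * \1_`]s, t] x)).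
    exact: step_closureD.
  by apply/funext => x /=; rewrite mulrDl.
- move=> a g Vg; under eq_fun do rewrite -mulrA; exact: step_closureZ.
- move=> f_ g K Vf _ fK fg; apply: (step_closure_lim (C := K) Vf) => [n x|x].
    rewrite normrM -[K]mulr1 ler_pM// indicE.
    by case: (_ \in _); rewrite ?normr1 ?normr0.
  by apply: cvgMr_tmp; exact: fg.
Qed.

End dyadic_steps.

Section observation_window.
Context {R : realType} (T : set R) (T_itv : observation_interval T).

Lemma observation_measurable : measurable T.
Proof. by case: T_itv => [[T0 _ ->]|->|->]; [exact: measurable_itv..|]. Qed.

Lemma observation_sub s t : T s -> T t -> `]s, t]%classic `<=` T.
Proof.
case: T_itv => [[T0 _ ->]|->|->]//= + + x; rewrite /= !in_itv/= ?andbT.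
  move=> /andP[s0 _] /andP[_ tT] /andP[sx xt].
  by rewrite (le_trans s0 (ltW sx)) (le_trans xt).
by move=> s0 _ /andP[sx _]; rewrite (le_trans s0 (ltW sx)).
Qed.

(* On a half-line or a segment the sets ]s n, t n] miss the endpoint 0. *)
Lemma observation_exhaustion : exists s t : nat -> R,
  (forall n, [/\ T (s n), T (t n) & s n < t n]) /\
  (forall n m, (n <= m)%N -> s m <= s n /\ t n <= t m) /\
  forall x, T x -> (x = 0 -> ~ (T `<=` `[0, +oo[)) ->
    \forall n \near \oo, `]s n, t n]%classic x.
Proof.
case: T_itv => [[T0 T00 ->]|->|->].
- exists (cst 0), (cst T0); split.
    by move=> n; split => //=; rewrite in_itv/= ?lexx ?ltW.
  split=> // x /=; rewrite in_itv/= => /andP[x0 xT] x1.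
  near=> n; rewrite /= in_itv/= xT andbT lt_neqAle x0 andbT eq_sym.
  apply/eqP => /x1; apply => y /=; rewrite !in_itv/= => /andP[->//].
- exists (cst 0), (fun n => n.+1%:R); split.
    by move=> n; split; rewrite /= ?in_itv/= ?andbT ?ler0n ?ltr0n.
  split=> [n m nm|x /=]; first by split => //; rewrite ler_nat.
  rewrite in_itv/= andbT => x0 x1.
  near=> n; rewrite /= in_itv/=; apply/andP; split.
    by rewrite lt_neqAle x0 andbT eq_sym; apply/eqP => /x1; apply => y.
  rewrite (@le_trans _ _ n%:R)//; last by rewrite ler_nat.
  by near: n; exact: nbhs_infty_ger.
- exists (fun n => - n.+1%:R), (fun n => n.+1%:R); split.
    by move=> n; split => //; rewrite (@lt_trans _ _ 0)// oppr_lt0.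
  split=> [n m nm|x _ _]; first by rewrite lerN2 ler_nat.
  near=> n; rewrite /= in_itv/=.
  have : `|x| < n.+1%:R.
    rewrite (@le_lt_trans _ _ n%:R)//; last by rewrite ltr_nat.
    by near: n; exact: nbhs_infty_ger.
  by rewrite ltr_norml => /andP[-> /ltW].
Unshelve. all: by end_near. Qed.

End observation_window.

Lemma lebesgue_stieltjes_measure_itv (R : realType) (F : cumulative R R) (a b : R) :
  a <= b -> lebesgue_stieltjes_measure F `]a, b]%classic = (F b - F a)%:E.
Proof.
move=> ab; rewrite /lebesgue_stieltjes_measure/= /measure_extension measurable_mu_extE/=; last by exists (a, b).
by rewrite wlength_itv_bnd.
Qed.

(** * Campbell's formula *)

Lemma Rintegral_sum d (A : measurableType d) (R : realType) (mu : {measure set A -> \bar R})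
    (D : set A) (I : Type) (r : seq I) (f : I -> A -> R) : measurable D ->
  (forall i, mu.-integrable D (EFin \o f i)) ->
  mu.-integrable D (EFin \o (fun x => \sum_(i <- r) f i x)) /\
  \int[mu]_(x in D) (\sum_(i <- r) f i x) = \sum_(i <- r) \int[mu]_(x in D) f i x.
Proof.
move=> mD fI.
have sI s : mu.-integrable D (EFin \o (fun x => \sum_(i <- s) f i x)).
  rewrite (_ : EFin \o _ = fun x => (\sum_(i <- s) (EFin \o f i) x)%E).
    exact: integrable_sum.
  by apply/funext => x /=; rewrite sumEFin.
split; first exact: sI.
elim: r => [|i r IH].
  by rewrite big_nil; under eq_Rintegral do rewrite big_nil; rewrite Rintegral_cst// mul0r.
rewrite big_cons -IH -RintegralD//.
by apply: eq_Rintegral => x _; rewrite big_cons.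
Qed.

Section step_integrals.
Context {R : realType} (mu : {measure set (measurableTypeR R) -> \bar R}).
Context (T : set R) (s t : R).
Hypotheses (mT : measurable T) (stT : `]s, t]%classic `<=` T) (st : s < t).

(** The weight [k] lets one statement serve twice: Lebesgue measure with weight [lam], and a path
    measure with weight 1. *)
Lemma Rintegral_step N (c : nat -> R) (k : R -> R) :
  mu.-integrable `]s, t] (EFin \o k) ->
  \int[mu]_(x in T) (step s t N c x * k x) =
  \sum_(i < 2 ^ N) c i * \int[mu]_(x in cell s t N i) k x.
Proof.
move=> kI.
have mc i : measurable (cell s t N i) by exact: measurable_itv.
have kc (i : 'I_(2 ^ N)) : mu.-integrable (cell s t N i) (EFin \o k).
  apply: (integrableS _ _ _ kI) => [||]; [exact: measurable_itv|exact: mc|]; exact: (cell_sub st (ltn_ord _)).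
have cT (i : 'I_(2 ^ N)) : cell s t N i `<=` T by apply: subset_trans stT; exact: (cell_sub st (ltn_ord _)).
have e (i : 'I_(2 ^ N)) : (fun x => \1_(cell s t N i) x * k x) = k \_ (cell s t N i).
  by apply/funext => x; rewrite patchE indicE; case: (_ \in _); rewrite ?mul1r ?mul0r.
have fI (i : 'I_(2 ^ N)) : mu.-integrable T (EFin \o (fun x => \1_(cell s t N i) x * k x)).
  rewrite e -restrict_EFin; apply: (@integrableS _ _ _ mu setT T) => //.
  refine (iffLR (@integrable_mkcond _ _ _ mu _ _ (mc i)) (kc i)).
have fcI (i : 'I_(2 ^ N)) : mu.-integrable T (EFin \o (fun x => c i * (\1_(cell s t N i) x * k x))).
  exact: integrable_scale.
under eq_Rintegral.
  move=> x _; rewrite /step mulr_suml.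
  under eq_bigr do rewrite -mulrA.
  over.
have [_ ->] := @Rintegral_sum _ _ _ mu T _ (index_enum 'I_(2 ^ N)) _ mT fcI.
apply: eq_bigr => i _; rewrite RintegralZl//; congr (_ * _).
by rewrite e -Rintegral_mkcondr; congr (Rintegral mu _ _); apply/setIidPr/cT.
Qed.

Lemma Rintegral_window (f k : R -> R) : (forall x, ~ `]s, t]%classic x -> f x = 0) ->
  \int[mu]_(x in T) (f x * k x) = \int[mu]_(x in `]s, t]) (f x * k x).
Proof.
move=> f0; have e : [set` `]s, t]] = T `&` `]s, t] by rewrite setIidr.
rewrite e Rintegral_mkcondr; apply: eq_Rintegral => x _; rewrite patchE.
by case: ifPn => // /negP xst; rewrite f0 ?mul0r// => h; apply: xst; rewrite inE.
Qed.

Lemma integrable_bounded_mul (D : set R) (f k : R -> R) (C : R) : measurable D ->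
  measurable_fun setT f -> (forall x, `|f x| <= C) ->
  mu.-integrable D (EFin \o k) -> mu.-integrable D (EFin \o (fun x => f x * k x)).
Proof.
move=> mD mf fC kI; have mk : measurable_fun D k.
  by apply/measurable_EFinP; exact: measurable_int kI.
have kCI : mu.-integrable D (EFin \o (fun x => C * k x)).
  exact: integrable_scale.
apply: le_integrable kCI => //.
  by apply/measurable_EFinP; apply: measurable_funM => //; exact: measurable_funTS.
by move=> x _ /=; rewrite lee_fin !normrM ler_wpM2r// (le_trans (fC x))// ler_norm.
Qed.

(** The functions vanish off the window, so domination is needed only there; [k] may fail to be
    integrable over all of [T]. *)
Lemma Rintegral_window_cvg (k : R -> R) (f_ : nat -> R -> R) (f : R -> R) (C : R) :
  mu.-integrable `]s, t] (EFin \o k) ->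
  (forall n, measurable_fun setT (f_ n)) -> (forall n x, `|f_ n x| <= C) ->
  (forall n x, ~ `]s, t]%classic x -> f_ n x = 0) ->
  (forall x, f_ ^~ x @ \oo --> f x) ->
  (fun n => \int[mu]_(x in T) (f_ n x * k x)) @ \oo --> \int[mu]_(x in T) (f x * k x).
Proof.
move=> kI mf_ fC f0 ff.
have mst : measurable `]s, t]%classic by exact: measurable_itv.
have mf : measurable_fun setT f by apply: (measurable_fun_cvg mf_) => x _; exact: ff.
have fC' x : `|f x| <= C by apply: norm_cvg_le (ff x) => n; exact: fC.
have f0' x : ~ `]s, t]%classic x -> f x = 0.
  move=> xst; have := ff x; under eq_fun do rewrite f0//.
  by move=> /cvg_unique; apply => //; exact: cvg_cst.
have mk : measurable_fun `]s, t] k by apply/measurable_EFinP; exact: measurable_int kI.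
rewrite (Rintegral_window _ f0') (_ : (fun n => _) = fun n => \int[mu]_(x in `]s, t]) (f_ n x * k x)).
2: by apply/funext => n; exact: Rintegral_window (f0 n).
have kCI : mu.-integrable `]s, t] (EFin \o (fun x => C * `|k x|)).
  by apply: integrable_scale => //; exact: integrable_norm.
apply: (@Rintegral_dominated_cvg _ _ _ mu _ mst (fun n x => f_ n x * k x)
  (fun x => f x * k x) (fun x => C * `|k x|) _ _ _ kCI _).2.
- by move=> n; apply: measurable_funM => //; exact: measurable_funTS (mf_ n).
- by apply: measurable_funM => //; exact: measurable_funTS.
- by apply: aeW => x _; apply: cvgMr_tmp; exact: ff.
- by apply: aeW => x n _; rewrite normrM ler_wpM2r.
Qed.

End step_integrals.

Section campbell.
Context (R : realType) (dO : measure_display) (Omega : measurableType dO).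
Context (P : probability Omega R) (T : set R) (T_itv : observation_interval T).
Context (lam : R -> R) (lamI : intensity T lam) (X : Omega -> cumulative R R).
Hypothesis X_poisson : poisson_process P T lam X.

Local Notation leb := (@lebesgue_measure R).
Local Notation path w := (lebesgue_stieltjes_measure (X w)).
Local Notation stint f w := (\int[path w]_(x in T) f x).

(** Generators of [process_sigma_algebra]. Naming them gives a measurable type [Omega'] on the same
    sample space, so that measurability with respect to the path alone can be stated by
    [measurable_fun]. *)
Definition path_events := \bigcup_(t in T)
  preimage_set_system [set: Omega] (fun w => X w t : R) measurable.

Local Notation Omega' := (g_sigma_algebraType path_events).

Let mT : measurable T := observation_measurable T_itv.

Lemma process_sub_measurable (A : set Omega) :
  process_sigma_algebra T X A -> measurable A.
Proof.
apply: smallest_sub; first exact: sigma_algebra_measurable.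
have [[mX _ _] _ _] := X_poisson.
by move=> B [t Tt [C mC <-]]; apply: mX.
Qed.

Lemma measurable_process d (U : measurableType d) (f : Omega -> U) :
  measurable_fun setT (f : Omega' -> U) -> measurable_fun setT f.
Proof.
by move=> mf _ B mB; apply: process_sub_measurable; exact: (mf measurableT _ mB).
Qed.

Lemma measurable_coordinate t : T t ->
  measurable_fun setT ((fun w => X w t : R) : Omega' -> R).
Proof.
move=> Tt _ B mB; apply: sub_sigma_algebra; exists t => //.
by exists B.
Qed.

Let path_itv w a b : a <= b -> path w `]a, b]%classic = (X w b - X w a)%:E.
Proof. exact: lebesgue_stieltjes_measure_itv. Qed.

Section window.
Variables (s t : R).
Hypotheses (Ts : T s) (Tt : T t) (st : s < t).

Let subT : `]s, t]%classic `<=` T := observation_sub T_itv Ts Tt.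
Let grid_T N i : (i <= 2 ^ N)%N -> T (grid s t N i).
Proof.
move=> iN; have [->|i0] := posnP i; first by rewrite grid0.
apply: subT; rewrite /= in_itv/= -{1}(grid0 s t N) ltNge grid_le// -ltnNge i0/=.
by rewrite -[leRHS](gridT s t N) grid_le.
Qed.

Let mass (a b : R) : R := \int[leb]_(u in `]a, b]) lam u.

Let lam_window : leb.-integrable `]s, t] (EFin \o lam).
Proof.
have [_ _ /(_ s t Ts Tt)] := lamI; apply: integrableS => //.
exact: subset_itv_oc_cc.
Qed.


Let path_window (w : Omega) : (path w).-integrable `]s, t] (EFin \o cst 1).
Proof.
apply: measurable_bounded_integrable => //; first by rewrite [X in (X < _)%E](path_itv w (ltW st)) ltry.
by exists 1; split => // M M1 x _ /=; rewrite normr1 ltW.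
Qed.

Let stint_mul f w : stint f w = \int[path w]_(x in T) (f x * cst 1 x).
Proof. by apply: eq_Rintegral => x _; rewrite mulr1. Qed.

(** The five clauses pass to bounded limits together. Measurability is with respect to the path
    alone, as independence of the processes will require; integrability and the mean serve later to
    show that the integral of |h| is almost surely finite; the last two clauses are Campbell's
    formula. *)
Definition window_good (f : R -> R) := [/\
  measurable_fun setT ((fun w => stint f w) : Omega' -> R),
  P.-integrable setT (EFin \o (fun w => stint f w)),
  \int[P]_w stint f w = \int[leb]_(x in T) (f x * lam x),
  \int[P]_w cos (stint f w) = expR (\int[leb]_(x in T) ((cos (f x) - 1) * lam x)) *
     cos (\int[leb]_(x in T) (sin (f x) * lam x)) &
  \int[P]_w sin (stint f w) = expR (\int[leb]_(x in T) ((cos (f x) - 1) * lam x)) *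
     sin (\int[leb]_(x in T) (sin (f x) * lam x))].

Section increments.
Variable N : nat.

(** Capping the index at [2 ^ N] turns the grid into an infinite nondecreasing sequence of times of
    [T], the form in which independence of increments is given. *)
Let g i := grid s t N (minn i (2 ^ N)).
Let dX i w : R := X w (g i.+1) - X w (g i).

Let gT i : T (g i).
Proof. by apply: grid_T; rewrite geq_minr. Qed.

Let g_nd i : g i <= g i.+1.
Proof. by rewrite grid_le// leq_min geq_minr andbT geq_min leqnSn. Qed.

Let dX_measurable' i : measurable_fun setT (dX i : Omega' -> R).
Proof. by apply: measurable_funB; exact: measurable_coordinate. Qed.

Let dX_measurable i : measurable_fun setT (dX i).
Proof. exact: measurable_process. Qed.

Let dX_nat i w : dX i w \is a Num.nat.
Proof. by have [[_ h _] _ _] := X_poisson; exact: h. Qed.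

Let dX_poisson i k : P [set w | dX i w = k%:R] = (poisson_mass (mass (g i) (g i.+1)) k)%:E.
Proof. by have [_ h _] := X_poisson; exact: h. Qed.

Let mass_ge0 i : 0 <= mass (g i) (g i.+1).
Proof.
apply: Rintegral_ge0 => x gx; have [_ h _] := lamI; apply: h.
by apply: (observation_sub T_itv (gT i) (gT i.+1)).
Qed.

Let gE (i : 'I_(2 ^ N)) : g i = grid s t N i /\ g i.+1 = grid s t N i.+1.
Proof. by rewrite /g !(minn_idPl _)// ltnW. Qed.

Lemma grid_increment_integrable i : P.-integrable setT (EFin \o dX i).
Proof.
apply/integrableP; split; first exact/measurable_EFinP.
rewrite (eq_integral (fun w => (dX i w)%:E)); last first.
  by move=> w _ /=; rewrite ger0_norm//; have /natrP[k ->] := dX_nat i w.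
by rewrite (poisson_mean (dX_measurable i) (dX_nat i) (dX_poisson i) (mass_ge0 i)) ltry.
Qed.

Let dX_mean i : \int[P]_w dX i w = mass (g i) (g i.+1).
Proof.
by rewrite /Rintegral (poisson_mean (dX_measurable i) (dX_nat i) (dX_poisson i) (mass_ge0 i)).
Qed.

Let stint_step c w : stint (step s t N c) w = \sum_(i < 2 ^ N) c i * dX i w.
Proof.
rewrite stint_mul (Rintegral_step mT subT st _ _ (path_window w)); apply: eq_bigr => i _; congr (_ * _).
rewrite Rintegral_cst ?mul1r; last exact: measurable_itv.
by rewrite [X in fine X]path_itv ?grid_le// /dX; have [-> ->] := gE i.
Qed.

Let lam_step c (phi : R -> R) : phi 0 = 0 ->
  \int[leb]_(x in T) (phi (step s t N c x) * lam x) =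
  \sum_(i < 2 ^ N) phi (c i) * mass (g i) (g i.+1).
Proof.
move=> phi0; under eq_Rintegral do rewrite step_comp//.
rewrite (Rintegral_step mT subT st _ _ lam_window); apply: eq_bigr => i _; congr (_ * _).
by rewrite /mass; have [-> ->] := gE i.
Qed.

(** The path integral of a step function is a linear combination of independent Poisson increments,
    so its characteristic function is a product of those of Poisson variables. *)
Lemma window_good_step c : window_good (step s t N c).
Proof.
have IcdX i : P.-integrable setT (EFin \o (fun w => c i * dX i w)).
  by apply: integrable_scale => //; exact: grid_increment_integrable.
have [sI sE] := @Rintegral_sum _ _ _ P setT _ (index_enum 'I_(2 ^ N)) _ measurableT IcdX.
have eS : (fun w => stint (step s t N c) w) = fun w => \sum_(i < 2 ^ N) c i * dX i w.
  by apply/funext => w; exact: stint_step.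
have ch i := poisson_charfun (dX_measurable i) (dX_nat i) (dX_poisson i) (c i).
have mcd i : measurable_fun setT (fun w => c i * dX i w) by exact: measurable_funM.
have FZ i (B : set R) : measurable B ->
    preimage_set_system setT (dX i) measurable ((fun w => c i * dX i w) @^-1` B).
  move=> mB; exists ((fun y => c i * y) @^-1` B); last by rewrite setTI.
  by rewrite -[X in measurable X]setTI; apply: mulrl_measurable.
have mF i A : preimage_set_system setT (dX i) measurable A -> measurable A.
  by move=> [B mB <-]; exact: dX_measurable.
have indX : mutually_independent P (fun i => preimage_set_system setT (dX i) measurable).
  by have [_ _ h] := X_poisson; exact: h.
have [hc hs] := independent_charfun indX mcd FZ mF (fun i => (ch i).1) (fun i => (ch i).2) (2 ^ N)%N.
have sc : \int[leb]_(x in T) ((cos (step s t N c x) - 1) * lam x) =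
    \sum_(i < 2 ^ N) mass (g i) (g i.+1) * (cos (c i) - 1).
  rewrite (lam_step c (phi := fun y => cos y - 1)) ?cos0 ?subrr//.
  by apply: eq_bigr => i _; rewrite mulrC.
have ss : \int[leb]_(x in T) (sin (step s t N c x) * lam x) =
    \sum_(i < 2 ^ N) mass (g i) (g i.+1) * sin (c i).
  rewrite (lam_step c (phi := sin)) ?sin0//.
  by apply: eq_bigr => i _; rewrite mulrC.
split.
- rewrite eS; apply: (@measurable_sum _ Omega' _ _ _ _ (fun (i : 'I_(2 ^ N)) w => c i * dX i w)) => i.
  by apply: (@measurable_funM _ Omega') => //; exact: dX_measurable'.
- by rewrite eS.
- rewrite eS sE (lam_step c (phi := idfun))//; apply: eq_bigr => i _.
  by rewrite RintegralZl ?dX_mean//; exact: grid_increment_integrable.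
- by under eq_Rintegral do rewrite stint_step; rewrite hc sc ss.
- by under eq_Rintegral do rewrite stint_step; rewrite hs sc ss.
Qed.

End increments.

(** Every path gives the window finite mass, so path integrals converge for each sample point; they
    are dominated by C (X t - X s), whose mean is finite. *)
Lemma window_good_lim (f_ : nat -> R -> R) (f : R -> R) (C : R) :
  (forall n, measurable_fun setT (f_ n)) ->
  (forall n x, ~ `]s, t]%classic x -> f_ n x = 0) ->
  (forall n, window_good (f_ n)) -> (forall n x, `|f_ n x| <= C) ->
  (forall x, f_ ^~ x @ \oo --> f x) -> window_good f.
Proof.
move=> mf_ f0 good_f fC ff.
have stc w : (fun n => stint (f_ n) w) @ \oo --> stint f w.
  rewrite stint_mul; under eq_fun do rewrite stint_mul.
  by apply: (Rintegral_window_cvg _ (path_window w) mf_ fC f0 ff).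
(* Used for cos - 1, sin and the identity; [phi 0 = 0] keeps the composed functions supported in the
   window. *)
have lamc (phi : R -> R) (K : R) : continuous phi -> phi 0 = 0 -> (forall n x, `|phi (f_ n x)| <= K) ->
    (fun n => \int[leb]_(x in T) (phi (f_ n x) * lam x)) @ \oo -->
      \int[leb]_(x in T) (phi (f x) * lam x).
  move=> cphi phi0 phiK; apply: (Rintegral_window_cvg _ lam_window _ phiK) => //.
  - move=> n; apply: measurableT_comp => //; exact: continuous_measurable_fun.
  - by move=> n x xst; rewrite f0.
  - by move=> x; apply: continuous_cvg; [exact: cphi|exact: ff].
have ms : measurable_fun setT ((fun w => stint f w) : Omega' -> R).
  apply: (@measurable_fun_cvg _ Omega' _ _ (fun n w => stint (f_ n) w)) => [n|w _]; last exact: stc.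
  by case: (good_f n).
have mcos : continuous (fun y : R => cos y - 1).
  by move=> y; apply: cvgB; [exact: continuous_cos|exact: cvg_cst].
have c1 : (fun n => \int[leb]_(x in T) ((cos (f_ n x) - 1) * lam x)) @ \oo -->
      \int[leb]_(x in T) ((cos (f x) - 1) * lam x).
  apply: (lamc (fun y => cos y - 1) 2) => //; first by rewrite cos0 subrr.
  by move=> n x; rewrite (le_trans (ler_normB _ _))// normr1 -[2]/(1 + 1) lerD2r cos_max.
have c2 : (fun n => \int[leb]_(x in T) (sin (f_ n x) * lam x)) @ \oo -->
      \int[leb]_(x in T) (sin (f x) * lam x).
  apply: (lamc sin 1); [exact: continuous_sin|exact: sin0|].
  by move=> n x; exact: sin_max.
have c3 : (fun n => expR (\int[leb]_(x in T) ((cos (f_ n x) - 1) * lam x))) @ \oo -->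
    expR (\int[leb]_(x in T) ((cos (f x) - 1) * lam x)).
  by apply: continuous_cvg; [exact: continuous_expR|exact: c1].
have trig (phi : R -> R) : continuous phi -> (forall y, `|phi y| <= 1) ->
    (forall n, \int[P]_w phi (stint (f_ n) w) =
       expR (\int[leb]_(x in T) ((cos (f_ n x) - 1) * lam x)) *
       phi (\int[leb]_(x in T) (sin (f_ n x) * lam x))) ->
    \int[P]_w phi (stint f w) = expR (\int[leb]_(x in T) ((cos (f x) - 1) * lam x)) *
       phi (\int[leb]_(x in T) (sin (f x) * lam x)).
  move=> cphi phi1 e.
  have mphi : measurable_fun setT phi by exact: continuous_measurable_fun.
  have [|||_] := @bounded_cvg _ _ _ P (fun n w => phi (stint (f_ n) w)) (fun w => phi (stint f w)) 1.
  - move=> n; apply: measurableT_comp => //; apply: measurable_process.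
    by case: (good_f n).
  - by [].
  - by move=> w; apply: continuous_cvg; [exact: cphi|exact: stc].
  under eq_fun do rewrite e.
  move=> /cvg_unique; apply => //; apply: cvgM => //.
  by apply: continuous_cvg; [exact: cphi|exact: c2].
have C0 : 0 <= C by rewrite (le_trans _ (fC 0%N 0)).
(* At level 0 the grid has a single cell, ]s, t]. *)
have XI : P.-integrable setT (EFin \o (fun w => X w t - X w s)).
  have : P.-integrable setT (EFin \o (fun w => X w (grid s t 0 (2 ^ 0)) - X w (grid s t 0 0))).
    exact: (grid_increment_integrable 0 0).
  by rewrite gridT grid0.
have bnd n w : `|stint (f_ n) w| <= C * (X w t - X w s).
  rewrite stint_mul (Rintegral_window _ subT _ (f0 n)).
  have fI := integrable_bounded_mul (measurable_itv `]s, t]) (mf_ n) (fC n) (path_window w).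
  apply: le_trans; first by apply: le_normr_Rintegral => //; exact: fI.
  have CI : (path w).-integrable `]s, t] (EFin \o (fun x => C * cst 1 x)).
    by apply: integrable_scale => //; exact: path_window.
  apply: (@le_trans _ _ (\int[path w]_(x in `]s, t]) (C * cst 1 x))).
    apply: le_Rintegral => //; first by apply: integrable_norm; exact: fI.
    by move=> x _ /=; rewrite !mulr1.
  under eq_Rintegral do rewrite /= mulr1.
  by rewrite Rintegral_cst//= [X in fine X](path_itv w (ltW st)).
have [sI sc] := @Rintegral_dominated_cvg _ _ _ P setT measurableT
  (fun n w => stint (f_ n) w) (fun w => stint f w) (fun w => C * (X w t - X w s))
  (fun n => let: And5 h _ _ _ _ := good_f n in measurable_process h)
  (measurable_process ms) (aeW _ (fun w _ => stc w)) (integrable_scale C measurableT XI)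
  (aeW _ (fun w n _ => bnd n w)).
split => //.
- have e n : \int[P]_w stint (f_ n) w = \int[leb]_(x in T) (f_ n x * lam x) by case: (good_f n).
  move: sc; under eq_fun do rewrite e.
  by move=> /cvg_unique; apply => //; apply: (lamc idfun C) => // y; exact: cvg_id.
- by apply: trig => //; [exact: continuous_cos|exact: cos_max|move=> n; case: (good_f n)].
- by apply: trig => //; [exact: continuous_sin|exact: sin_max|move=> n; case: (good_f n)].
Qed.

Lemma window_good_bounded (f : R -> R) (C : R) : measurable_fun setT f ->
  (forall x, `|f x| <= C) -> window_good (fun x => f x * \1_`]s, t] x).
Proof.
move=> mf fC; have := step_closure_bounded_measurable st mf fC.
elim=> [N c|f_ f' K Vf IH fK ff]; first exact: window_good_step.
apply: window_good_lim IH fK ff => [n|n x].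
  exact: step_closure_measurable (Vf n).
exact: (step_closure_out st (Vf n)).
Qed.

End window.
End campbell.

(** * Campbell's formula for integrands integrable against the intensity *)

Section campbell_integrable.
Context (R : realType) (dO : measure_display) (Omega : measurableType dO).
Context (P : probability Omega R) (T : set R) (T_itv : observation_interval T).
Context (lam : R -> R) (lamI : intensity T lam) (X : Omega -> cumulative R R).
Hypothesis X_poisson : poisson_process P T lam X.

Local Notation leb := (@lebesgue_measure R).
Local Notation path w := (lebesgue_stieltjes_measure (X w)).
Local Notation stint f w := (\int[path w]_(x in T) f x).
Local Notation Omega' := (g_sigma_algebraType (path_events T X)).

Let mT : measurable T := observation_measurable T_itv.

Section exhaustion.
Variables (s t : nat -> R) (st : forall n, [/\ T (s n), T (t n) & s n < t n]).
Hypothesis st_nd : forall n m, (n <= m)%N -> s m <= s n /\ t n <= t m.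
Hypothesis st_exh : forall x, T x -> (x = 0 -> ~ (T `<=` `[0, +oo[)) ->
    \forall n \near \oo, `]s n, t n]%classic x.

Let E := \bigcup_n `]s n, t n]%classic.

Let mE : measurable E.
Proof. by apply: bigcup_measurable => k _; exact: measurable_itv. Qed.

Let E_T : E `<=` T.
Proof.
by move=> x [n _]; have [Ts Tt _] := st n; exact: (observation_sub T_itv Ts Tt).
Qed.

Let TE0 : T `\` E `<=` [set 0] /\ (T `\` E !=set0 -> T `<=` `[0, +oo[).
Proof.
have h x : (T `\` E) x -> x = 0 /\ T `<=` `[0, +oo[.
  move=> [Tx Ex]; apply: contrapT => x0; apply: Ex.
  have [|n _ /(_ n (leqnn n)) xn] := st_exh Tx; last by exists n.
  by move=> x00 T0; apply: x0.
by split => [x /h[]//|[x /h[]]].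
Qed.

Let leb_TE : leb (T `\` E) = 0%E.
Proof.
apply: (@subset_measure0 _ _ _ leb (T `\` E) [set 0]); [exact: measurableD|exact: measurable_set1|exact: TE0.1|].
exact: lebesgue_measure_set1.
Qed.

(** If [T] starts at 0, the only point that can be missed is 0, which lies in ]-1, 0]; that interval
    has no mass because paths vanish up to 0. Otherwise nothing is missed. *)
Let path_TE w : path w (T `\` E) = 0%E.
Proof.
have [TE|] := pselect (T `\` E !=set0); last first.
  by move/set0P/negP/negPn/eqP => ->; rewrite measure0.
have [[_ _ X0] _ _] := X_poisson.
apply: (@subset_measure0 _ _ _ (path w) (T `\` E) `]-1, 0]%classic); [exact: measurableD|exact: measurable_itv| |].
  by apply: (subset_trans TE0.1) => x /= ->; rewrite in_itv/= lexx ltrN10.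
rewrite [LHS]lebesgue_stieltjes_measure_itv ?lerN10//.
by rewrite !X0 ?subrr ?lerN10//; exact: TE0.2.
Qed.

Variable h : R -> R.
Hypothesis mh : measurable_fun T h.

Let h' := h \_ T.

Let mh' : measurable_fun setT h'.
Proof. exact/(measurable_restrictT _ mT). Qed.

(** Truncation both in time and in value: on [F k] the path measure is finite and [h'] is bounded by
    k. *)
Let F k := `]s k, t k]%classic `&` [set x | `|h' x| <= k%:R].

Let mF k : measurable (F k).
Proof.
apply: measurableI; first exact: measurable_itv.
rewrite -[X in measurable X]setTI.
have -> : [set x | `|h' x| <= k%:R] = (fun x => `|h' x|) @^-1` `]-oo, k%:R].
  by apply/seteqP; split => x /=; rewrite in_itv.
have : measurable_fun setT (fun x => `|h' x|) by apply: measurableT_comp.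
by apply => //; exact: measurable_itv.
Qed.

Let F_T k : F k `<=` T.
Proof.
by move=> x [xk _]; have [Ts Tt _] := st k; exact: (observation_sub T_itv Ts Tt).
Qed.

Let F_nd : nondecreasing_seq F.
Proof.
move=> m n mn; apply/subsetPset => x [] /=; rewrite !in_itv/= => /andP[sx xt] hx.
have [sn tn] := st_nd mn; split; last by rewrite /= (le_trans hx)// ler_nat.
by rewrite /= in_itv/= (le_lt_trans sn)// (le_trans xt).
Qed.

Let bigcup_F : \bigcup_k F k = E.
Proof.
apply/seteqP; split => [x [k _ [xk _]]|x [n _ xn]]; first by exists k.
have [m nm hm] : exists2 m, (n <= m)%N & `|h' x| <= m%:R.
  near \oo => m; exists m; first by near: m; exact: nbhs_infty_ge.
  by near: m; exact: nbhs_infty_ger.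
exists m => //; split => //; move: xn; rewrite /= !in_itv/= => /andP[sx xt].
by have [sn tn] := st_nd nm; rewrite (le_lt_trans sn)// (le_trans xt).
Unshelve. all: by end_near. Qed.

Let trunc (u : R -> R) k x := (u x * \1_[set x | `|h' x| <= k%:R] x) * \1_`]s k, t k] x.

Let truncE u k : trunc u k = u \_ (F k).
Proof.
apply/funext => x; rewrite patchE /trunc /F in_setI !indicE -mulrA -natrM mulnb andbC.
by case: (_ && _); rewrite ?mulr1 ?mulr0.
Qed.

(** The sets [F k] depend on [h] only, so the same truncation serves h, |h| and the positive and
    negative parts of h. *)
Let trunc_good (u : R -> R) k : measurable_fun setT u -> (forall x, `|u x| <= `|h' x|) ->
  window_good P T lam X (trunc u k).
Proof.
move=> mu uh; have [Ts Tt sk] := st k.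
apply: (window_good_bounded T_itv lamI X_poisson Ts Tt sk (C := k%:R)).
  apply: measurable_funM => //; apply: measurable_indic.
  rewrite -[X in measurable X]setTI.
  have -> : [set x | `|h' x| <= k%:R] = (fun x => `|h' x|) @^-1` `]-oo, k%:R].
    by apply/seteqP; split => x /=; rewrite in_itv.
  have : measurable_fun setT (fun x => `|h' x|) by apply: measurableT_comp.
  by apply => //; exact: measurable_itv.
move=> x; rewrite indicE; have [hx|hx] := leP `|h' x| k%:R.
  by rewrite mem_set// mulr1 (le_trans (uh x)).
by rewrite memNset ?mulr0 ?normr0//= => /le_lt_trans/(_ hx); rewrite ltxx.
Qed.

Let int_trunc (mu : {measure set (measurableTypeR R) -> \bar R}) (u k : R -> R) n :
  \int[mu]_(x in T) (trunc u n x * k x) = \int[mu]_(x in F n) (u x * k x).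
Proof.
have e : F n = T `&` F n by rewrite setIidr//; exact: F_T.
rewrite [in RHS]e Rintegral_mkcondr; apply: eq_Rintegral => x _.
by rewrite truncE !patchE; case: ifP => // _; rewrite mul0r.
Qed.

Let stint_trunc u k w : stint (trunc u k) w = \int[path w]_(x in F k) u x.
Proof.
transitivity (\int[path w]_(x in T) (trunc u k x * cst 1 x)).
  by apply: eq_Rintegral => x _; rewrite mulr1.
by rewrite int_trunc; apply: eq_Rintegral => x _; rewrite mulr1.
Qed.

Let path_F_lty w k : (path w (F k) < +oo)%E.
Proof.
have [Ts Tt sk] := st k.
apply: (@le_lt_trans _ _ (path w `]s k, t k]%classic)).
  by apply: le_measure; rewrite ?inE; [exact: mF|exact: measurable_itv|by move=> x []].
by rewrite [X in (X < _)%E](lebesgue_stieltjes_measure_itv (X w) (ltW sk)) ltry.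
Qed.

Let u_int_F (u : R -> R) w k : measurable_fun setT u -> (forall x, `|u x| <= `|h' x|) ->
  (path w).-integrable (F k) (EFin \o u).
Proof.
move=> mu uh; apply: measurable_bounded_integrable; [exact: mF|exact: path_F_lty|exact: (measurable_funTS mu)|].
exists k%:R; split => // M kM x [_ hx] /=.
by rewrite (le_trans (uh x))// (le_trans hx)// ltW.
Qed.

Let int_T_E (mu : {measure set (measurableTypeR R) -> \bar R}) (u : R -> \bar R) :
  mu (T `\` E) = 0%E -> measurable_fun T u -> (forall x, T x -> (0 <= u x)%E) ->
  (\int[mu]_(x in T) u x = \int[mu]_(x in E) u x)%E.
Proof.
move=> TE mu0 u0; rewrite (@ge0_negligible_integral _ _ _ mu T (T `\` E))//.
  by rewrite setDD setIidr.
exact: measurableD.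
Qed.

(* Monotone exhaustion of a nonnegative integrand by the truncations. *)
Let ge0_stint_cvg (u : R -> R) w : measurable_fun setT u ->
  (forall x, 0 <= u x <= `|h' x|) ->
  (fun k => (stint (trunc u k) w)%:E) @ \oo --> (\int[path w]_(x in T) (u x)%:E)%E.
Proof.
move=> mu uh; have u0 x : 0 <= u x by case/andP: (uh x).
have uh' x : `|u x| <= `|h' x| by rewrite ger0_norm//; case/andP: (uh x).
rewrite int_T_E; [|exact: path_TE|by apply/measurable_EFinP; exact: measurable_funTS|
  by move=> x _; rewrite lee_fin].
rewrite -bigcup_F.
rewrite (_ : (fun k => _) = fun k => (\int[path w]_(x in F k) (u x)%:E)%E).
  apply: ge0_nondecreasing_set_cvg_integral => //.
  - by move=> i; apply/measurable_EFinP; exact: measurable_funTS.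
  - by move=> i x _; rewrite lee_fin.
apply/funext => k; rewrite stint_trunc fineK//; apply: integrable_fin_num; first exact: mF.
exact: u_int_F.
Qed.

Let ge0_stint_measurable (u : R -> R) : measurable_fun setT u ->
  (forall x, 0 <= u x <= `|h' x|) ->
  measurable_fun setT ((fun w => \int[path w]_(x in T) (u x)%:E)%E : Omega' -> \bar R).
Proof.
move=> mu uh; have uh' x : `|u x| <= `|h' x|.
  by have /andP[u0 ?] := uh x; rewrite ger0_norm.
apply: (@emeasurable_fun_cvg _ Omega' _ _ (fun k w => (stint (trunc u k) w)%:E)).
  by move=> k; apply/measurable_EFinP; case: (trunc_good k mu uh').
by move=> w _; exact: ge0_stint_cvg.
Qed.

(** Holds without any integrability: the extended integrals of the positive and negative parts are
    measurable as limits of truncations, and [fine] of their difference is a measurable total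
    function even where both are infinite. *)
Lemma stint_measurable_exhaustion :
  measurable_fun setT ((fun w => stint h w) : Omega' -> R).
Proof.
have -> : (fun w => stint h w) = fun w =>
    fine (\int[path w]_(x in T) (Num.max (h' x) 0)%:E - \int[path w]_(x in T) (Num.max (- h' x) 0)%:E)%E.
  apply/funext => w; rewrite /Rintegral integralE; congr (fine (_ - _)%E).
    by apply: eq_integral => x xT; rewrite funeposE/= /h' patchE xT EFin_max.
  by apply: eq_integral => x xT; rewrite funenegE/= /h' patchE xT EFin_max.
apply: measurableT_comp => //; apply: emeasurable_funB; apply: ge0_stint_measurable.
- exact: measurable_maxr.
- by move=> x; rewrite le_max lexx orbT/= ge_max ler_norm normr_ge0.
- by apply: measurable_maxr => //; exact: measurableT_comp.
- by move=> x; rewrite le_max lexx orbT/= ge_max normr_ge0 andbT -normrN ler_norm.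
Qed.

Hypothesis hI : leb.-integrable T (fun x => (h x * lam x)%:E).

Let lam_ge0 x : T x -> 0 <= lam x.
Proof. by have [_ l0 _] := lamI; exact: l0. Qed.

Let mlam : measurable_fun T lam.
Proof. by have [ml _ _] := lamI. Qed.

Let habsI : leb.-integrable T (EFin \o (fun x => `|h x * lam x|)).
Proof. by apply: integrable_norm. Qed.

Let abs_h'_le x : 0 <= `|h' x| <= `|h' x|.
Proof. by rewrite normr_ge0 lexx. Qed.

Let mabs : measurable_fun setT (fun x => `|h' x|).
Proof. exact: measurableT_comp. Qed.

Let stint_absh_bound k :
  (\int[P]_w (stint (trunc (fun x => `|h' x|) k) w)%:E <=
   (\int[leb]_(x in T) `|h x * lam x|)%:E)%E.
Proof.
have [_ sI sE _ _] : window_good P T lam X (trunc (fun x => `|h' x|) k).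
  by apply: trunc_good => // x; rewrite normr_id.
rewrite -[leLHS]fineK ?lee_fin; last exact: integrable_fin_num sI.
rewrite [leLHS]sE.
rewrite int_trunc [leRHS]Rintegral_mkcond [leLHS]Rintegral_mkcond.
apply: le_Rintegral => //.
- rewrite -restrict_EFin; apply: (iffLR (@integrable_mkcond _ _ _ leb _ _ (mF k))).
  apply: (@integrableS _ _ _ leb T); [exact: mT|exact: mF|exact: F_T|].
  apply: eq_integrable habsI => // x; rewrite inE => Tx /=.
  by rewrite /h' patchE mem_set// normrM (ger0_norm (lam_ge0 Tx)).
- by rewrite -restrict_EFin; apply: (iffLR (@integrable_mkcond _ _ _ leb _ _ mT)).
- move=> x _; have [Fx|Fx] := pselect (F k x).
    rewrite patchE mem_set// patchE mem_set; last exact: F_T Fx.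
    by rewrite /h' patchE mem_set ?normrM ?(ger0_norm (lam_ge0 (F_T Fx)))//; exact: F_T Fx.
  by rewrite patchE memNset// patchE; case: ifPn => _; rewrite ?lexx ?normr_ge0.
Qed.

(** Integrability against the intensity says nothing about an individual path. By monotone
    convergence the mean of the path integral of |h| is at most the integral of |h| [lam], so it is
    finite for almost every path. *)
Lemma stint_integrable_ae_exhaustion :
  {ae P, forall w, (path w).-integrable T (EFin \o h)}.
Proof.
pose G k w := (stint (trunc (fun x => `|h' x|) k) w)%:E.
pose J w := (\int[path w]_(x in T) (`|h' x|)%:E)%E.
have Gcvg w : G ^~ w @ \oo --> J w by exact: ge0_stint_cvg.
have mG k : measurable_fun setT (G k).
  apply/measurable_EFinP; apply: (measurable_process X_poisson).
  by have [] : window_good P T lam X (trunc (fun x => `|h' x|) k);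
    first by apply: trunc_good => // x; rewrite normr_id.
have G0 k w : (0 <= G k w)%E.
  rewrite lee_fin; apply: Rintegral_ge0 => x _; rewrite truncE patchE.
  by case: ifP.
have Gnd w : nondecreasing_seq (G ^~ w).
  have GE k : G k w = (\int[path w]_(x in F k) (`|h' x|)%:E)%E.
    rewrite /G stint_trunc fineK//; apply: integrable_fin_num; first exact: mF.
    by apply: u_int_F => // x; rewrite normr_id.
  move=> m n mn; rewrite !GE; apply: ge0_subset_integral; [exact: mF|exact: mF| |by []|].
    by apply/measurable_EFinP; exact: measurable_funTS.
  by apply/subsetPset; exact: F_nd.
have JE : (\int[P]_w J w = limn (fun k => \int[P]_w G k w))%E.
  rewrite -monotone_convergence//.
  by apply: eq_integral => w _; apply/esym/cvg_lim => //; exact: Gcvg.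
have mJ : measurable_fun setT J.
  apply: (measurable_process X_poisson); exact: ge0_stint_measurable.
have JI : P.-integrable setT J.
  apply/integrableP; split => //.
  rewrite (eq_integral J); last first.
    by move=> w _; rewrite gee0_abs//; apply: integral_ge0 => x _; rewrite lee_fin.
  rewrite JE; apply: (@le_lt_trans _ _ (\int[leb]_(x in T) `|h x * lam x|)%:E); last exact: ltry.
  apply: lime_le; last by apply: nearW => k; exact: stint_absh_bound.
  apply: ereal_nondecreasing_is_cvgn => m n mn; apply: ge0_le_integral => //.
  by move=> w _; exact: Gnd.
apply: filterS (integrable_ae measurableT JI) => w /(_ I) Jfin.
apply/integrableP; split; first exact/measurable_EFinP.
have -> : (\int[path w]_(x in T) `|(EFin \o h) x| = J w)%E.
  by apply: eq_integral => x xT; rewrite /h' patchE xT.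
by rewrite ltey_eq Jfin.
Qed.

Let trunc_cvg x : E x -> (fun k => trunc h' k x) @ \oo --> h x.
Proof.
move=> Ex; apply: cvg_near_cst; move: (Ex); rewrite -bigcup_F => -[n _ Fn].
exists n => // m /= nm; rewrite truncE patchE mem_set.
  by rewrite /h' patchE mem_set//; exact: E_T.
by have /subsetPset := F_nd nm; exact.
Qed.

Let trunc_le k x : `|trunc h' k x| <= `|h' x|.
Proof. by rewrite truncE patchE; case: ifP => //; rewrite normr0. Qed.

Let h_trunc_good k : window_good P T lam X (trunc h' k).
Proof. exact: trunc_good. Qed.

Let mtrunc k : measurable_fun setT (trunc h' k).
Proof. by rewrite truncE; apply/(measurable_restrictT _ (mF k)); exact: measurable_funTS. Qed.

Let stint_trunc_cvg :
  {ae P, forall w, (fun k => stint (trunc h' k) w) @ \oo --> stint h w}.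
Proof.
apply: filterS stint_integrable_ae_exhaustion => w hwI.
apply: (@Rintegral_dominated_cvg _ _ _ (path w) T mT (fun k => trunc h' k) h (fun x => `|h x|) _ _ _ _ _).2.
- by move=> n; exact: (measurable_funTS (mtrunc n)).
- exact: mh.
- exists (T `\` E); split; [exact: measurableD|exact: path_TE|].
  by move=> x /= /not_implyP[Tx nc]; split => // Ex; apply: nc; exact: trunc_cvg.
- by apply: integrable_norm; exact: hwI.
- apply: aeW => x n Tx; rewrite (le_trans (trunc_le n x))//.
  by rewrite /h' patchE mem_set.
Qed.

(** The bound |phi y| <= |y|, valid for sin and for cos - 1, makes |h lam| a dominating function. *)
Let lam_trunc_cvg (phi : R -> R) : continuous phi -> (forall y, `|phi y| <= `|y|) ->
  (fun k => \int[leb]_(x in T) (phi (trunc h' k x) * lam x)) @ \oo -->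
  \int[leb]_(x in T) (phi (h x) * lam x).
Proof.
move=> cphi phi_le; have mphi : measurable_fun setT phi by exact: continuous_measurable_fun.
apply: (@Rintegral_dominated_cvg _ _ _ leb T mT (fun k x => phi (trunc h' k x) * lam x)
  (fun x => phi (h x) * lam x) (fun x => `|h x * lam x|) _ _ _ _ _).2.
- move=> n; apply: measurable_funM => //; apply: measurableT_comp => //.
  exact: (measurable_funTS (mtrunc n)).
- by apply: measurable_funM => //; exact: measurableT_comp.
- exists (T `\` E); split; [exact: measurableD|exact: leb_TE|].
  move=> x /= /not_implyP[Tx nc]; split => // Ex; apply: nc; apply: cvgMr_tmp.
  by apply: continuous_cvg; [exact: cphi|exact: trunc_cvg].
- exact: habsI.
- apply: aeW => x n Tx; rewrite !normrM ler_wpM2r// (le_trans (phi_le _))//.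
  by rewrite (le_trans (trunc_le n x))// /h' patchE mem_set.
Qed.

Let stint_charfun_lim (phi : R -> R) : continuous phi -> (forall y, `|phi y| <= 1) ->
  (forall k, \int[P]_w phi (stint (trunc h' k) w) =
     expR (\int[leb]_(x in T) ((cos (trunc h' k x) - 1) * lam x)) *
     phi (\int[leb]_(x in T) (sin (trunc h' k x) * lam x))) ->
  \int[P]_w phi (stint h w) =
     expR (\int[leb]_(x in T) ((cos (h x) - 1) * lam x)) *
     phi (\int[leb]_(x in T) (sin (h x) * lam x)).
Proof.
move=> cphi phi1 e; have mphi : measurable_fun setT phi by exact: continuous_measurable_fun.
have ccos : continuous (fun y : R => cos y - 1).
  by move=> y; apply: cvgB; [exact: continuous_cos|exact: cvg_cst].
have c1 := lam_trunc_cvg ccos (@ler_abs_cosB1_id _).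
have c2 := lam_trunc_cvg (@continuous_sin _) (@ler_abs_sin _).
have [|||||_] := @Rintegral_dominated_cvg _ _ _ P setT measurableT
  (fun k w => phi (stint (trunc h' k) w)) (fun w => phi (stint h w)) (cst 1).
- move=> k; apply: measurableT_comp => //; apply: (measurable_process X_poisson).
  by case: (h_trunc_good k).
- apply: measurableT_comp => //; apply: (measurable_process X_poisson).
  exact: stint_measurable_exhaustion.
- apply: filterS stint_trunc_cvg => w cw _.
  by apply: continuous_cvg; [exact: cphi|exact: cw].
- by apply: (@bounded_integrable _ _ _ _ _ _ 1) => // x; rewrite normr1.
- by apply: aeW => w n _; exact: phi1.
under eq_fun do rewrite e.
move=> /cvg_unique; apply => //; apply: cvgM.
  by apply: continuous_cvg; [exact: continuous_expR|exact: c1].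
by apply: continuous_cvg; [exact: cphi|exact: c2].
Qed.

Lemma stint_cos_exhaustion : \int[P]_w cos (stint h w) =
  expR (\int[leb]_(x in T) ((cos (h x) - 1) * lam x)) *
  cos (\int[leb]_(x in T) (sin (h x) * lam x)).
Proof.
apply: stint_charfun_lim; [exact: continuous_cos|exact: cos_max|].
by move=> k; case: (h_trunc_good k).
Qed.

Lemma stint_sin_exhaustion : \int[P]_w sin (stint h w) =
  expR (\int[leb]_(x in T) ((cos (h x) - 1) * lam x)) *
  sin (\int[leb]_(x in T) (sin (h x) * lam x)).
Proof.
apply: stint_charfun_lim; [exact: continuous_sin|exact: sin_max|].
by move=> k; case: (h_trunc_good k).
Qed.

End exhaustion.

Variable h : R -> R.
Hypothesis mh : measurable_fun T h.

Lemma stint_measurable : measurable_fun setT ((fun w => stint h w) : Omega' -> R).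
Proof.
have [s [t [st [nd ex]]]] := observation_exhaustion T_itv.
exact: (stint_measurable_exhaustion st nd ex mh).
Qed.

Hypothesis hI : leb.-integrable T (fun x => (h x * lam x)%:E).

Lemma stint_integrable_ae : {ae P, forall w, (path w).-integrable T (EFin \o h)}.
Proof.
have [s [t [st [nd ex]]]] := observation_exhaustion T_itv.
exact: (stint_integrable_ae_exhaustion st nd ex mh hI).
Qed.

Theorem stint_cos : \int[P]_w cos (stint h w) =
  expR (\int[leb]_(x in T) ((cos (h x) - 1) * lam x)) *
  cos (\int[leb]_(x in T) (sin (h x) * lam x)).
Proof.
have [s [t [st [nd ex]]]] := observation_exhaustion T_itv.
exact: (stint_cos_exhaustion st nd ex mh hI).
Qed.

Theorem stint_sin : \int[P]_w sin (stint h w) =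
  expR (\int[leb]_(x in T) ((cos (h x) - 1) * lam x)) *
  sin (\int[leb]_(x in T) (sin (h x) * lam x)).
Proof.
have [s [t [st [nd ex]]]] := observation_exhaustion T_itv.
exact: (stint_sin_exhaustion st nd ex mh hI).
Qed.

End campbell_integrable.

(** * Approximation by trigonometric polynomials *)

Section bernstein.
Context {R : realType}.
Implicit Types (N k : nat) (s v : R) (phi psi : nat -> R).

(* [bern N s phi] is the mean of [phi k] for a binomial(N, s) variable k. *)
Fixpoint bern N s phi : R :=
  if N is N'.+1 then s * bern N' s (phi \o S) + (1 - s) * bern N' s phi else phi 0%N.

Lemma bern_cst N s v : bern N s (fun=> v) = v.
Proof. by elim: N => //= N IH; rewrite /comp IH; ring. Qed.

Lemma bernD N s phi psi : bern N s (phi \+ psi) = bern N s phi + bern N s psi.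
Proof.
elim: N phi psi => //= N IH phi psi.
by rewrite (_ : (phi \+ psi) \o S = (phi \o S) \+ (psi \o S))// !IH; ring.
Qed.

Lemma bernZ N s v phi : bern N s (fun k => v * phi k) = v * bern N s phi.
Proof.
elim: N phi => //= N IH phi.
by rewrite (_ : _ \o S = fun k => v * (phi \o S) k)// !IH; ring.
Qed.

Lemma ler_bern N s phi psi : 0 <= s <= 1 ->
  (forall k, (k <= N)%N -> phi k <= psi k) -> bern N s phi <= bern N s psi.
Proof.
move=> /andP[s0 s1]; elim: N phi psi => [|N IH] phi psi h /=; first exact: h.
apply: lerD; apply: ler_wpM2l; rewrite ?subr_ge0//; apply: IH => k kN.
  exact: h.
by apply: h; rewrite ltnW.
Qed.

Lemma ler_abs_bern N s phi v : 0 <= s <= 1 ->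
  (forall k, (k <= N)%N -> `|phi k| <= v) -> `|bern N s phi| <= v.
Proof.
move=> s01 h; rewrite ler_norml -{2}(bern_cst N s v) -(bern_cst N s (- v)).
by apply/andP; split; apply: ler_bern => // k /h; rewrite ler_norml => /andP[].
Qed.

(** Squared bias plus binomial variance. The centre [v] is arbitrary because the recursion replaces
    it by [v - 1]. *)
Lemma bern_sqr N s v : bern N s (fun k => (k%:R - v) ^+ 2) =
  (N%:R * s - v) ^+ 2 + N%:R * s * (1 - s).
Proof.
elim: N v => [|N IH] v; first by rewrite /= !mul0r addr0.
rewrite /= (_ : _ \o S = fun k => (k%:R - (v - 1)) ^+ 2).
  by rewrite !IH -natr1; ring.
by apply/funext => k /=; rewrite -natr1; ring.
Qed.

(* Chebyshev's inequality for the binomial law. *)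
Lemma bern_approx N s phi v (eta M delta : R) : (0 < N)%N -> 0 <= s <= 1 ->
  0 <= eta -> 0 <= M -> 0 < delta ->
  (forall k, (k <= N)%N -> `|k%:R / N%:R - s| < delta -> `|phi k - v| <= eta) ->
  (forall k, (k <= N)%N -> `|phi k - v| <= M) ->
  `|bern N s phi - v| <= eta + M / (delta ^+ 2 * N%:R).
Proof.
move=> N0 s01 eta0 M0 d0 near_phi phiM.
have N0' : 0 < N%:R :> R by rewrite ltr0n.
pose c := M / (delta * N%:R) ^+ 2.
have c0 : 0 <= c by rewrite divr_ge0// sqr_ge0.
have bnd k : (k <= N)%N -> `|phi k - v| <= eta + c * (k%:R - N%:R * s) ^+ 2.
  move=> kN; have [kd|kd] := ltP `|k%:R / N%:R - s| delta.
    by rewrite (le_trans (near_phi k kN kd))// lerDl mulr_ge0// sqr_ge0.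
  rewrite (le_trans (phiM k kN))// -[leLHS]add0r lerD//.
  rewrite /c -[leLHS]mulr1 -mulrA ler_wpM2l//.
  rewrite ler_pdivlMl ?exprn_gt0 ?mulr_gt0// mulr1.
  have kd' : delta * N%:R <= `|k%:R - N%:R * s|.
    have -> : k%:R - N%:R * s = (k%:R / N%:R - s) * N%:R.
      by rewrite mulrBl mulfVK ?gt_eqF// (mulrC s).
    by rewrite normrM (ger0_norm (ltW N0')) ler_wpM2r// ltW.
  rewrite -[leRHS]real_normK ?num_real//.
  by apply: lerXn2r kd'; rewrite ?nnegrE ?normr_ge0// mulr_ge0// ltW.
have -> : bern N s phi - v = bern N s (phi \+ fun=> - v) by rewrite bernD bern_cst.
(* Only monotonicity of [bern] is at hand, so the two sides of the absolute value are bounded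
   separately; the sign treats both. *)
have B (sg : bool) : bern N s (fun k => (-1) ^+ sg * (phi k - v)) <= eta + M / (delta ^+ 2 * N%:R).
  apply: (@le_trans _ _ (bern N s ((fun=> eta) \+ fun k => c * (k%:R - N%:R * s) ^+ 2))).
    apply: ler_bern => // k /bnd; apply: le_trans.
    by rewrite (le_trans (ler_norm _))// normrM normr_sign mul1r.
  rewrite bernD bern_cst bernZ bern_sqr subrr expr0n/= add0r lerD2l.
  have ss : s * (1 - s) <= 1.
    by move: s01 => /andP[? ?]; nra.
  have -> : M / (delta ^+ 2 * N%:R) = c * N%:R.
    rewrite /c; field; by rewrite !gt_eqF.
  by rewrite ler_wpM2l// -mulrA -[leRHS]mulr1 ler_wpM2l// ltW.
rewrite ler_norml lerNl; apply/andP; split.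
  have := B true; rewrite bernZ /= expr1 mulN1r; exact.
have := B false; rewrite bernZ /= expr0 mul1r; exact.
Qed.

End bernstein.

Section sine_separation.
Context {R : realType}.

(** With h = (a - b) / 2 and m = (a + b) / 2 the two sides are 2 sin^2 h and 2 sin h cos m, so it is
    enough that sin h <= cos m; this holds because |m| <= pi / 2 - h. *)
Lemma sin_gap (a b : R) : - (pi / 2) <= b -> b <= a -> a <= pi / 2 ->
  1 - cos (a - b) <= sin a - sin b.
Proof.
move=> pb ba ap; pose h := (a - b) / 2; pose m := (a + b) / 2.
have -> : a = m + h by rewrite /h /m; field.
have -> : b = m - h by rewrite /h /m; field.
have -> : m + h - (m - h) = h *+ 2 by rewrite mulr2n; ring.
rewrite cos_mulr2n sinD sinB.
have h0 : 0 <= h by rewrite /h; lra.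
have h1 : h <= pi / 2 by rewrite /h; lra.
have sh : 0 <= sin h.
  by apply: sin_ge0_pi; rewrite h0/= (le_trans h1)// ler_pdivrMr// ler_peMr ?pi_ge0// ler1n.
have cm : sin h <= cos m.
  rewrite -cos_norm -cosBpihalf -cosN opprB.
  have pi0 := pi_gt0 R.
  rewrite leNgt ltr_cos ?in_itv/=; last 2 first.
  - by apply/andP; split; lra.
  - by rewrite normr_ge0/= ler_norml /m; apply/andP; split; lra.
  rewrite -leNgt ler_norml /m /h; apply/andP; split; lra.
rewrite -subr_ge0.
have -> : sin m * cos h + cos m * sin h - (sin m * cos h - cos m * sin h) -
   (1 - (cos h ^+ 2 *+ 2 - 1)) = 2 * sin h * (cos m - sin h) + 2 * (sin h ^+ 2 + cos h ^+ 2 - 1).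
  by rewrite mulr2n; ring.
rewrite [sin h ^+ 2 + _]addrC cos2Dsin2 subrr mulr0 addr0.
by rewrite mulr_ge0 ?mulr_ge0// subr_ge0.
Qed.

(** Uniform continuity of the inverse sine. It turns closeness of the Bernstein nodes in the
    variable (1 + sin (c x_i)) / 2 into closeness in x_i. *)
Lemma sin_separation (rho : R) : 0 < rho -> exists2 delta : R, 0 < delta &
  forall a b, - (pi / 2) <= a <= pi / 2 -> - (pi / 2) <= b <= pi / 2 ->
    `|sin a - sin b| < delta -> `|a - b| < rho.
Proof.
move=> rho0; pose r := Num.min rho pi.
have pi0 := pi_gt0 R.
have r0 : 0 < r by rewrite lt_min rho0.
have rpi : r <= pi by rewrite ge_min lexx orbT.
exists (1 - cos r).
  by rewrite subr_gt0 -cos0 ltr_cos// in_itv/= ?lexx ?(ltW pi0) ?(ltW r0).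
move=> a b; wlog ba : a b / b <= a => [H ha hb|].
  have [ba|/ltW ab] := leP b a; first exact: H.
  by rewrite distrC [in X in _ -> X]distrC; exact: H.
move=> /andP[a1 a2] /andP[b1 b2] sab.
have ab0 : 0 <= a - b by rewrite subr_ge0.
rewrite ger0_norm//; apply: (@lt_le_trans _ _ r); last by rewrite ge_min lexx.
rewrite -ltr_cos ?in_itv/= ?ab0 ?rpi ?(ltW r0)//=; last by lra.
have := le_lt_trans (le_trans (sin_gap b1 ba a2) (ler_norm _)) sab.
by rewrite ltrBlDr -ltrBlDl opprB addrC -addrA; lra.
Qed.

End sine_separation.

Section row_vectors.
Context {R : realType} {d : nat}.
Local Notation V := 'rV[R]_d.
Implicit Types (u x y : V).

Definition dot u x : R := (u *m x^T) 0 0.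

Lemma dotE u x : dot u x = \sum_i u 0 i * x 0 i.
Proof. by rewrite /dot mxE; apply: eq_bigr => i _; rewrite mxE. Qed.

Lemma dotDl u v x : dot (u + v) x = dot u x + dot v x.
Proof. by rewrite /dot mulmxDl mxE. Qed.

Lemma dotNl u x : dot (- u) x = - dot u x.
Proof. by rewrite /dot mulNmx mxE. Qed.

Lemma dotZl a u x : dot (a *: u) x = a * dot u x.
Proof. by rewrite /dot -scalemxAl mxE. Qed.

Lemma dot0l x : dot 0 x = 0.
Proof. by rewrite /dot mul0mx mxE. Qed.

Lemma dotDr u x y : dot u (x + y) = dot u x + dot u y.
Proof. by rewrite /dot linearD mulmxDr mxE. Qed.

Lemma dotZr a u x : dot u (a *: x) = a * dot u x.
Proof. by rewrite /dot linearZ -scalemxAr mxE. Qed.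

Lemma dot_delta i x : dot (delta_mx 0 i) x = x 0 i.
Proof.
rewrite dotE (bigD1 i)//= big1 ?addr0 ?mxE ?eqxx ?mul1r// => j ji.
by rewrite mxE (negbTE ji) mul0r.
Qed.

Lemma ler_abs_coord x i : `|x 0 i| <= `|x|.
Proof.
rewrite [leRHS]/Num.norm/= mx_normrE.
by apply/bigmax_geP; right => /=; exists (0, i).
Qed.

Lemma ler_mxnorm x (e : R) : 0 <= e -> (forall i, `|x 0 i| <= e) -> `|x| <= e.
Proof.
move=> e0 xe; rewrite [leLHS]/Num.norm/= mx_normrE.
by apply/bigmax_leP; split => // -[i j] _ /=; rewrite ord1.
Qed.

Lemma ler_abs_dot u x : `|dot u x| <= (\sum_i `|u 0 i|) * `|x|.
Proof.
rewrite dotE (le_trans (ler_norm_sum _ _ _))// mulr_suml.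
by apply: ler_sum => i _; rewrite normrM ler_wpM2l// ler_abs_coord.
Qed.

Lemma continuous_dot u : continuous (dot u).
Proof.
rewrite (_ : dot u = fun x => \sum_i u 0 i * x 0 i); last first.
  by apply/funext => y; rewrite dotE.
apply: continuous_big => [|i _ x]; first exact: add_continuous.
have h : (fun y : V => y 0 i) @ x --> x 0 i := @coord_continuous R 1 d 0 i x.
exact: cvgM (cvg_cst _) h.
Qed.

Inductive trig_poly : (V -> R) -> Prop :=
| trig_poly_cos u : trig_poly (fun x => cos (dot u x))
| trig_poly_sin u : trig_poly (fun x => sin (dot u x))
| trig_polyD p q : trig_poly p -> trig_poly q -> trig_poly (fun x => p x + q x)
| trig_polyZ a p : trig_poly p -> trig_poly (fun x => a * p x).

Lemma trig_poly_eq p q : p =1 q -> trig_poly p -> trig_poly q.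
Proof. by move=> /funext ->. Qed.

Lemma trig_poly_cst a : trig_poly (fun=> a).
Proof.
apply: trig_poly_eq (trig_polyZ a (trig_poly_cos 0)) => x.
by rewrite dot0l cos0 mulr1.
Qed.

(** Product-to-sum formulas on the generators, with the frequencies u + v and u - v, extended by
    linearity in each factor. *)
Lemma trig_polyM p q : trig_poly p -> trig_poly q -> trig_poly (fun x => p x * q x).
Proof.
move=> tp; elim: tp q => {p} [u|u|p1 p2 _ IH1 _ IH2|a p _ IH] q tq; last 2 first.
- by apply: trig_poly_eq (trig_polyD (IH1 q tq) (IH2 q tq)) => x; rewrite mulrDl.
- by apply: trig_poly_eq (trig_polyZ a (IH q tq)) => x; rewrite mulrA.
- elim: tq => {q} [v|v|q1 q2 _ IH1 _ IH2|a q _ IH]; last 2 first.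
  + by apply: trig_poly_eq (trig_polyD IH1 IH2) => x; rewrite mulrDr.
  + by apply: trig_poly_eq (trig_polyZ a IH) => x; rewrite mulrCA.
  + apply: trig_poly_eq (trig_polyD (trig_polyZ 2^-1 (trig_poly_cos (u + v)))
      (trig_polyZ 2^-1 (trig_poly_cos (u - v)))) => x.
    by rewrite !dotDl dotNl cosD cosB; field.
  + apply: trig_poly_eq (trig_polyD (trig_polyZ 2^-1 (trig_poly_sin (u + v)))
      (trig_polyZ (- 2^-1) (trig_poly_sin (u - v)))) => x.
    by rewrite !dotDl dotNl sinD sinB; field.
- elim: tq => {q} [v|v|q1 q2 _ IH1 _ IH2|a q _ IH]; last 2 first.
  + by apply: trig_poly_eq (trig_polyD IH1 IH2) => x; rewrite mulrDr.
  + by apply: trig_poly_eq (trig_polyZ a IH) => x; rewrite mulrCA.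
  + apply: trig_poly_eq (trig_polyD (trig_polyZ 2^-1 (trig_poly_sin (u + v)))
      (trig_polyZ 2^-1 (trig_poly_sin (u - v)))) => x.
    by rewrite !dotDl dotNl sinD sinB; field.
  + apply: trig_poly_eq (trig_polyD (trig_polyZ 2^-1 (trig_poly_cos (u - v)))
      (trig_polyZ (- 2^-1) (trig_poly_cos (u + v)))) => x.
    by rewrite !dotDl dotNl cosB cosD; field.
Qed.

Lemma trig_poly_continuous p : trig_poly p -> continuous p.
Proof.
elim=> {p} [u|u|p q _ cp _ cq|a p _ cp] x.
- by apply: continuous_comp; [exact: continuous_dot|exact: continuous_cos].
- by apply: continuous_comp; [exact: continuous_dot|exact: continuous_sin].
- exact: cvgD (cp x) (cq x).
- exact: cvgM (cvg_cst a) (cp x).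
Qed.

Lemma trig_poly_bern N (s : V -> R) (p : nat -> V -> R) : trig_poly s ->
  (forall k, trig_poly (p k)) -> trig_poly (fun x => bern N (s x) (p ^~ x)).
Proof.
move=> ts; elim: N p => [|N IH] p tp /=; first exact: tp.
apply: trig_polyD; apply: trig_polyM => //.
- exact: (IH (fun k => p k.+1)).
- apply: trig_poly_eq (trig_polyD (trig_poly_cst 1) (trig_polyZ (-1) ts)) => x.
  by rewrite mulN1r.
- exact: IH.
Qed.

Definition box (K : R) : set V := [set x | forall i, `|x 0 i| <= K].

Lemma box_compact K : compact (box K).
Proof.
have -> : box K = [set v : V | forall i, `[- K, K]%classic (v ord0 i)].
  by apply/seteqP; split => x h i; have := h i; rewrite /= in_itv/= ler_norml.
by apply: (@rV_compact R d (fun=> `[- K, K]%classic)) => _; exact: segment_compact.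
Qed.

(** Uniform continuity by compactness, in near-covering form. Only [x] is required to lie in the
    box, so the perturbed point need not be checked. *)
Lemma continuous_box_uniform (f : V -> R) (K eta : R) : continuous f -> 0 < eta ->
  exists2 rho : R, 0 < rho & forall x y, box K x -> `|x - y| < rho -> `|f x - f y| < eta.
Proof.
move=> cf eta0.
pose Q (rho : R) (x : V) := forall y, `|x - y| < rho -> `|f x - f y| < eta.
have : \forall rho \near 0^'+, box K `<=` Q rho.
  have nc := (compact_near_coveringP _).1 (@box_compact K).
  apply: (nc R (at_right 0) Q) => x _.
  have e2 : 0 < eta / 2 by rewrite divr_gt0.
  have /cvgrPdist_lt/(_ _ e2)/nbhs_ballP[r r0 hr] := cf x.
  have r20 : 0 < r / 2 by rewrite divr_gt0.
  exists (ball x (r / 2), [set rho | rho < r / 2]) => /=.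
    split; first exact: nbhsx_ballx.
    exact: nbhs_right_lt.
  move=> [x' rho] /= [xx' rr] y x'y.
  have fx' : `|f x - f x'| < eta / 2.
    by apply: hr; apply: le_ball xx'; move: r20; lra.
  have fy : `|f x - f y| < eta / 2.
    apply: hr; rewrite -ball_normE/=; move: xx'; rewrite -ball_normE/= => xx'.
    rewrite (splitr r) -(subrKA x') (le_lt_trans (ler_normD _ _))// ltrD//.
    exact: lt_trans rr.
  rewrite (splitr eta) -(subrKA (f x)) (le_lt_trans (ler_normD _ _))// ltrD//.
  by rewrite distrC.
move=> h; near (at_right (0 : R)) => rho; exists rho; first by near: rho; exact: nbhs_right_gt.
move=> x y Kx; have : box K `<=` Q rho by near: rho.
by move=> /(_ x Kx); exact.
Unshelve. all: by end_near. Qed.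

Definition replace i (a : R) x : V := x + (a - x 0 i) *: delta_mx 0 i.

Lemma replaceE i (a : R) x j : replace i a x 0 j = if j == i then a else x 0 j.
Proof.
rewrite /replace !mxE eqxx/=; case: eqP => [->|_]; last by rewrite mulr0 addr0.
by rewrite mulr1 addrC subrK.
Qed.

Lemma continuous_replace i (a : R) : continuous (replace i a).
Proof.
move=> x; have h : (fun y : V => y 0 i) @ x --> x 0 i := @coord_continuous R 1 d 0 i x.
have FF : Filter (nbhs x) by exact: nbhs_filter.
have h2 : (fun y : V => a - y 0 i) @ x --> a - x 0 i.
  exact: (@cvgB _ _ _ _ _ _ _ _ _ (cvg_cst a) h).
have h3 : (fun y : V => (a - y 0 i) *: (delta_mx 0 i : V)) @ x --> (a - x 0 i) *: delta_mx 0 i.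
  exact: (@cvgZr_tmp _ _ _ _ _ _ _ _ h2).
exact: (@cvgD _ _ _ _ _ _ _ _ _ (@cvg_id _ _) h3).
Qed.

Lemma replace_dist i (a : R) x : `|replace i a x - x| <= `|a - x 0 i|.
Proof.
apply: ler_mxnorm => // j; rewrite !mxE addrC addrA addNr add0r eqxx/=.
by case: eqP => _; rewrite ?mulr1 ?mulr0 ?normr0.
Qed.

(* Bernstein approximation in one coordinate, with binomial parameter
   (1 + sin (c x_i)) / 2, turns f into a convex combination of trigonometric
   polynomials in x_i with coefficients depending on the other coordinates. *)
Lemma trig_approx_coords (K C : R) (l : seq 'I_d) (f : V -> R) (eps : R) :
  0 < K -> continuous f -> (forall x, `|f x| <= C) ->
  (forall x y, (forall i, i \in l -> x 0 i = y 0 i) -> f x = f y) -> 0 < eps ->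
  exists p, [/\ trig_poly p, forall x, `|p x| <= C &
    forall x, box K x -> `|p x - f x| <= eps].
Proof.
move=> K0; elim: l f eps => [|i l IH] f eps cf fC fl eps0.
  exists (fun=> f 0); split => [||x _]; [exact: trig_poly_cst|by []|].
  by rewrite (fl x 0)// subrr normr0 ltW.
have C0 : 0 <= C by rewrite (le_trans _ (fC 0)).
have pi0 := pi_gt0 R.
have e3 : 0 < eps / 3 by rewrite divr_gt0.
have [rho rho0 frho] := continuous_box_uniform K cf e3.
(* With this scale [-K, K] is mapped onto [-pi/2, pi/2], where the sine is injective. *)
pose c := pi / 2 / K.
have c0 : 0 < c by rewrite !divr_gt0.
have cK : c * K = pi / 2 by rewrite /c divfK// gt_eqF.
have [delta delta0 hdelta] := sin_separation (mulr_gt0 c0 rho0).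
(* Halved because the binomial parameter is (1 + sin) / 2. *)
pose de := delta / 2; have de0 : 0 < de by rewrite divr_gt0.
have [N N0 hN] : exists2 N, (0 < N)%N & 2 * C / (de ^+ 2 * N%:R) <= eps / 3.
  near \oo => N; exists N; first by near: N; exact: nbhs_infty_gt.
  have N0 : 0 < N%:R :> R by rewrite ltr0n; near: N; exact: nbhs_infty_gt.
  rewrite ler_pdivrMr ?mulr_gt0 ?exprn_gt0// mulrA -ler_pdivrMl ?mulr_gt0 ?exprn_gt0//.
  by near: N; exact: nbhs_infty_ger.
(* The point of [-K, K] at which the binomial parameter equals k / N. *)
pose node k : R := asin (k%:R / N%:R * 2 - 1) / c.
have nodeP k : (k <= N)%N -> `|node k| <= K /\ sin (c * node k) = k%:R / N%:R * 2 - 1 /\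
    - (pi / 2) <= c * node k <= pi / 2.
  move=> kN; have kN1 : 0 <= (k%:R / N%:R : R) <= 1.
    by rewrite divr_ge0//= ler_pdivrMr ?ltr0n// mul1r ler_nat.
  have a1 : -1 <= (k%:R / N%:R * 2 - 1 : R) <= 1 by move: kN1 => /andP[? ?]; apply/andP; split; lra.
  have cn : c * node k = asin (k%:R / N%:R * 2 - 1) by rewrite /node mulrC divfK// gt_eqF.
  have b : - (pi / 2) <= c * node k <= pi / 2.
    by rewrite cn asin_geNpi2// asin_lepi2.
  split; last by split => //; rewrite cn asinK// in_itv/=.
  have : `|c * node k| <= pi / 2 by rewrite ler_norml.
  by rewrite normrM (gtr0_norm c0) -cK ler_pM2l.
pose s x : R := (1 + sin (c * x 0 i)) / 2.
have s01 x : 0 <= s x <= 1.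
  by have := sin_geN1 (c * x 0 i); have := sin_le1 (c * x 0 i); rewrite /s => h1 h2; apply/andP; split; lra.
have ts : trig_poly s.
  apply: trig_poly_eq (trig_polyD (trig_poly_cst 2^-1) (trig_polyZ 2^-1
    (trig_poly_sin (c *: delta_mx 0 i)))) => x.
  by rewrite dotZl dot_delta /s; field.
(* With coordinate i frozen at a node, the function depends only on the coordinates in [l], so the
   induction hypothesis applies. Its error is one third of [eps]; the others are the oscillation of
   f over [rho] and the Chebyshev tail. *)
have [p hp] : exists p : nat -> V -> R, forall k, [/\ trig_poly (p k), forall x, `|p k x| <= C &
    forall x, box K x -> `|p k x - f (replace i (node k) x)| <= eps / 3].
  suff /choice[q hq] : forall k, exists q : V -> R, [/\ trig_poly q, forall x, `|q x| <= C &
    forall x, box K x -> `|q x - f (replace i (node k) x)| <= eps / 3] by exists q.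
  move=> k; apply: IH => //.
  - move=> x; apply: continuous_comp; [exact: continuous_replace|exact: cf].
  - move=> x y xy; apply: fl => j; rewrite inE !replaceE.
    by case: eqP => //= _ /xy.
exists (fun x => bern N (s x) (p ^~ x)); split.
- by apply: trig_poly_bern => // k; case: (hp k).
- by move=> x; apply: ler_abs_bern => // k _; case: (hp k).
- move=> x Kx.
  have -> : bern N (s x) (p ^~ x) - f x =
      bern N (s x) (fun k => p k x - f (replace i (node k) x)) +
      (bern N (s x) (fun k => f (replace i (node k) x)) - f x).
    rewrite addrA -bernD; congr (bern _ _ _ - _); apply/funext => k /=; ring.
  have -> : eps = eps / 3 + (eps / 3 + eps / 3) by field.
  rewrite (le_trans (ler_normD _ _))// lerD//.
    by apply: ler_abs_bern => // k _; have [_ _] := hp k; exact.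
  rewrite (le_trans _ (lerD (lexx _) hN))//.
  apply: bern_approx => //; first exact: ltW.
  + by rewrite mulr_ge0.
  + move=> k kN ks; have [nK [sn nb]] := nodeP k kN; apply: ltW.
    rewrite distrC; apply: frho => //; rewrite distrC.
    rewrite (le_lt_trans (replace_dist _ _ _))//.
    have /hdelta : - (pi / 2) <= c * x 0 i <= pi / 2.
      by rewrite -ler_norml normrM (gtr0_norm c0) -cK ler_pM2l.
    move=> /(_ _ nb) hx; rewrite -(ltr_pM2l c0) -[X in X * `|_|](gtr0_norm c0) -normrM mulrBr distrC.
    apply: hx.
    rewrite distrC sn; move: ks; rewrite /s /de => ks.
    have -> : k%:R / N%:R * 2 - 1 - sin (c * x 0 i) = 2 * (k%:R / N%:R - (1 + sin (c * x 0 i)) / 2).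
      by field; rewrite pnatr_eq0 -lt0n.
    by rewrite normrM ger0_norm// mulrC -ltr_pdivlMr.
  + by move=> k _; rewrite (le_trans (ler_normB _ _))// mulr2n mulrDl mul1r lerD.
Unshelve. all: by end_near. Qed.

Lemma trig_approx (K C : R) (f : V -> R) (eps : R) :
  0 < K -> continuous f -> (forall x, `|f x| <= C) -> 0 < eps ->
  exists p, [/\ trig_poly p, forall x, `|p x| <= C &
    forall x, `|x| <= K -> `|p x - f x| <= eps].
Proof.
move=> K0 cf fC eps0.
have [|p [tp pC pf]] := @trig_approx_coords K C (enum 'I_d) f eps K0 cf fC _ eps0.
  by move=> x y xy; congr f; apply/rowP => i; apply: xy; rewrite mem_enum.
exists p; split => // x xK; apply: pf => i.
by rewrite (le_trans (ler_abs_coord _ _)).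
Qed.

End row_vectors.

(** * Weak convergence from characteristic functions *)

Section borel_row_vectors.
Context {R : realType} {d : nat}.
Local Notation V := 'rV[R]_d.
Local Notation B := (borel_rV R d).

Lemma measurable_open (U : set V) : open U -> measurable (U : set B).
Proof. exact: sub_sigma_algebra. Qed.

Lemma measurable_fun_continuous_rV (f : V -> R) : continuous f ->
  measurable_fun setT (f : B -> R).
Proof.
move=> /continuousP cf; apply: (measurability _ (RGenOInfty.measurableE R)).
move=> _ [_ [a ->] <-]; rewrite setTI; apply: measurable_open.
by apply: cf; exact: interval_open.
Qed.

Lemma ltr_mxnorm (x : V) (e : R) : 0 < e -> (forall i, `|x 0 i| < e) -> `|x| < e.
Proof.
move=> e0 xe; rewrite [ltLHS]/Num.norm/= mx_normrE.
by apply/bigmax_ltP; split => // -[i j] _ /=; rewrite ord1.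
Qed.

(* Open sets of 'rV are countable unions of rational cubes. *)
Lemma measurable_fun_rV dO (Omega : measurableType dO) (Y : Omega -> V) :
  (forall i, measurable_fun setT (fun w => Y w 0 i)) ->
  measurable_fun setT (Y : Omega -> B).
Proof.
move=> mY; apply: (@measurability _ _ Omega B setT Y (@open V)) => // _ [U oU <-]; rewrite setTI.
pose cube (q : 'rV[rat]_d) (n : nat) : set V :=
  [set x | forall i, `|ratr (q 0 i) - x 0 i| < n.+1%:R^-1].
have mcube q n : measurable (Y @^-1` cube q n).
  have -> : Y @^-1` cube q n = \bigcap_(i in [set: 'I_d])
      (fun w => `|ratr (q 0 i) - Y w 0 i|) @^-1` `]-oo, n.+1%:R^-1[.
    apply/seteqP; split => [w h i _|w h i]; first by rewrite /= in_itv/=; exact: h.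
    by have := h i I; rewrite /= in_itv.
  apply: fin_bigcap_measurable => // i _; rewrite -[X in measurable X]setTI.
  have : measurable_fun setT (fun w => `|ratr (q 0 i) - Y w 0 i|).
    by apply: measurableT_comp => //; apply: measurable_funB.
  by apply => //; exact: measurable_itv.
(* All rational cubes are kept as indices, which makes the family countable; those not inside [U]
   contribute the empty set. *)
pose G (k : 'rV[rat]_d * nat) : set Omega :=
  if `[< cube k.1 k.2 `<=` U >] then Y @^-1` cube k.1 k.2 else set0.
have -> : Y @^-1` U = \bigcup_(k in [set: 'rV[rat]_d * nat]) G k.
  apply/seteqP; split => [w Uw|w [k _]]; last first.
    by rewrite /G; case: asboolP => // cU cw; exact: cU.
  have : nbhs (Y w) U by exact: open_nbhs_nbhs.
  move=> /nbhs_ballP[r /= r0 rU].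
  have [n nr] : exists n, n.+1%:R^-1 < r / 2.
    have r20 : 0 < r / 2 by lra.
    by have [n _ /(_ n (leqnn n)) nr] := near_infty_natSinv_lt (PosNum r20); exists n.
  have n0 : 0 < n.+1%:R^-1 :> R by rewrite invr_gt0.
  have hq (v y : R) : 0 < v -> exists q : rat, `|ratr q - y| < v.
    move=> v0; have lt : y - v < y + v by lra.
    have [q] := rat_in_itvoo lt.
    by rewrite in_itv/= => /andP[q1 q2]; exists q; rewrite ltr_norml; apply/andP; split; lra.
  have [q hq'] := choice (fun i => hq _ (Y w 0 i) n0).
  exists (\row_i q i, n) => //; rewrite /G asboolT/=.
    by move=> i; rewrite mxE.
  move=> x hx; apply: rU; rewrite -ball_normE/=.
  apply: ltr_mxnorm => // i; rewrite !mxE.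
  have := hx i; have := hq' i; rewrite mxE => h1 h2.
  rewrite distrC in h1; rewrite (le_lt_trans (ler_distD (ratr (q i)) _ _))//.
  by rewrite (splitr r) ltrD// (lt_trans _ nr).
apply: countable_bigcupT_measurable => // k; rewrite /G.
by case: asboolP => _; [exact: mcube|exact: measurable0].
Qed.

Lemma measurable_fun_coord dO (Omega : measurableType dO) (Y : Omega -> V) i :
  measurable_fun setT (Y : Omega -> B) -> measurable_fun setT (fun w => Y w 0 i).
Proof.
move=> mY; have mc : measurable_fun setT ((fun x : V => x 0 i) : B -> R).
  by apply: measurable_fun_continuous_rV => x; exact: (@coord_continuous R 1 d 0 i x).
exact: (measurableT_comp mc mY).
Qed.

Lemma measurable_fun_comp_rV dO (Omega : measurableType dO) (Y : Omega -> V) (f : V -> R) :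
  continuous f -> measurable_fun setT (Y : Omega -> B) ->
  measurable_fun setT (fun w => f (Y w)).
Proof. by move=> cf mY; exact: (measurableT_comp (measurable_fun_continuous_rV cf) mY). Qed.

End borel_row_vectors.

Lemma probability_indic d (T : measurableType d) (R : realType) (P : probability T R)
  (A : set T) : measurable A -> \int[P]_x \1_A x = fine (P A).
Proof. by move=> mA; rewrite /Rintegral integral_indic// setIT. Qed.

(** Serves both the trigonometric approximation, where [A] is the outside of a large ball, and the
    delta method, where [A] is the event that Y_n is large. *)
Lemma Rintegral_close d (T : measurableType d) (R : realType) (P : probability T R)
    (A : set T) (f p : T -> R) (C e e' : R) : measurable A ->
  measurable_fun setT f -> measurable_fun setT p ->
  (forall x, `|f x| <= C) -> (forall x, `|p x| <= C) ->
  0 <= e -> (forall x, ~ A x -> `|p x - f x| <= e) -> (P A <= e'%:E)%E ->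
  `|\int[P]_x p x - \int[P]_x f x| <= e + 2 * C * e'.
Proof.
move=> mA mf mp fC pC e0 pf PA.
have C0 : 0 <= C by rewrite (le_trans _ (fC point)).
have fI := @bounded_integrable _ _ _ P _ _ _ measurableT mf fC.
have pI := @bounded_integrable _ _ _ P _ _ _ measurableT mp pC.
rewrite -RintegralB//.
have mpf : measurable_fun setT (fun x => p x - f x) by exact: measurable_funB.
have pfC x : `|p x - f x| <= C + C by rewrite (le_trans (ler_normB _ _))// lerD.
have pfI := @bounded_integrable _ _ _ P _ _ _ measurableT mpf pfC.
apply: (le_trans (le_normr_Rintegral measurableT pfI)).
have iI : P.-integrable setT (EFin \o (\1_A : T -> R)).
  apply: (@bounded_integrable _ _ _ _ _ _ 1) => //.
  by move=> x; rewrite indicE; case: (_ \in _); rewrite ?normr1 ?normr0.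
have eI : P.-integrable setT (EFin \o (cst e : T -> R)).
  by apply: (@bounded_integrable _ _ _ _ _ _ `|e|).
have cI : P.-integrable setT (EFin \o (fun x => 2 * C * \1_A x)).
  exact: integrable_scale.
apply: (@le_trans _ _ (\int[P]_x (cst e x + 2 * C * \1_A x))).
  apply: le_Rintegral => //; first exact: integrable_norm.
    exact: (integrableD measurableT eI cI).
  move=> x _; rewrite indicE; have [Ax|Ax] := pselect (A x).
    rewrite mem_set// mulr1 (le_trans (pfC x))// -[leLHS]add0r lerD//.
    by rewrite mulr2n mulrDl mul1r.
  by rewrite memNset// mulr0 addr0; exact: pf.
rewrite RintegralD// Rintegral_cst// RintegralZl// probability_indic//.
rewrite [X in fine X](probability_setT P) mulr1 lerD2l ler_wpM2l ?mulr_ge0//.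
by rewrite -lee_fin fineK// fin_num_measure.
Qed.

Section weak_convergence.
Context {R : realType} {d : nat} {dO : measure_display} {Omega : measurableType dO}.
Local Notation V := 'rV[R]_d.
Variables (P : probability Omega R) (Y : nat -> Omega -> V) (mu : probability (borel_rV R d) R).
Hypothesis mY : forall n, measurable_fun setT (Y n : Omega -> borel_rV R d).

Lemma measurable_norm_gt (K : R) : measurable ([set x : V | K < `|x|] : set (borel_rV R d)).
Proof.
have := @measurable_fun_continuous_rV R d Num.norm (@norm_continuous _ _).
move=> /(_ measurableT `]K, +oo[%classic (measurable_itv _)); rewrite setTI.
congr measurable; apply/seteqP; split => x /=; by rewrite in_itv/= andbT.
Qed.

Lemma probability_tight (e : R) : 0 < e ->
  exists2 K : R, 0 < K & (mu [set x | (K < `|x : V|)%R] <= e%:E)%E.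
Proof.
move=> e0.
pose f (n : nat) (x : borel_rV R d) : R := \1_[set x : V | n.+1%:R < `|x|] x.
have mf n : measurable_fun setT (f n).
  by apply: measurable_indic; exact: measurable_norm_gt.
have [||_ cf] := @bounded_cvg _ _ _ mu f (cst 0) 1 mf.
- by move=> n x; rewrite /f indicE; case: (_ \in _); rewrite ?normr1 ?normr0.
- move=> x; apply: cvg_near_cst; near=> n; rewrite /f indicE memNset//=.
  apply/negP; rewrite -leNgt (@le_trans _ _ n%:R)// ?ler_nat//.
  by near: n; exact: nbhs_infty_ger.
have [n _ hn] : \forall n \near \oo, \int[mu]_x f n x < e.
  apply: (cvgr_lt _ cf); by rewrite Rintegral_cst// mul0r.
exists n.+1%:R => //; have := hn n (leqnn n).
rewrite /f probability_indic; last exact: measurable_norm_gt.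
move=> /ltW; rewrite -lee_fin fineK// fin_num_measure//; exact: measurable_norm_gt.
Unshelve. all: by end_near. Qed.

Lemma cvg_in_distribution_trig :
  (forall u, (fun n => \int[P]_w cos (dot u (Y n w))) @ \oo --> \int[mu]_x cos (dot u x)) ->
  (forall u, (fun n => \int[P]_w sin (dot u (Y n w))) @ \oo --> \int[mu]_x sin (dot u x)) ->
  (forall e : R, 0 < e -> exists2 K : R, 0 < K &
     \forall n \near \oo, (P [set w | (K < `|Y n w|)%R] <= e%:E)%E) ->
  cvg_in_distribution P Y mu.
Proof.
move=> hc hs tight f cf [C fC].
have mfY n (g : V -> R) : continuous g -> measurable_fun setT (fun w => g (Y n w)).
  by move=> cg; exact: measurable_fun_comp_rV.
have bnd (p : V -> R) : trig_poly p -> exists M : R, forall x, `|p x| <= M.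
  elim=> [u|u|p1 p2 _ [M1 h1] _ [M2 h2]|a p1 _ [M1 h1]].
  - by exists 1 => x; exact: cos_max.
  - by exists 1 => x; exact: sin_max.
  - by exists (M1 + M2) => x; rewrite (le_trans (ler_normD _ _))// lerD.
  - by exists (`|a| * M1) => x; rewrite normrM ler_wpM2l.
have hp (p : V -> R) : trig_poly p ->
    (fun n => \int[P]_w p (Y n w)) @ \oo --> \int[mu]_x p x.
  elim=> {p} [u|u|p q tp IHp tq IHq|a p tp IHp]; [exact: hc|exact: hs| |].
  - have [M pM] := bnd p tp; have [N qN] := bnd q tq.
    have cp := trig_poly_continuous tp; have cq := trig_poly_continuous tq.
    rewrite RintegralD//; last 2 first.
    + by apply: (@bounded_integrable _ _ _ _ _ _ M) => //; exact: measurable_fun_continuous_rV.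
    + by apply: (@bounded_integrable _ _ _ _ _ _ N) => //; exact: measurable_fun_continuous_rV.
    rewrite (_ : (fun n => _) = fun n => \int[P]_w p (Y n w) + \int[P]_w q (Y n w)).
      exact: cvgD.
    apply/funext => n; rewrite RintegralD//.
    + by apply: (@bounded_integrable _ _ _ _ _ _ M) => //; exact: mfY.
    + by apply: (@bounded_integrable _ _ _ _ _ _ N) => //; exact: mfY.
  - have [M pM] := bnd p tp; have cp := trig_poly_continuous tp.
    rewrite RintegralZl//; last first.
      by apply: (@bounded_integrable _ _ _ _ _ _ M) => //; exact: measurable_fun_continuous_rV.
    rewrite (_ : (fun n => _) = fun n => a * \int[P]_w p (Y n w)).
      exact: cvgMl_tmp.
    apply/funext => n; rewrite RintegralZl//.
    by apply: (@bounded_integrable _ _ _ _ _ _ M) => //; exact: mfY.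
have C0 : 0 <= C by rewrite (le_trans _ (fC 0)).
apply/cvgrPdist_le => e e0.
(* Replacing f by p costs at most e1 + 2 C e2 <= 2 e1 under each of the two laws, and convergence
   for p costs e1. The 1 in the denominator of [e2] allows C = 0. *)
pose e1 := e / 5; have e10 : 0 < e1 by rewrite divr_gt0.
pose e2 := e1 / (2 * C + 1); have e20 : 0 < e2.
  by rewrite divr_gt0// ltr_wpDl// mulr_ge0.
have Ce2 : 2 * C * e2 <= e1.
  rewrite /e2 mulrA ler_pdivrMr; last by rewrite ltr_wpDl// mulr_ge0.
  by rewrite mulrC ler_wpM2l// ?ltW// ltrDl.
have [K1 K10 hK1] := tight e2 e20; have [K2 K20 hK2] := probability_tight e20.
pose K := Num.max K1 K2.
have K0 : 0 < K by rewrite lt_max K10.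
have [p [tp pC pf]] := trig_approx K0 cf fC e10.
have cp := trig_poly_continuous tp.
have pfN x : ~ (K < `|x|) -> `|p x - f x| <= e1.
  by move=> /negP; rewrite -leNgt; exact: pf.
have hmu : `|\int[mu]_x p x - \int[mu]_x f x| <= e1 + 2 * C * e2.
  apply: (@Rintegral_close _ _ _ mu [set x : V | K < `|x|]) => //.
  - exact: measurable_norm_gt.
  - exact: measurable_fun_continuous_rV.
  - exact: measurable_fun_continuous_rV.
  - exact: ltW.
  - apply: le_trans hK2; apply: le_measure; rewrite ?inE; try exact: measurable_norm_gt.
    by move=> x /=; apply: le_lt_trans; rewrite le_max lexx orbT.
have := hp p tp => /cvgrPdist_le/(_ e1 e10) hpn.
near=> n.
have hP : `|\int[P]_w p (Y n w) - \int[P]_w f (Y n w)| <= e1 + 2 * C * e2.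
  have mK k : measurable [set w | k < `|Y n w|].
    by rewrite -[X in measurable X]setTI; exact: (mY n measurableT (measurable_norm_gt k)).
  apply: (@Rintegral_close _ _ _ P [set w | K < `|Y n w|]) => //.
  - exact: mfY.
  - exact: mfY.
  - exact: ltW.
  - by move=> w; exact: pfN.
  - apply: (@le_trans _ _ (P [set w | (K1 < `|Y n w|)%R])); last by near: n.
    apply: le_measure; rewrite ?inE//.
    by move=> w /=; apply: le_lt_trans; rewrite le_max lexx.
have hpn' : `|\int[mu]_x p x - \int[P]_w p (Y n w)| <= e1 by near: n.
rewrite distrC in hP.
have : `|\int[mu]_x f x - \int[P]_w f (Y n w)| <=
   (e1 + 2 * C * e2) + e1 + (e1 + 2 * C * e2).
  rewrite distrC in hmu.
  have -> : \int[mu]_x f x - \int[P]_w f (Y n w) = (\int[mu]_x f x - \int[mu]_x p x) +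
    (\int[mu]_x p x - \int[P]_w p (Y n w)) + (\int[P]_w p (Y n w) - \int[P]_w f (Y n w)) by ring.
  rewrite (le_trans (ler_normD _ _))// lerD//; last by rewrite distrC.
  by rewrite (le_trans (ler_normD _ _))// lerD.
have : e = 5 * e1 by rewrite /e1; field.
move=> -> h; apply: (le_trans h); move: Ce2; move: (2 * C * e2) (e1) => z y; lra.
Unshelve. all: by end_near. Qed.

End weak_convergence.

(** * Gaussian vectors *)

Section gaussian.
Context {R : realType}.
Local Notation leb := (@lebesgue_measure R).

Lemma Rintegral_derive_vanishing (F f : R -> R) :
  (forall x : R, is_derive x 1 F (f x)) -> continuous f ->
  leb.-integrable setT (EFin \o f) ->
  (fun n : nat => F n%:R) @ \oo --> (0 : R) -> (fun n : nat => F (- n%:R)) @ \oo --> (0 : R) ->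
  \int[leb]_x f x = 0.
Proof.
move=> dF cf fI F0 FN0.
have mf : measurable_fun setT f by exact: continuous_measurable_fun.
pose f_ (n : nat) := f \_ `[- n%:R, n%:R]%classic.
have mf_ n : measurable_fun setT (f_ n).
  by apply/(measurable_restrictT _ (measurable_itv _)); exact: measurable_funTS.
have cF : continuous F.
  move=> x; apply/differentiable_continuous/derivable1_diffP.
  by have := dF x => -[].
(* The index n + 1 makes the segment nondegenerate for the fundamental theorem of calculus. *)
have Hn n : \int[leb]_x f_ n.+1 x = F n.+1%:R - F (- n.+1%:R).
  rewrite -Rintegral_mkcond /Rintegral (@continuous_FTC2 _ f F)//.
  - by rewrite gtrN.
  - exact: continuous_subspaceT.
  - split => [x _||]; first by have := dF x => -[].
    + by apply: cvg_at_right_filter; exact: cF.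
    + by apply: cvg_at_left_filter; exact: cF.
  - by move=> x _; rewrite derive1E derive_val.
have [|||||_ cv] := @Rintegral_dominated_cvg _ _ _ leb setT measurableT f_ f (fun x => `|f x|).
- exact: mf_.
- exact: mf.
- apply: aeW => x _; apply: cvg_near_cst; near=> n.
  rewrite /f_ patchE mem_set//= in_itv/= -ler_norml.
  by near: n; exact: nbhs_infty_ger.
- exact: integrable_norm.
- apply: aeW => x n _; rewrite /f_ patchE; case: ifP => _ //=.
  by rewrite normr0.
have : (fun n => \int[leb]_x f_ n x) @ \oo --> (0 - 0 : R).
  rewrite -cvg_shiftS /=; rewrite (_ : (fun n : nat => _) = fun n : nat => F n.+1%:R - F (- n.+1%:R)).
    by apply: cvgB; [move: F0|move: FN0]; rewrite -cvg_shiftS.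
  by apply/funext => n; rewrite Hn.
by rewrite subr0; apply: cvg_unique.
Unshelve. all: by end_near. Qed.

Variable s : R.
Hypothesis s0 : s != 0.
Local Notation p := (normal_pdf 0 s).

Lemma is_derive_normal_pdf (x : R) : is_derive x 1 p (- (x / s ^+ 2) * p x).
Proof.
rewrite normal_pdfE//.
have E (y : R) : normal_peak s * normal_fun 0 s y = normal_peak s * expR (- (2 * s ^+ 2)^-1 * y ^+ 2).
  by rewrite /normal_fun subr0 -mulr_natl; congr (_ * expR _); field.
rewrite (funext E) E; apply: is_derive_eq; rewrite /GRing.scale/=; field.
by rewrite s0.
Qed.

(** The wider Gaussian has s' = sqrt 2 s. With y = |x| / (2 |s|) the exponents are - 2 y^2 and -
    y^2, and the claim reduces to y <= exp (y^2). *)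
Lemma normal_pdf_moment1 : exists K : R, exists2 s' : R, s' != 0 &
  forall x : R, `|x| * p x <= K * normal_pdf 0 s' x.
Proof.
pose s' := Num.sqrt 2 * s; have s'0 : s' != 0 by rewrite mulf_neq0// gt_eqF// sqrtr_gt0.
exists (2 * `|s| * normal_peak s / normal_peak s'), s' => // x.
rewrite !normal_pdfE//.
have q0 : normal_peak s' != 0 by rewrite gt_eqF// normal_peak_gt0.
have -> : 2 * `|s| * normal_peak s / normal_peak s' * (normal_peak s' * normal_fun 0 s' x) =
  normal_peak s * (2 * `|s| * normal_fun 0 s' x) by field.
rewrite [leLHS]mulrCA ler_wpM2l ?normal_peak_ge0//.
rewrite /normal_fun !subr0; set y := `|x| / (2 * `|s|).
have as0 : `|s| != 0 by rewrite normr_eq0.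
have ys : y ^+ 2 = x ^+ 2 / (s ^+ 2 *+ 4).
  by rewrite /y expr_div_n exprMn !real_normK ?num_real//; field.
have -> : `|x| = 2 * `|s| * y by rewrite /y; field.
rewrite -[leLHS]mulrA ler_wpM2l//.
have -> : - x ^+ 2 / (s ^+ 2 *+ 2) = - y ^+ 2 - y ^+ 2 by rewrite ys; field.
have -> : - x ^+ 2 / (s' ^+ 2 *+ 2) = - y ^+ 2.
  by rewrite ys /s' exprMn sqr_sqrtr//; field.
rewrite expRD mulrA ler_piMl ?expR_ge0// expRN ler_pdivrMr ?expR_gt0// mul1r.
apply: le_trans (expR_ge1Dx _); nra.
Qed.

Lemma integrable_normal_pdf_moment1 :
  leb.-integrable setT (EFin \o (fun x => `|x| * p x)).
Proof.
have [K [s' s'0 h]] := normal_pdf_moment1.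
have mp : measurable_fun setT p by exact: measurable_normal_pdf.
have KI : leb.-integrable setT (EFin \o (fun x => K * normal_pdf 0 s' x)).
  by apply: integrable_scale => //; exact: integrable_normal_pdf.
apply: le_integrable KI => //.
- by apply/measurable_EFinP; apply: measurable_funM => //; exact: measurableT_comp.
- move=> x _; rewrite lee_fin ger0_norm ?mulr_ge0 ?normal_pdf_ge0//.
  by rewrite (le_trans (h x))// ler_norm.
Qed.

(** The previous domination bounds n p(h n) by a constant, so p(h n) = O(1/n). *)
Lemma cvg_normal_pdf_infty (h : nat -> R) : (forall n, `|h n| = n%:R) ->
  (fun n => p (h n)) @ \oo --> (0 : R).
Proof.
move=> hn; have [K [s' s'0 hK]] := normal_pdf_moment1.
apply: norm_cvg0.
apply: (@squeeze_cvgr _ _ _ _ (cst 0) (fun n => n%:R^-1 * (`|K| * normal_peak s'))).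
- near=> n; have n0 : 0 < n%:R :> R by rewrite ltr0n; near: n; exact: nbhs_infty_gt.
  rewrite normr_ge0/= ger0_norm ?normal_pdf_ge0// ler_pdivlMl//.
  rewrite -[in leLHS](hn n) (le_trans (hK _))//.
  rewrite (le_trans (ler_norm _))// normrM ler_wpM2l// ger0_norm ?normal_pdf_ge0//.
  exact: normal_pdf_ub.
- exact: cvg_cst.
- rewrite -[X in _ --> X](mul0r (`|K| * normal_peak s')).
  by apply: cvgMr_tmp; rewrite -cvg_shiftS; exact: cvg_harmonic.
Unshelve. all: by end_near. Qed.

(* The ODE phi' = - s^2 t phi comes from integrating by parts against
   p' = - x / s^2 p; the phase c treats cos and sin at once. *)
Lemma normal_pdf_charfun (c t : R) :
  \int[leb]_x (cos (t * x + c) * p x) = cos c * expR (- (s ^+ 2 * t ^+ 2) / 2).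
Proof.
move: t; pose f (t x : R) : R := cos (t * x + c) * p x.
have mp : measurable_fun setT p by exact: measurable_normal_pdf.
have cp : continuous p by exact: continuous_normal_pdf.
have clin (t : R) : continuous (fun x => t * x + c).
  by move=> x; apply: cvgD; [exact: mulrl_continuous|exact: cvg_cst].
have cc (t : R) : continuous (fun x : R => cos (t * x + c)).
  by move=> x; apply: continuous_comp; [exact: clin|exact: continuous_cos].
have cs (t : R) : continuous (fun x : R => sin (t * x + c)).
  by move=> x; apply: continuous_comp; [exact: clin|exact: continuous_sin].
have fI (t : R) : leb.-integrable setT (EFin \o f t).
  have pI : leb.-integrable setT (EFin \o p) by exact: integrable_normal_pdf.
  apply: le_integrable pI => //.
  - apply/measurable_EFinP; apply: measurable_funM => //; exact: continuous_measurable_fun.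
  - move=> x _; rewrite lee_fin normrM -[leRHS]mul1r ler_wpM2r//; exact: cos_max.
have sI (t : R) : leb.-integrable setT (EFin \o (fun x => x * sin (t * x + c) * p x)).
  apply: le_integrable integrable_normal_pdf_moment1 => //.
  - apply/measurable_EFinP; apply: measurable_funM => //; apply: measurable_funM => //.
    exact: continuous_measurable_fun.
  - move=> x _; rewrite lee_fin !normrM normr_id ler_wpM2r// -[leRHS]mulr1 ler_wpM2l//.
    exact: sin_max.
(* Integration by parts: the derivative of sin (t x + c) p(x) has integral 0. *)
have parts (t : R) : \int[leb]_x (x * sin (t * x + c) * p x) = s ^+ 2 * t * \int[leb]_x f t x.
  pose F (x : R) := sin (t * x + c) * p x.
  have sI' := integrable_scale (- s ^- 2) measurableT (sI t).
  have fI' := integrable_scale t measurableT (fI t).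
  have dF (x : R) : is_derive x 1 F (t * f t x + - s ^- 2 * (x * sin (t * x + c) * p x)).
    have dp := is_derive_normal_pdf x.
    have dl : is_derive x 1 (fun x : R => t * x + c) t.
      by apply: is_derive_eq; rewrite /GRing.scale/=; ring.
    have ds : is_derive x 1 (fun x : R => sin (t * x + c)) (cos (t * x + c) * t).
      exact: (@is_derive1_comp _ sin (fun x : R => t * x + c)).
    by apply: is_derive_eq; rewrite /GRing.scale/= /f; field.
  have lim (h : nat -> R) : (forall n, `|h n| = n%:R) -> (fun n => F (h n)) @ \oo --> (0 : R).
    move=> hn; apply: norm_cvg0.
    apply: (@squeeze_cvgr _ _ _ _ (cst 0) (fun n => p (h n))).
    - apply: nearW => n; rewrite normr_ge0/= normrM (ger0_norm (normal_pdf_ge0 _ _ _)).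
      by rewrite -[leRHS]mul1r ler_wpM2r ?normal_pdf_ge0//; exact: sin_max.
    - exact: cvg_cst.
    - exact: cvg_normal_pdf_infty.
  have E : \int[leb]_x (t * f t x + - s ^- 2 * (x * sin (t * x + c) * p x)) = 0.
    apply: (@Rintegral_derive_vanishing F) => //.
    - move=> x; apply: cvgD; apply: cvgM; try exact: cvg_cst.
        by apply: cvgM; [exact: cc|exact: cp].
      by apply: cvgM; [apply: cvgM; [exact: cvg_id|exact: cs]|exact: cp].
    - exact: (integrableD measurableT fI' sI').
    - by apply: lim => n; rewrite normr_nat.
    - by apply: lim => n; rewrite normrN normr_nat.
  move: E; rewrite RintegralD// !RintegralZl//.
  set A := \int[leb]_x _; set B := \int[leb]_x _ => E.
  have -> : B = s ^+ 2 * (t * A - (t * A + - s ^- 2 * B)) by field.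
  by rewrite E subr0 mulrA.
pose phi (t : R) := \int[leb]_x f t x.
have dphi (t : R) : is_derive t 1 phi (- (s ^+ 2 * t) * phi t).
  have df (x y : R) : is_derive y 1 (f ^~ x) (- (x * sin (y * x + c) * p x)).
    have dl : is_derive y 1 (fun t : R => t * x + c) x.
      by apply: is_derive_eq; rewrite /GRing.scale/=; ring.
    have dc : is_derive y 1 (fun t : R => cos (t * x + c)) (- sin (y * x + c) * x).
      exact: (@is_derive1_comp _ cos (fun t : R => t * x + c)).
    by rewrite /f; apply: is_derive_eq; rewrite /GRing.scale/=; ring.
  have tI : `]t - 1, t + 1[%classic t by rewrite /= in_itv/=; apply/andP; split; lra.
  have bd (x y : R) : `|partial1of2 f y x| <= `|x| * p x.
    rewrite partial1of2E (@derive_val _ _ _ _ _ _ _ (df x y)) normrN !normrM.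
    rewrite (ger0_norm (normal_pdf_ge0 _ _ _)) ler_wpM2r ?normal_pdf_ge0//.
    by rewrite -[leRHS]mulr1 ler_wpM2l//; exact: sin_max.
  have fd (x y : R) : derivable (f ^~ x) y 1 by have := df x y => -[].
  have ge0 (x : R) : 0 <= `|x| * p x by rewrite mulr_ge0// normal_pdf_ge0.
  apply: DeriveDef.
    exact: (derivable_under_integral measurableT tI (fun t _ => fI t)
      (fun t x _ _ => fd x t) ge0 integrable_normal_pdf_moment1 (fun t x _ _ => bd x t)).
  rewrite -derive1E (differentiation_under_integral measurableT tI (fun t _ => fI t)
      (fun t x _ _ => fd x t) ge0 integrable_normal_pdf_moment1 (fun t x _ _ => bd x t)).
  transitivity (\int[leb]_x (- 1 * (x * sin (t * x + c) * p x))).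
    apply: eq_Rintegral => x _.
    by rewrite partial1of2E (@derive_val _ _ _ _ _ _ _ (df x t)) mulN1r.
  by rewrite RintegralZl// parts mulN1r mulNr.
(* Integrating factor: [psi] has zero derivative. *)
pose psi (t : R) := phi t * expR (s ^+ 2 * t ^+ 2 / 2).
have dpsi (t : R) : is_derive t 1 psi 0.
  have dphi' := dphi t.
  have dl : is_derive t 1 (fun t : R => s ^+ 2 * t ^+ 2 / 2) (s ^+ 2 * t).
    by apply: is_derive_eq; rewrite /GRing.scale/=; field.
  have de : is_derive t 1 (fun t : R => expR (s ^+ 2 * t ^+ 2 / 2)) (expR (s ^+ 2 * t ^+ 2 / 2) * (s ^+ 2 * t)).
    exact: (@is_derive1_comp _ expR (fun t : R => s ^+ 2 * t ^+ 2 / 2)).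
  by apply: is_derive_eq; rewrite /GRing.scale/=; ring.
move=> t; have := is_derive_0_is_cst t 0 dpsi; rewrite /psi.
have -> : phi 0 = cos c.
  rewrite /phi (_ : \int[leb]_x _ = \int[leb]_x (cos c * p x)).
    rewrite RintegralZl//; last exact: integrable_normal_pdf.
    by rewrite /Rintegral integral_normal_pdf/= mulr1.
  by apply: eq_Rintegral => x _; rewrite /f mul0r add0r.
rewrite expr0n/= mulr0 mul0r expR0 mulr1 => <-.
by rewrite -/(phi t) mulNr expRN mulfK// gt_eqF// expR_gt0.
Qed.

Lemma Rintegral_normal_prob (f : R -> R) (C : R) : measurable_fun setT f ->
  (forall x, `|f x| <= C) ->
  \int[normal_prob 0 s]_x f x = \int[leb]_x (f x * p x).
Proof.
move: f C; have mp : measurable_fun setT p by exact: measurable_normal_pdf.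
have pI : leb.-integrable setT (EFin \o p) by exact: integrable_normal_pdf.
pose N : probability _ R := normal_prob (0:R) s.
pose K (f : R -> R) := [/\ measurable_fun setT f, N.-integrable setT (EFin \o f),
  leb.-integrable setT (EFin \o (fun x => f x * p x)) &
  \int[N]_x f x = \int[leb]_x (f x * p x)].
suff KP (f : R -> R) (C : R) : measurable_fun setT f -> (forall x, `|f x| <= C) -> K f.
  by move=> f C mf fC; have [] := KP f C mf fC.
apply: bounded_measurable_ind => {f C}.
- move=> A mA; split.
  + exact: measurable_indic.
  + apply: (@bounded_integrable _ _ _ _ _ _ 1) => //.
    by move=> x; rewrite indicE; case: (_ \in _); rewrite ?normr1 ?normr0.
  + apply: le_integrable pI => //.
      by apply/measurable_EFinP; apply: measurable_funM => //; exact: measurable_indic.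
    move=> x _; rewrite lee_fin normrM indicE; case: (_ \in _); rewrite ?normr1 ?normr0 ?mul1r ?mul0r//.
  + rewrite probability_indic//.
    have -> : N A = (\int[leb]_(x in A) (p x)%:E)%E by [].
    rewrite -/(Rintegral leb A p) Rintegral_mkcond; apply: eq_Rintegral => x _.
    by rewrite patchE [\1_A x]indicE; case: (x \in A); rewrite ?mul1r ?mul0r.
- move=> f g [mf fN fl Ef] [mg gN gl Eg].
  have E x : (f \+ g) x * p x = f x * p x + g x * p x by rewrite mulrDl.
  split.
  + exact: measurable_funD.
  + exact: (integrableD measurableT fN gN).
  + by rewrite (funext E); exact: (integrableD measurableT fl gl).
  + by rewrite RintegralD// (funext E) RintegralD// Ef Eg.
- move=> a f [mf fN fl Ef].
  have E x : a * f x * p x = a * (f x * p x) by rewrite mulrA.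
  split.
  + exact: measurable_funM.
  + exact: integrable_scale.
  + by rewrite (funext E); exact: integrable_scale.
  + by rewrite RintegralZl// (funext E) RintegralZl// Ef.
- move=> f_ f C Kf mf_ fC cf.
  have [mf cN] := @bounded_cvg _ _ _ N f_ f C mf_ fC cf.
  have fb x : `|f x| <= C by exact: (norm_cvg_le (fC ^~ x) (cf x)).
  have CI := integrable_scale C measurableT pI.
  have [|||||fl cl] := @Rintegral_dominated_cvg _ _ _ leb setT measurableT
      (fun n x => f_ n x * p x) (fun x => f x * p x) (fun x => C * p x).
  + by move=> n; apply: measurable_funM => //; exact: mf_.
  + by apply: measurable_funM; [exact: mf|exact: mp].
  + by apply: aeW => x _; apply: cvgMr_tmp; exact: cf.
  + exact: CI.
  + apply: aeW => x n _; rewrite normrM (ger0_norm (normal_pdf_ge0 _ _ _)).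
    by rewrite ler_wpM2r ?normal_pdf_ge0.
  split => //.
  + exact: (@bounded_integrable _ _ _ _ _ _ C).
  + have EE : (fun n => \int[N]_x f_ n x) = fun n => \int[leb]_x (f_ n x * p x).
      by apply/funext => n; have [] := Kf n.
    by rewrite EE in cN; move: cN cl; exact: cvg_unique.
Qed.

Lemma normal_prob_cos (t : R) :
  \int[normal_prob 0 s]_x cos (t * x) = expR (- (s ^+ 2 * t ^+ 2) / 2).
Proof.
rewrite (@Rintegral_normal_prob _ 1); last 2 first.
- apply: continuous_measurable_fun => x; apply: continuous_comp; last exact: continuous_cos.
  exact: mulrl_continuous.
- by move=> x; exact: cos_max.
have := normal_pdf_charfun 0 t; rewrite cos0 mul1r => <-.
by apply: eq_Rintegral => x _; rewrite addr0.
Qed.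

(** The sine is the cosine with phase - pi / 2, and cos (- pi / 2) = 0. *)
Lemma normal_prob_sin (t : R) : \int[normal_prob 0 s]_x sin (t * x) = 0.
Proof.
rewrite (@Rintegral_normal_prob _ 1); last 2 first.
- apply: continuous_measurable_fun => x; apply: continuous_comp; last exact: continuous_sin.
  exact: mulrl_continuous.
- by move=> x; exact: sin_max.
transitivity (\int[leb]_x (cos (t * x + - (pi / 2)) * p x)).
  by apply: eq_Rintegral => x _; rewrite cosD cosN sinN cos_pihalf sin_pihalf; congr (_ * _); ring.
by rewrite normal_pdf_charfun cosN cos_pihalf mul0r.
Qed.

End gaussian.

Lemma probability_image {R : realType} d1 d2 (T1 : measurableType d1) (T2 : measurableType d2)
    (P : probability T1 R) (phi : T1 -> T2) : measurable_fun setT phi ->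
  exists nu : probability T2 R, (forall A, nu A = P (phi @^-1` A)) /\
    forall (f : T2 -> R) (C : R), measurable_fun setT f -> (forall x, `|f x| <= C) ->
      \int[nu]_x f x = \int[P]_x f (phi x).
Proof.
move=> mphi; pose X : {mfun T1 >-> T2} := mfun_Sub (mem_set mphi).
exists (distribution P X); split => // f C mf fC.
rewrite /Rintegral /distribution integral_pushforward//.
- exact/measurable_EFinP.
- exact: (@bounded_integrable _ _ _ P setT (f \o phi) C measurableT (measurableT_comp mf mphi) (fun x => fC _)).
Qed.

Lemma product_expectation {R : realType} d1 d2 (T1 : measurableType d1) (T2 : measurableType d2)
    (P1 : probability T1 R) (P2 : probability T2 R) (f : T1 -> R) (g : T2 -> R) (C : R) :
  measurable_fun setT f -> (forall x, `|f x| <= C) ->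
  measurable_fun setT g -> (forall x, `|g x| <= C) ->
  \int[(P1 \x P2)%E]_z (f z.1 * g z.2) = \int[P1]_x f x * \int[P2]_x g x.
Proof.
move=> mf fC mg gC.
have gI := @bounded_integrable _ _ _ P2 _ _ _ measurableT mg gC.
have fI := @bounded_integrable _ _ _ P1 _ _ _ measurableT mf fC.
rewrite [LHS]/Rintegral -integral12_prod_meas1; last first.
  apply: (@bounded_integrable _ _ _ (P1 \x P2)%E _ _ (C * C)) => //.
    by apply: measurable_funM; [exact: (measurableT_comp mf)|exact: (measurableT_comp mg)].
  by move=> z; rewrite normrM ler_pM.
rewrite mulrC -RintegralZl//; congr fine; apply: eq_integral => x _.
rewrite /fubini_F/= -[LHS]fineK; last first.
  apply: integrable_fin_num => //.
  by apply: (@integrable_scale _ _ _ P2) => //.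
by rewrite -/(Rintegral P2 setT (fun y => f x * g y)) RintegralZl// mulrC.
Qed.

Section gaussian_vector.
Context {R : realType}.

(** The law of sum_i xi_i b_i with independent standard normal xi_i, built one term at a time: the
    image of a product measure under (x, y) |-> x + y b_m, starting from the Dirac mass at 0. *)
Lemma gaussian_vector_exists (d m : nat) (b : nat -> 'rV[R]_d) :
  exists mu : probability (borel_rV R d) R, forall u,
    \int[mu]_x cos (dot u x) = expR (- (\sum_(i < m) dot u (b i) ^+ 2) / 2) /\
    \int[mu]_x sin (dot u x) = 0.
Proof.
elim: m => [|m [mu IH]].
  pose mu : probability (borel_rV R d) R := @dirac _ (borel_rV R d) (0 : 'rV[R]_d) R.
  exists mu => u; have E (f : R -> R) : continuous f ->
      \int[mu]_x f (dot u x) = f 0.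
    move=> cf; rewrite /Rintegral integral_dirac//.
      by rewrite diracT mul1e/= /dot trmx0 mulmx0 mxE.
    apply/measurable_EFinP; apply: (@measurable_fun_continuous_rV _ _ (fun x => f (dot u x))) => x.
    by apply: continuous_comp; [exact: continuous_dot|exact: cf].
  rewrite (E cos (@continuous_cos R)) (E sin (@continuous_sin R)) cos0 sin0.
  by rewrite big_ord0 oppr0 mul0r expR0.
pose N : probability _ R := normal_prob (0 : R) 1.
pose phi (z : borel_rV R d * measurableTypeR R) : borel_rV R d := (z.1 : 'rV[R]_d) + (z.2 : R) *: b m.
have mphi : measurable_fun setT phi.
  apply: measurable_fun_rV => i.
  rewrite (_ : (fun w => _) = fun w => (w.1 : 'rV[R]_d) 0 i + (w.2 : R) * b m 0 i); last first.
    by apply/funext => w; rewrite !mxE.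
  apply: measurable_funD.
    have mc : measurable_fun setT ((fun x : 'rV[R]_d => x 0 i) : borel_rV R d -> R).
      by apply: measurable_fun_continuous_rV => x; exact: (@coord_continuous R 1 d 0 i x).
    by apply: (measurableT_comp mc); exact: measurable_fst.
  apply: measurable_funM => //; exact: measurable_snd.
have [nu [_ nuE]] := probability_image (mu \x N)%E mphi.
exists nu => u; have [hc hs] := IH u.
have Nc := @normal_prob_cos R 1 (oner_neq0 _) (dot u (b m)).
have Ns := @normal_prob_sin R 1 (oner_neq0 _) (dot u (b m)).
have mN (f : R -> R) : continuous f -> measurable_fun setT (fun x : R => f (dot u (b m) * x)).
  move=> cf; apply: continuous_measurable_fun => x; apply: continuous_comp; last exact: cf.
  exact: mulrl_continuous.
have mmu (f : R -> R) : continuous f -> measurable_fun setT ((fun x => f (dot u x)) : borel_rV R d -> R).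
  move=> cf; apply: measurable_fun_continuous_rV => x.
  by apply: continuous_comp; [exact: continuous_dot|exact: cf].
have c1 : (forall x : R, `|cos x| <= 1) by exact: cos_max.
have s1 : (forall x : R, `|sin x| <= 1) by exact: sin_max.
have cc := @continuous_cos R; have cs := @continuous_sin R.
have I (f g : R -> R) : continuous f -> continuous g -> (forall x, `|f x| <= 1) ->
   (forall x, `|g x| <= 1) ->
   (mu \x N)%E.-integrable setT (EFin \o (fun z => f (dot u z.1) * g (dot u (b m) * z.2))).
  move=> cf cg f1 g1; apply: (@bounded_integrable _ _ _ (mu \x N)%E _ _ 1) => //.
    apply: measurable_funM.
      by apply: (measurableT_comp (mmu f cf)); exact: measurable_fst.
    by apply: (measurableT_comp (mN g cg)); exact: measurable_snd.
  by move=> z; rewrite normrM mulr_ile1.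
have PE (f g : R -> R) : continuous f -> continuous g -> (forall x, `|f x| <= 1) ->
   (forall x, `|g x| <= 1) ->
   \int[(mu \x N)%E]_z (f (dot u z.1) * g (dot u (b m) * z.2)) =
   \int[mu]_x f (dot u x) * \int[N]_y g (dot u (b m) * y).
  move=> cf cg f1 g1.
  exact: (@product_expectation _ _ _ _ _ mu N (fun x => f (dot u x)) (fun y => g (dot u (b m) * y)) 1
    (mmu f cf) (fun x => f1 _) (mN g cg) (fun x => g1 _)).
have E z : dot u (phi z) = dot u z.1 + dot u (b m) * z.2.
  by rewrite /phi dotDr dotZr [_ * z.2]mulrC.
split.
- rewrite (nuE _ 1 (mmu cos cc))//.
  transitivity (\int[(mu \x N)%E]_z (cos (dot u z.1) * cos (dot u (b m) * z.2) -
      sin (dot u z.1) * sin (dot u (b m) * z.2))).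
    by apply: eq_Rintegral => z _; rewrite E cosD.
  rewrite RintegralB//; [|exact: I..].
  rewrite !PE// hc hs mul0r subr0 Nc -expRD big_ord_recr/=; congr expR.
  by rewrite expr1n; ring.
- rewrite (nuE _ 1 (mmu sin cs))//.
  transitivity (\int[(mu \x N)%E]_z (sin (dot u z.1) * cos (dot u (b m) * z.2) +
      cos (dot u z.1) * sin (dot u (b m) * z.2))).
    by apply: eq_Rintegral => z _; rewrite E sinD.
  rewrite RintegralD//; [|exact: I..].
  by rewrite !PE// hs Ns mul0r mulr0 addr0.
Qed.

End gaussian_vector.

(** * Laws on the line are determined by their characteristic functions *)

Section charfun_unique.
Context {R : realType}.
Local Notation RR := (measurableTypeR R).
Variables N1 N2 : probability RR R.
Hypothesis N12c : forall t : R, \int[N1]_x cos (t * x) = \int[N2]_x cos (t * x).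
Hypothesis N12s : forall t : R, \int[N1]_x sin (t * x) = \int[N2]_x sin (t * x).

(** [cvg_in_distribution_trig] for a constant sequence: [N1], carried to row vectors of length 1,
    converges in distribution to the image of [N2], and a constant sequence of integrals equals its
    limit. Tightness is that of the image of [N1]. *)
Lemma charfun_unique_continuous (h : R -> R) (C : R) : continuous h ->
  (forall x, `|h x| <= C) -> \int[N1]_x h x = \int[N2]_x h x.
Proof.
move=> ch hC; pose emb (x : RR) : borel_rV R 1 := (const_mx (x : R) : 'rV[R]_1).
have memb : measurable_fun setT emb.
  apply: measurable_fun_rV => i.
  apply: (eq_measurable_fun (fun w : RR => w : R)) => [x _|]; first by rewrite /emb mxE.
  exact: measurable_id.
have [nu1 [nu1E _]] := probability_image N1 memb.
have [nu2 [_ nu2E]] := probability_image N2 memb.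
have dotE1 (u : 'rV[R]_1) (x : RR) : dot u (emb x) = u 0 0 * (x : R).
  by rewrite dotE big_ord1 mxE.
have m (f : R -> R) : continuous f -> forall u, measurable_fun setT ((fun x => f (dot u x)) : borel_rV R 1 -> R).
  move=> cf u; apply: measurable_fun_continuous_rV => x.
  by apply: continuous_comp; [exact: continuous_dot|exact: cf].
have : cvg_in_distribution N1 (fun _ : nat => emb) nu2.
  apply: cvg_in_distribution_trig => [//|u|u|e e0].
  - rewrite (nu2E _ 1 (m cos (@continuous_cos R) u) (fun x => cos_max _)).
    apply: cvg_near_cst; apply: nearW => n.
    under eq_Rintegral do rewrite dotE1.
    by rewrite N12c; apply: eq_Rintegral => x _; rewrite dotE1.
  - rewrite (nu2E _ 1 (m sin (@continuous_sin R) u) (fun x => sin_max _)).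
    apply: cvg_near_cst; apply: nearW => n.
    under eq_Rintegral do rewrite dotE1.
    by rewrite N12s; apply: eq_Rintegral => x _; rewrite dotE1.
  - have [K K0 hK] := probability_tight nu1 e0.
    by exists K => //; apply: nearW => n; move: hK; rewrite nu1E.
have c00 : continuous (fun v : 'rV[R]_1 => v 0 0) by move=> v; exact: (@coord_continuous R 1 1 0 0 v).
have cf : continuous (fun v : 'rV[R]_1 => h (v 0 0)).
  by move=> v; apply: continuous_comp; [exact: c00|exact: ch].
have fC (v : 'rV[R]_1) : `|h (v 0 0)| <= C by exact: hC.
move=> /(_ _ cf (ex_intro _ C fC)).
rewrite (nu2E _ C (measurable_fun_continuous_rV cf) fC).
move=> cv; transitivity (\int[N1]_x h ((emb x : 'rV[R]_1) 0 0)).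
  by apply: eq_Rintegral => x _; rewrite mxE.
transitivity (\int[N2]_x h ((emb x : 'rV[R]_1) 0 0)); last first.
  by apply: eq_Rintegral => x _; rewrite mxE.
by have <- := cvg_lim (@Rhausdorff R) cv; rewrite lim_cst.
Qed.

Lemma charfun_unique (A : set RR) : measurable A -> N1 A = N2 A.
Proof.
move=> mA; apply: (@measure_unique _ R RR (@RGenOInfty.G R) (fun n : nat => `]- n%:R, +oo[%classic) _ _ _ _ N1 N2) => //.
- exact: RGenOInfty.measurableE.
- move=> _ _ [a ->] [b ->]; exists (Num.max a b).
  apply/seteqP; split => x /=; rewrite !in_itv/= !andbT gt_max; first by move=> [-> ->].
  by move=> /andP[].
- by move=> n; exists (- n%:R).
- apply/seteqP; split => // x _; have [n xn] : exists n : nat, `|x : R| < n%:R.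
    by exists (Num.truncn `|x : R|).+1; exact: truncnS_gt.
  exists n => //=; rewrite in_itv/= andbT; by move: xn; rewrite ltr_norml => /andP[].
- move=> _ [a ->].
  (* Continuous ramps that converge pointwise to the indicator of the ray ]a, +oo[. *)
  pose h (n : nat) (x : R) : R := Num.min 1 (n%:R * Num.max 0 (x - a)).
  have ch n : continuous (h n).
    move=> x; apply: (@continuous_min _ _ (cst 1) (fun x => n%:R * Num.max 0 (x - a)) x).
      exact: cvg_cst.
    apply: cvgM; first exact: cvg_cst.
    apply: (@continuous_max _ _ (cst 0) (fun x => x - a) x); first exact: cvg_cst.
    by apply: cvgB; [exact: cvg_id|exact: cvg_cst].
  have h1 n x : `|h n x| <= 1.
    rewrite ger0_norm; first by rewrite ge_min lexx.
    by rewrite le_min ler01 mulr_ge0// le_max lexx.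
  have hl x : h ^~ x @ \oo --> (\1_(`]a, +oo[%classic : set R) x : R).
    rewrite indicE; have [xa|ax] := leP x a.
      rewrite memNset/=; last by rewrite in_itv/= andbT; apply/negP; rewrite -leNgt.
      apply: cvg_near_cst; apply: nearW => n.
      by rewrite /h max_l ?subr_le0// mulr0 min_r.
    rewrite mem_set/=; last by rewrite in_itv/= andbT.
    apply: cvg_near_cst; near=> n.
    rewrite /h max_r ?subr_ge0 ?ltW// min_l// -ler_pdivrMr ?subr_gt0// mul1r.
    by near: n; exact: nbhs_infty_ger.
  have mI : measurable (`]a, +oo[%classic : set RR) by exact: measurable_itv.
  have mh n : measurable_fun setT (h n : RR -> R) by exact: continuous_measurable_fun.
  have [|||_ c1] := @bounded_cvg _ _ _ N1 h (\1_(`]a, +oo[%classic : set RR)) 1; [exact: mh|exact: h1|exact: hl|].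
  have [|||_ c2] := @bounded_cvg _ _ _ N2 h (\1_(`]a, +oo[%classic : set RR)) 1; [exact: mh|exact: h1|exact: hl|].
  have E : (fun n => \int[N1]_x h n x) = fun n => \int[N2]_x h n x.
    by apply/funext => n; exact: (charfun_unique_continuous (@ch n) (h1 n)).
  rewrite E in c1.
  have : \int[N1]_x \1_(`]a, +oo[%classic : set RR) x = \int[N2]_x \1_(`]a, +oo[%classic : set RR) x.
    by rewrite -(cvg_lim _ c1)// -(cvg_lim _ c2).
  rewrite !probability_indic// => h12.
  by rewrite -[LHS]fineK ?h12 ?fineK//; exact: fin_num_measure.
- by move=> n; rewrite (le_lt_trans (probability_le1 _ _))// ?ltry.
Unshelve. all: by end_near. Qed.

End charfun_unique.

(** * Nonnegative quadratic forms as sums of squares *)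

Section sum_of_squares.
Context {R : realType} {d : nat}.
Local Notation V := 'rV[R]_d.

Lemma linear_dot (L : V -> R) : (forall a u v, L (a *: u + v) = a * L u + L v) ->
  forall u, L u = dot u (\row_i L (delta_mx 0 i)).
Proof.
move=> lin u.
have L0 : L 0 = 0.
  by have := lin 1 0 0; rewrite scale1r addr0 mul1r => /eqP; rewrite -subr_eq subrr => /eqP.
rewrite dotE {1}(row_sum_delta u); elim/big_ind2: _ => [//|x a y b <- <-|i _].
  by rewrite -[a]scale1r lin scale1r mul1r.
by rewrite mxE -[_ *: _]addr0 lin L0 addr0.
Qed.

(* Symmetric Gaussian elimination, one coordinate at a time. *)
Lemma psd_sum_squares (k : nat) (B : V -> V -> R) : (k <= d)%N ->
  (forall u v, B u v = B v u) ->
  (forall w a u v, B (a *: u + v) w = a * B u w + B v w) ->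
  (forall u, 0 <= B u u) ->
  (forall (i : 'I_d) v, (i < d - k)%N -> B (delta_mx 0 i) v = 0) ->
  exists b : nat -> V, forall u, B u u = \sum_(i < k) dot u (b i) ^+ 2.
Proof.
elim: k B => [|k IH] B kd sym lin psd B0.
  exists (fun=> 0) => u; rewrite big_ord0 (linear_dot (lin u)) dotE big1// => i _.
  by rewrite mxE B0 ?mulr0// subn0.
have lt : (d - k.+1 < d)%N by rewrite ltn_subrL (leq_ltn_trans _ kd).
(* The coordinates below d - k - 1 are already in the kernel of [B]; [e] is the next one to
   eliminate. *)
pose e : V := delta_mx 0 (Ordinal lt).
(* The next claim, [key], is Cauchy-Schwarz, including the case where [B e e] vanishes. *)
have lin' w a u v : B w (a *: u + v) = a * B w u + B w v by rewrite sym lin !(sym w).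
have key u : B u e ^+ 2 <= B e e * B u u.
  have [Bee|Bee] := eqVneq (B e e) 0.
    rewrite Bee mul0r; apply: contraT; rewrite -ltNge => Bu.
    have Bue : B u e != 0 by apply/eqP => E; move: Bu; rewrite E expr0n ltxx.
    (* When [B e e = 0] the form is affine in c along u + c e; this c gives it the value -1. *)
    pose c := - (B u u + 1) / (2 * B u e).
    have := psd (c *: e + u); rewrite lin !lin' Bee (sym e u).
    have -> : c * (c * 0 + B u e) + (c * B u e + B u u) = -1 by rewrite /c; field.
    by rewrite ler0N1.
  have Bee0 : 0 < B e e by rewrite lt0r Bee psd.
  have := psd ((- (B u e / B e e)) *: e + u); rewrite lin !lin' (sym e u).
  have -> : - (B u e / B e e) * (- (B u e / B e e) * B e e + B u e) +
    (- (B u e / B e e) * B u e + B u u) = (B e e * B u u - B u e ^+ 2) / B e e by field.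
  by rewrite pmulr_lge0 ?invr_gt0// subr_ge0.
pose s := Num.sqrt (B e e).
have s2 : s ^+ 2 = B e e by rewrite sqr_sqrtr.
(* When [B e e = 0] the inverse of [s] is [0], and nothing is subtracted. *)
pose B' u v := B u v - (B u e / s) * (B v e / s).
have [|||||b hb] := IH B'; first exact: ltnW.
- by move=> u v; rewrite /B' sym mulrC.
- by move=> w a u v; rewrite /B' !lin; ring.
- move=> u; rewrite /B' subr_ge0 -expr2 expr_div_n s2.
  have [Bee|Bee] := eqVneq (B e e) 0; first by rewrite Bee invr0 mulr0.
  by rewrite ler_pdivrMr ?lt0r ?Bee ?psd// mulrC; exact: key.
- move=> i v idk; rewrite /B'.
  have [i0|i0] := ltnP i (d - k.+1); first by rewrite !B0// !mul0r subr0.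
  have -> : i = Ordinal lt.
    apply/val_inj => /=; apply/eqP; rewrite eqn_leq i0 andbT.
    by rewrite subnS -ltnS prednK ?subn_gt0.
  rewrite -/e; have [Bee|Bee] := eqVneq (B e e) 0.
    have := key v; rewrite Bee mul0r => /(conj (sqr_ge0 (B v e)))/andP/le_anti/esym/eqP.
    by rewrite sqrf_eq0 (sym e v) => /eqP ->; rewrite !mul0r subr0.
  have s0 : s != 0 by rewrite -(sqrf_eq0 s) s2.
  by rewrite (sym e v) -s2; field.
have linb : forall a u v, B (a *: u + v) e / s = a * (B u e / s) + B v e / s.
  by move=> a u v; rewrite lin; ring.
exists (fun i => if i is i'.+1 then b i' else \row_i (B (delta_mx 0 i) e / s)) => u.
rewrite big_ord_recl/= -(linear_dot linb) -hb /B'; ring.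
Qed.

End sum_of_squares.

(** A linear form <u, x> has characteristic function exp (- v t^2 / 2) with v = u D u^T, and
    [charfun_unique] identifies its law; v = 0 is treated apart, being the Dirac case of
    [normal_law]. The characteristic function stays in the conclusion because convergence in
    distribution is tested against it. *)
Lemma multivariate_normal_exists {R : realType} (d : nat) (D : 'M[R]_d) :
  D^T = D -> (forall u : 'rV[R]_d, 0 <= (u *m D *m u^T) 0 0) ->
  exists2 mu : probability (borel_rV R d) R, multivariate_normal mu 0 D &
    forall u, \int[mu]_x cos (dot u x) = expR (- (u *m D *m u^T) 0 0 / 2) /\
    \int[mu]_x sin (dot u x) = 0.
Proof.
move=> symD psdD.
have [||||b hb] := @psd_sum_squares R d d (fun u v => (u *m D *m v^T) 0 0) (leqnn d).
- move=> u v; rewrite -[in LHS](trmxK (u *m D *m v^T)) [LHS]mxE.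
  by rewrite !trmx_mul trmxK symD mulmxA.
- by move=> w a u v; rewrite !mulmxDl -!scalemxAl !mxE.
- exact: psdD.
- by move=> i v; rewrite subnn.
have [mu hmu] := gaussian_vector_exists d b.
have {}hmu u : \int[mu]_x cos (dot u x) = expR (- (u *m D *m u^T) 0 0 / 2) /\
    \int[mu]_x sin (dot u x) = 0 by rewrite hb; exact: hmu.
exists mu => // u A mA.
rewrite trmx0 mulmx0 [in RHS]mxE; set v := (u *m D *m u^T) 0 0.
pose phi (x : borel_rV R d) : measurableTypeR R := dot u x.
have mphi : measurable_fun setT phi by apply: measurable_fun_continuous_rV; exact: continuous_dot.
have [nu [nuA nuE]] := probability_image mu mphi.
have mlin (f : R -> R) (t : R) : continuous f -> measurable_fun setT (fun x : measurableTypeR R => f (t * x)).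
  move=> cf; apply: continuous_measurable_fun => x; apply: continuous_comp; last exact: cf.
  exact: mulrl_continuous.
have vt (t : R) : ((t *: u) *m D *m (t *: u)^T) 0 0 = t ^+ 2 * v.
  by rewrite -!scalemxAl linearZ/= -scalemxAr scalerA mxE -expr2.
have nuc (t : R) : \int[nu]_x cos (t * x) = expR (- (v * t ^+ 2) / 2).
  rewrite (nuE (fun x => cos (t * x)) 1 (mlin cos t (@continuous_cos R)) (fun x => cos_max _)).
  by rewrite [v * _]mulrC -vt -(hmu _).1; apply: eq_Rintegral => x _; rewrite dotZl.
have nus (t : R) : \int[nu]_x sin (t * x) = 0.
  rewrite (nuE (fun x => sin (t * x)) 1 (mlin sin t (@continuous_sin R)) (fun x => sin_max _)).
  by rewrite -[RHS](hmu (t *: u)).2; apply: eq_Rintegral => x _; rewrite dotZl.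
transitivity (nu A); first by rewrite nuA.
rewrite /normal_law; case: ifPn => [/eqP v0|v0].
  pose N2 : probability (measurableTypeR R) R := @dirac _ (measurableTypeR R) (0 : R) R.
  have E (f : R -> R) (t : R) : continuous f -> \int[N2]_x f (t * x) = f 0.
    move=> cf; rewrite /Rintegral integral_dirac//.
      by rewrite diracT mul1e/= mulr0.
    by apply/measurable_EFinP; exact: mlin.
  apply: (@charfun_unique R nu N2) => // t.
  - by rewrite nuc (E cos _ (@continuous_cos R)) v0 mul0r oppr0 mul0r expR0 cos0.
  - by rewrite nus (E sin _ (@continuous_sin R)) sin0.
have v1 : 0 < v by rewrite lt0r v0 psdD.
have s0 : Num.sqrt v != 0 by rewrite gt_eqF// sqrtr_gt0.
pose N2 : probability (measurableTypeR R) R := normal_prob (0 : R) (Num.sqrt v).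
apply: (@charfun_unique R nu N2) => // t.
- by rewrite nuc (normal_prob_cos s0) sqr_sqrtr// ltW.
- by rewrite nus (normal_prob_sin s0).
Qed.

(** * The normalized empirical moments *)

Section scaling.
Context {R : realType}.

(** Equal to 0 at n = 0, so that n ([rsqrt] n)^2 is 0 there and 1 for every positive n. *)
Definition rsqrt (n : nat) : R := (Num.sqrt n%:R)^-1.

Lemma rsqrt_ge0 n : 0 <= rsqrt n. Proof. by rewrite invr_ge0 sqrtr_ge0. Qed.

Lemma rsqrt_sqr n : rsqrt n ^+ 2 = n%:R^-1.
Proof. by rewrite exprVn sqr_sqrtr. Qed.

Lemma rsqrt_le1 n : n%:R * rsqrt n ^+ 2 <= 1.
Proof.
rewrite rsqrt_sqr; case: n => [|n]; first by rewrite mul0r.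
by rewrite divff ?pnatr_eq0.
Qed.

Lemma cvg_rsqrt : rsqrt @ \oo --> (0 : R).
Proof.
have -> : rsqrt = fun n => Num.sqrt (n%:R^-1) by apply/funext => n; rewrite sqrtrV.
have c0 : (fun n : nat => n%:R^-1) @ \oo --> (0 : R).
  by rewrite -cvg_shiftS; exact: cvg_harmonic.
rewrite -[X in _ --> X](sqrtr0 R).
by apply: (cvg_comp _ _ c0); exact: sqrt_continuous.
Qed.

Lemma ler_abs_cos_scaled n (x : R) : `|n%:R * (cos (x * rsqrt n) - 1)| <= x ^+ 2.
Proof.
rewrite normrM normr_nat (@le_trans _ _ (n%:R * (x * rsqrt n) ^+ 2))//.
  rewrite ler_wpM2l// (le_trans (ler_abs_cosB1 _))// ler_piMr ?sqr_ge0//; lra.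
by rewrite exprMn mulrCA ler_piMr ?sqr_ge0// rsqrt_le1.
Qed.

Lemma ler_abs_sin_scaled n (x : R) : `|n%:R * (sin (x * rsqrt n) - x * rsqrt n)| <= x ^+ 2.
Proof.
rewrite normrM normr_nat (@le_trans _ _ (n%:R * (x * rsqrt n) ^+ 2))//.
  by rewrite ler_wpM2l// ler_abs_sinBid_sqr.
by rewrite exprMn mulrCA ler_piMr ?sqr_ge0// rsqrt_le1.
Qed.

Lemma cvg_of_dist_le (u b : nat -> R) (l : R) :
  (\forall n \near \oo, `|u n - l| <= b n) -> b @ \oo --> (0 : R) -> u @ \oo --> l.
Proof.
move=> ub b0; apply/cvgrPdist_le => e e0.
have /cvgrPdist_le/(_ e e0) be := b0.
near=> n; rewrite distrC; apply: (@le_trans _ _ (b n)); first by near: n.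
have : `|0 - b n| <= e by near: n.
by rewrite sub0r normrN; apply: le_trans; exact: ler_norm.
Unshelve. all: by end_near. Qed.

Lemma rsqrt_sqrM n : (0 < n)%N -> n%:R * rsqrt n ^+ 2 = 1.
Proof. by move=> n0; rewrite rsqrt_sqr divff// pnatr_eq0 -lt0n. Qed.

Lemma cvg_cos_scaled (x : R) :
  (fun n => n%:R * (cos (x * rsqrt n) - 1)) @ \oo --> - (x ^+ 2 / 2).
Proof.
apply: (@cvg_of_dist_le _ (fun n => `|x| ^+ 4 / 24 * (rsqrt n * rsqrt n))); last first.
  rewrite -[X in _ --> X](mulr0 (`|x| ^+ 4 / 24)); apply: cvgMl_tmp.
  by rewrite -[X in _ --> X](mulr0 0); exact: (cvgM cvg_rsqrt cvg_rsqrt).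
near=> n; have n0 : (0 < n)%N by near: n; exact: nbhs_infty_gt.
have E := rsqrt_sqrM n0.
have -> : n%:R * (cos (x * rsqrt n) - 1) - - (x ^+ 2 / 2) =
    n%:R * (cos (x * rsqrt n) - 1 + (x * rsqrt n) ^+ 2 / 2).
  rewrite [x ^+ 2 / 2 in LHS](_ : _ = (n%:R * rsqrt n ^+ 2) * (x ^+ 2 / 2)); last by rewrite E mul1r.
  move: (cos _) => c; ring.
rewrite normrM normr_nat (@le_trans _ _ (n%:R * (`|x * rsqrt n| ^+ 4 / 24)))//.
  by rewrite ler_wpM2l// ler_abs_cosB1D.
rewrite normrM (ger0_norm (rsqrt_ge0 n)).
have -> : n%:R * ((`|x| * rsqrt n) ^+ 4 / 24) =
  (n%:R * rsqrt n ^+ 2) * (`|x| ^+ 4 / 24 * (rsqrt n * rsqrt n)) by ring.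
by rewrite E mul1r.
Unshelve. all: by end_near. Qed.

Lemma cvg_sin_scaled (x : R) :
  (fun n => n%:R * (sin (x * rsqrt n) - x * rsqrt n)) @ \oo --> (0 : R).
Proof.
apply: (@cvg_of_dist_le _ (fun n => `|x| ^+ 3 / 6 * rsqrt n)); last first.
  by rewrite -[X in _ --> X](mulr0 (`|x| ^+ 3 / 6)); apply: cvgMl_tmp; exact: cvg_rsqrt.
near=> n; have n0 : (0 < n)%N by near: n; exact: nbhs_infty_gt.
rewrite subr0 normrM normr_nat (@le_trans _ _ (n%:R * (`|x * rsqrt n| ^+ 3 / 6)))//.
  by rewrite ler_wpM2l// ler_abs_sinBid.
rewrite normrM (ger0_norm (rsqrt_ge0 n)).
have -> : n%:R * ((`|x| * rsqrt n) ^+ 3 / 6) =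
  (n%:R * rsqrt n ^+ 2) * (`|x| ^+ 3 / 6 * rsqrt n) by ring.
by rewrite rsqrt_sqrM// mul1r.
Unshelve. all: by end_near. Qed.

End scaling.

(* As [t] goes to [0], [2 (1 - cos (t y)) / t^2] tends to [y^2]. *)
Lemma truncated_second_moment {R : realType} d (T : measurableType d) (P : probability T R)
    (Y : T -> R) (v K : R) : measurable_fun setT Y ->
  (forall t, 1 - \int[P]_w cos (Y w * t) <= t ^+ 2 * v / 2 + (t ^+ 2 * v) ^+ 2 / 2) ->
  \int[P]_w Num.min (Y w ^+ 2) (K ^+ 2) <= v.
Proof.
move=> mY h.
(* 2 n (1 - cos (y / sqrt n)): nonnegative, bounded for each n, with limit y^2. The truncation at
   K^2 gives a bound independent of n. *)
pose q (n : nat) (y : R) : R := - (2 * (n%:R * (cos (y * rsqrt n) - 1))).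
pose f n w := Num.min (q n (Y w)) (K ^+ 2).
have mq n : measurable_fun setT (fun w => q n (Y w)).
  apply: (measurableT_comp _ mY); apply: continuous_measurable_fun => y.
  apply: cvgN; apply: cvgM; first exact: cvg_cst.
  apply: cvgM; first exact: cvg_cst.
  apply: cvgB; last exact: cvg_cst.
  apply: continuous_comp; last exact: continuous_cos.
  by apply: cvgM; [exact: cvg_id|exact: cvg_cst].
have q0 n y : 0 <= q n y.
  have := cos_max (y * rsqrt n); rewrite ler_norml => /andP[_ c1].
  by have := ler0n R n; rewrite /q; nra.
have qle n y : q n y <= 4 * n%:R.
  have := cos_max (y * rsqrt n); rewrite ler_norml => /andP[c1 _].
  by have := ler0n R n; rewrite /q; nra.
have mf n : measurable_fun setT (f n) by apply: measurable_minr.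
have fC n w : `|f n w| <= K ^+ 2.
  rewrite ger0_norm; first by rewrite ge_min lexx orbT.
  by rewrite le_min q0 sqr_ge0.
have cf w : f ^~ w @ \oo --> Num.min (Y w ^+ 2) (K ^+ 2).
  have c : (fun n => q n (Y w)) @ \oo --> Y w ^+ 2.
    rewrite (_ : Y w ^+ 2 = - (2 * - (Y w ^+ 2 / 2))); last by field.
    by apply: cvgN; apply: cvgMl_tmp; exact: cvg_cos_scaled.
  have cmin : {for Y w ^+ 2, continuous (fun x : R => Num.min x (K ^+ 2))}.
    apply: (@continuous_min _ _ idfun (cst (K ^+ 2))); [exact: cvg_id|exact: cvg_cst].
  by apply: (cvg_comp (fun n => q n (Y w)) (fun x : R => Num.min x (K ^+ 2)) c); exact: cmin.
have [|||_ cI] := @bounded_cvg _ _ _ P f (fun w => Num.min (Y w ^+ 2) (K ^+ 2)) (K ^+ 2);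
  [exact: mf|exact: fC|exact: cf|].
have le n : (0 < n)%N -> \int[P]_w f n w <= v + v ^+ 2 * (rsqrt n * rsqrt n).
  move=> n0; have E := @rsqrt_sqrM R _ n0.
  have qI : P.-integrable setT (EFin \o (fun w => q n (Y w))).
    apply: (@bounded_integrable _ _ _ P _ _ (4 * n%:R)) => // w.
    by rewrite ger0_norm.
  have fI : P.-integrable setT (EFin \o f n).
    exact: (@bounded_integrable _ _ _ P _ _ (K ^+ 2)).
  apply: (@le_trans _ _ (\int[P]_w q n (Y w))).
    by apply: le_Rintegral => // w _; rewrite ge_min lexx.
  have cI' : P.-integrable setT (EFin \o (fun w => cos (Y w * rsqrt n))).
    apply: (@bounded_integrable _ _ _ P _ _ 1) => //; last by move=> w; exact: cos_max.
    apply: (measurableT_comp _ (measurable_funM mY (measurable_cst _))).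
    by apply: continuous_measurable_fun; exact: continuous_cos.
  have oI : P.-integrable setT (EFin \o (cst 1 : T -> R)).
    by apply: (@bounded_integrable _ _ _ P _ _ `|1|).
  have -> : \int[P]_w q n (Y w) = 2 * n%:R * (1 - \int[P]_w cos (Y w * rsqrt n)).
    transitivity (\int[P]_w (2 * n%:R * (cst 1 w - cos (Y w * rsqrt n)))).
      by apply: eq_Rintegral => w _; rewrite /q/=; ring.
    rewrite RintegralZl//; last exact: (integrableB measurableT oI cI').
    by rewrite RintegralB// Rintegral_cst// [X in fine X](probability_setT P) mulr1.
  (* The hypothesis at t = 1 / sqrt n; multiplied by 2 n it becomes v + v^2 / n. *)
  apply: (@le_trans _ _ (2 * n%:R * (rsqrt n ^+ 2 * v / 2 + (rsqrt n ^+ 2 * v) ^+ 2 / 2))).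
    by rewrite ler_wpM2l// mulr_ge0.
  have -> : 2 * n%:R * (rsqrt n ^+ 2 * v / 2 + (rsqrt n ^+ 2 * v) ^+ 2 / 2) =
    (n%:R * rsqrt n ^+ 2) * (v + v ^+ 2 * (rsqrt n * rsqrt n)) by field.
  by rewrite E mul1r.
have lim : (fun n => v + v ^+ 2 * (rsqrt n * rsqrt n)) @ \oo --> v.
  rewrite -[X in _ --> X]addr0; apply: cvgD; first exact: cvg_cst.
  rewrite -[X in _ --> X](mulr0 (v ^+ 2)); apply: cvgMl_tmp.
  by rewrite -[X in _ --> X](mulr0 0); exact: (cvgM cvg_rsqrt cvg_rsqrt).
apply: (ler_cvg_to cI lim); near=> n; apply: le.
by near: n; exact: nbhs_infty_gt.
Unshelve. all: by end_near. Qed.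

(** Split as (1 - e^A) + e^A (1 - cos C), bounded by - A and by C^2 / 2. *)
Lemma one_sub_charfun_le {R : realType} (A C v : R) :
  - v / 2 <= A -> A <= 0 -> `|C| <= v -> 1 - expR A * cos C <= v / 2 + v ^+ 2 / 2.
Proof.
move=> vA A0 Cv.
have e1 : expR A <= 1 by rewrite -expR0 ler_expR.
have e0 := expR_ge0 A; have eA := expR_ge1Dx A.
have cC := cos_ge1Bsqr C; have c1 : cos C <= 1 by rewrite (le_trans (ler_norm _))// cos_max.
have C2 : C ^+ 2 <= v ^+ 2.
  by rewrite -real_normK ?num_real// ler_pXn2r// ?nnegrE// (le_trans _ Cv).
have : 1 - expR A * cos C = (1 - expR A) + expR A * (1 - cos C) by ring.
have : expR A * (1 - cos C) <= 1 - cos C by rewrite ler_piMl// subr_ge0.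
move=> h ->; lra.
Qed.

Section empirical_moments.
Context {R : realType} {d : nat} {T : set R} (T_itv : observation_interval T).
Context (lam : 'rV[R]_d -> R -> R) (theta0 : 'rV[R]_d) (g : R -> 'rV[R]_d).
Context {dO : measure_display} {Omega : measurableType dO} (P : probability Omega R).
Context (X : nat -> Omega -> cumulative R R).
Local Notation l := (lam theta0).
Local Notation leb := (@lebesgue_measure R).
Local Notation M := (moment T g lam theta0).
Local Notation G := (moment_cov T g lam theta0).
Hypothesis lI : intensity T l.
Hypothesis iidX : iid_poisson_processes P T l X.
Hypothesis mg : forall k, measurable_fun T (fun s => g s 0 k).
Hypothesis gfin : moments_finite T g lam theta0.

Local Notation h u := (fun s => dot u (g s)).
Local Notation stint f j w := (\int[lebesgue_stieltjes_measure (X j w)]_(s in T) f s).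

Let mT : measurable T := observation_measurable T_itv.
Let l0 s : T s -> 0 <= l s. Proof. by have [_ l0 _] := lI; exact: l0. Qed.
Let ml : measurable_fun T l. Proof. by have [ml _ _] := lI. Qed.

Let gI k : leb.-integrable T (EFin \o (fun s => g s 0 k * l s)).
Proof. exact: gfin.1. Qed.
Let ggI i k : leb.-integrable T (EFin \o (fun s => g s 0 i * g s 0 k * l s)).
Proof. exact: gfin.2. Qed.

Lemma measurable_dot_g u : measurable_fun T (h u).
Proof.
rewrite (_ : h u = fun s => \sum_i u 0 i * g s 0 i); last first.
  by apply/funext => s; rewrite dotE.
by apply: measurable_sum => i; apply: measurable_funM => //; exact: measurable_cst.
Qed.

Lemma dot_moment u : leb.-integrable T (fun s => (h u s * l s)%:E) /\
  \int[leb]_(s in T) (h u s * l s) = dot u M.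
Proof.
have E : (fun s => h u s * l s) = fun s => \sum_i (u 0 i * (g s 0 i * l s)).
  by apply/funext => s; rewrite dotE mulr_suml; apply: eq_bigr => i _; rewrite mulrA.
have uI i : leb.-integrable T (EFin \o (fun s => u 0 i * (g s 0 i * l s))).
  by apply: integrable_scale => //; exact: gI.
have [I V] := @Rintegral_sum _ _ _ leb T _ (index_enum 'I_d) (fun i s => u 0 i * (g s 0 i * l s)) mT uI.
rewrite -E in V; split; last first.
  rewrite V dotE; apply: eq_bigr => i _; rewrite mxE RintegralZl//; exact: gI.
by move: I; rewrite -E.
Qed.

Lemma quadratic_moment u : leb.-integrable T (fun s => (h u s ^+ 2 * l s)%:E) /\
  \int[leb]_(s in T) (h u s ^+ 2 * l s) = (u *m G *m u^T) 0 0.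
Proof.
pose q i k s := u 0 i * (u 0 k * (g s 0 i * g s 0 k * l s)).
have E : (fun s => h u s ^+ 2 * l s) = fun s => \sum_k \sum_i q i k s.
  apply/funext => s; rewrite expr2 {2}dotE mulr_sumr mulr_suml; apply: eq_bigr => k _.
  by rewrite dotE !mulr_suml; apply: eq_bigr => i _; rewrite /q; ring.
have qI i k : leb.-integrable T (EFin \o q i k).
  by do 2 apply: integrable_scale => //; exact: ggI.
have S k := @Rintegral_sum _ _ _ leb T _ (index_enum 'I_d) (q ^~ k) mT (qI ^~ k).
have [I V] := @Rintegral_sum _ _ _ leb T _ (index_enum 'I_d) (fun k s => \sum_i q i k s) mT (fun k => (S k).1).
rewrite -E in V; split; last first.
  rewrite V mxE; apply: eq_bigr => k _; rewrite (S k).2 !mxE mulr_suml.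
  apply: eq_bigr => i _; rewrite /q RintegralZl//; last by apply: integrable_scale => //; exact: ggI.
  rewrite RintegralZl//.
  by rewrite mxE; ring.
by move: I; rewrite -E.
Qed.

Lemma quadratic_moment_ge0 (u : 'rV[R]_d) : 0 <= (u *m G *m u^T) 0 0.
Proof.
rewrite -(quadratic_moment u).2; apply: Rintegral_ge0 => s Ts.
by rewrite mulr_ge0 ?sqr_ge0// l0.
Qed.

Definition centered (n : nat) (w : Omega) : 'rV[R]_d :=
  Num.sqrt n%:R *: (empirical_moment T g X n w - M).

Lemma stint_dot_measurable u j : measurable_fun setT (fun w => stint (h u) j w).
Proof.
have m := stint_measurable T_itv lI (iidX.1 j) (measurable_dot_g u).
exact: (measurable_process (iidX.1 j) m).
Qed.

Lemma stint_coord_measurable k j : measurable_fun setT (fun w => stint (fun s => g s 0 k) j w).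
Proof.
have m := stint_measurable T_itv lI (iidX.1 j) (mg k).
exact: (measurable_process (iidX.1 j) m).
Qed.

Lemma centered_measurable n : measurable_fun setT (centered n : Omega -> borel_rV R d).
Proof.
apply: measurable_fun_rV => k.
rewrite (_ : (fun w => _) = fun w => Num.sqrt n%:R *
   (n%:R^-1 * \sum_(j < n) stint (fun s => g s 0 k) j w - M 0 k)); last first.
  by apply/funext => w; rewrite !mxE.
apply: measurable_funM; first exact: measurable_cst.
apply: measurable_funB; last exact: measurable_cst.
apply: measurable_funM; first exact: measurable_cst.
by apply: measurable_sum => j; exact: stint_coord_measurable.
Qed.

Lemma sqrtr_nat n : Num.sqrt n%:R = n%:R * rsqrt n :> R.
Proof.
case: n => [|n]; first by rewrite sqrtr0 mul0r.
have s0 : Num.sqrt n.+1%:R != 0 :> R by rewrite gt_eqF// sqrtr_gt0.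
by rewrite /rsqrt -[X in X / _](sqr_sqrtr (ler0n R n.+1)) expr2 mulfK.
Qed.

(** Only almost sure, because linearity of the path integral in the coordinates of g needs their
    integrability along the path. The factor 1 / sqrt n goes into the integrand so that Campbell's
    formula applies to each summand. *)
Lemma dot_centered u n : {ae P, forall w, dot u (centered n w) =
  \sum_(j < n) stint (h (rsqrt n *: u)) j w - n%:R * (rsqrt n * dot u M)}.
Proof.
have : {ae P, forall w, forall (j : 'I_n) (k : 'I_d),
    (lebesgue_stieltjes_measure (X j w)).-integrable T (EFin \o (fun s => g s 0 k))}.
  apply: filter_forall => j; apply: filter_forall => k.
  exact: (stint_integrable_ae T_itv lI (iidX.1 j) (mg k) (gfin.1 k)).
apply: filterS => w I.
have E (j : 'I_n) : stint (h (rsqrt n *: u)) j w =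
    rsqrt n * \sum_k u 0 k * stint (fun s => g s 0 k) j w.
  have uI k : (lebesgue_stieltjes_measure (X j w)).-integrable T
      (EFin \o (fun s => rsqrt n * u 0 k * g s 0 k)).
    by apply: integrable_scale => //; exact: I.
  have [_ V] := @Rintegral_sum _ _ _ (lebesgue_stieltjes_measure (X j w)) T _ (index_enum 'I_d)
    (fun k s => rsqrt n * u 0 k * g s 0 k) mT uI.
  transitivity (\int[lebesgue_stieltjes_measure (X j w)]_(s in T) (\sum_k rsqrt n * u 0 k * g s 0 k)).
    by apply: eq_Rintegral => s _; rewrite dotE; apply: eq_bigr => k _; rewrite mxE.
  rewrite V mulr_sumr; apply: eq_bigr => k _; rewrite RintegralZl//; first by rewrite mulrA.
  exact: I.
rewrite (eq_bigr _ (fun j _ => E j)) -mulr_sumr /centered dotZr dotDr -scaleN1r dotZr sqrtr_nat.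
have -> : dot u (empirical_moment T g X n w) =
    n%:R^-1 * \sum_(j < n) \sum_k u 0 k * stint (fun s => g s 0 k) j w.
  rewrite dotE exchange_big/= mulr_sumr; apply: eq_bigr => k _.
  by rewrite mxE mulrCA -mulr_sumr.
(* For n = 0 both sides vanish; otherwise n cancels its inverse. *)
case: n I E => [|n] I E; first by rewrite !big_ord0 !mul0r mulr0 subr0.
have n0 : n.+1%:R != 0 :> R by rewrite pnatr_eq0.
by set a := \sum_(_ < _) _; field.
Qed.

(** Logarithm of the modulus of the characteristic function of <u, Y_n>. The factor n is inside the
    integral, where the integrand tends to - h^2 / 2 under the bound h^2. *)
Definition log_modulus u n := \int[leb]_(s in T) ((n%:R * (cos (h u s * rsqrt n) - 1)) * l s).
(** The argument of the same characteristic function. The centering term is merged into the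
    integrand, since sqrt n times the mean and the sine integral may diverge separately. *)
Definition phase u n :=
  \int[leb]_(s in T) ((n%:R * (sin (h u s * rsqrt n) - h u s * rsqrt n)) * l s).

Let scaled_integrable (q : R -> R) (c : R) u : measurable_fun setT q ->
  (forall x, `|q x| <= c * `|x|) -> leb.-integrable T (EFin \o (fun s => q (h u s) * l s)).
Proof.
move=> mq qc; have [I _] := dot_moment u.
have cI : leb.-integrable T (EFin \o (fun s => c * (h u s * l s))).
  by apply: integrable_scale.
apply: le_integrable cI => //.
- apply/measurable_EFinP; apply: measurable_funM => //.
  exact: (measurableT_comp mq (measurable_dot_g u)).
- move=> s Ts; rewrite lee_fin mulrA [leLHS]normrM [leRHS]normrM ler_wpM2r//.
  by rewrite (le_trans (qc _))// normrM ler_wpM2r// ler_norm.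
Qed.

Let mcos : measurable_fun setT (@cos R).
Proof. by apply: continuous_measurable_fun; exact: continuous_cos. Qed.
Let msin : measurable_fun setT (@sin R).
Proof. by apply: continuous_measurable_fun; exact: continuous_sin. Qed.

Lemma centered_charfun u n :
  \int[P]_w cos (dot u (centered n w)) = expR (log_modulus u n) * cos (phase u n) /\
  \int[P]_w sin (dot u (centered n w)) = expR (log_modulus u n) * sin (phase u n).
Proof.
pose u' := rsqrt n *: u.
pose Z j w := stint (h u') j w.
pose a := \int[leb]_(s in T) ((cos (h u' s) - 1) * l s).
pose b := \int[leb]_(s in T) (sin (h u' s) * l s).
pose c := n%:R * (rsqrt n * dot u M).
have mZ j : measurable_fun setT (Z j) by exact: stint_dot_measurable.
have mu' := measurable_dot_g u'; have hI' := (dot_moment u').1.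
(* Measurability with respect to the j-th path alone is what lets independence of the processes
   apply. *)
have FZ j B : measurable B -> process_sigma_algebra T (X j) (Z j @^-1` B).
  move=> mB; rewrite -[Z j @^-1` B]setTI.
  exact: (stint_measurable T_itv lI (iidX.1 j) mu' measurableT mB).
have [Ec Es] := @independent_charfun _ _ _ P (fun j => process_sigma_algebra T (X j)) Z
  (fun=> a) (fun=> b) iidX.2 mZ FZ
  (fun j A => @process_sub_measurable _ _ _ _ _ _ _ (iidX.1 j) A)
  (fun j => stint_cos T_itv lI (iidX.1 j) mu' hI')
  (fun j => stint_sin T_itv lI (iidX.1 j) mu' hI') n.
have sc (x : R) : \sum_(j < n) x = n%:R * x by rewrite sumr_const card_ord mulr_natl.
have {}Ec : \int[P]_w cos (\sum_(j < n) Z j w) = expR (n%:R * a) * cos (n%:R * b).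
  by rewrite -(sc a) -(sc b); exact: Ec.
have {}Es : \int[P]_w sin (\sum_(j < n) Z j w) = expR (n%:R * a) * sin (n%:R * b).
  by rewrite -(sc a) -(sc b); exact: Es.
have hu' s : h u' s = h u s * rsqrt n by rewrite dotZl mulrC.
have aI : leb.-integrable T (EFin \o (fun s => (cos (h u' s) - 1) * l s)).
  apply: (@scaled_integrable (fun x => cos x - 1) 1); first exact: measurable_funB.
  by move=> x; rewrite mul1r ler_abs_cosB1_id.
have bI : leb.-integrable T (EFin \o (fun s => sin (h u' s) * l s)).
  by apply: (@scaled_integrable sin 1) => // x; rewrite mul1r ler_abs_sin.
have Ea : log_modulus u n = n%:R * a.
  rewrite /a -RintegralZl//; apply: eq_Rintegral => s _; rewrite hu'; ring.
have Eb : phase u n = n%:R * b - c.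
  rewrite /b /c -(dot_moment u).2 -RintegralZl//; last exact: (dot_moment u).1.
  rewrite -[X in _ - X]RintegralZl//; last first.
    by apply: (@integrable_scale _ _ _ leb) => //; exact: (dot_moment u).1.
  rewrite -RintegralZl// -RintegralB//.
  - by apply: eq_Rintegral => s _; rewrite hu'; ring.
  - exact: integrable_scale.
  - do 2 apply: (@integrable_scale _ _ _ leb) => //; exact: (dot_moment u).1.
pose S w := \sum_(j < n) Z j w.
have mS : measurable_fun setT S by exact: measurable_sum.
have mY : measurable_fun setT (fun w => dot u (centered n w)).
  exact: (measurable_fun_comp_rV (@continuous_dot R d u) (centered_measurable n)).
have ae_expect (f : R -> R) : continuous f ->
    \int[P]_w f (dot u (centered n w)) = \int[P]_w f (S w - c).
  move=> cf; have mf : measurable_fun setT f by exact: continuous_measurable_fun.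
  congr fine; apply: ae_eq_integral => //.
  - by apply/measurable_EFinP; exact: (measurableT_comp mf mY).
  - by apply/measurable_EFinP; apply: (measurableT_comp mf); exact: measurable_funB.
  - by have := dot_centered u n; apply: filterS => w E _; rewrite E.
have cI : P.-integrable setT (EFin \o (fun w => cos (S w))).
  apply: (@bounded_integrable _ _ _ P _ _ 1) => //; last by move=> w; exact: cos_max.
  exact: (measurableT_comp mcos mS).
have sI : P.-integrable setT (EFin \o (fun w => sin (S w))).
  apply: (@bounded_integrable _ _ _ P _ _ 1) => //; last by move=> w; exact: sin_max.
  exact: (measurableT_comp msin mS).
(* The constant shift by [c] is undone with the addition formulas, which only need such
   combinations. *)
have lin (p q : R) : \int[P]_w (p * cos (S w) + q * sin (S w)) =
    p * (expR (n%:R * a) * cos (n%:R * b)) + q * (expR (n%:R * a) * sin (n%:R * b)).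
  by rewrite RintegralD//; try exact: integrable_scale; rewrite !RintegralZl// -Ec -Es.
rewrite Ea Eb; split.
- rewrite (ae_expect _ (@continuous_cos R)).
  transitivity (\int[P]_w (cos c * cos (S w) + sin c * sin (S w))).
    by apply: eq_Rintegral => w _; rewrite cosB; ring.
  by rewrite lin cosB; ring.
- rewrite (ae_expect _ (@continuous_sin R)).
  transitivity (\int[P]_w ((- sin c) * cos (S w) + cos c * sin (S w))).
    by apply: eq_Rintegral => w _; rewrite sinB; ring.
  by rewrite lin sinB; ring.
Qed.

Let cvg_scaled (f_ : nat -> R -> R) (f : R -> R) u :
  (forall n, measurable_fun setT (f_ n)) -> measurable_fun setT f ->
  (forall n x, `|f_ n x| <= x ^+ 2) -> (forall x, f_ ^~ x @ \oo --> f x) ->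
  (fun n => \int[leb]_(s in T) (f_ n (h u s) * l s)) @ \oo -->
    \int[leb]_(s in T) (f (h u s) * l s).
Proof.
move=> mf_ mf fx cf; have mh := measurable_dot_g u.
have [|||||//] := @Rintegral_dominated_cvg _ _ _ leb T mT (fun n s => f_ n (h u s) * l s)
  (fun s => f (h u s) * l s) (fun s => h u s ^+ 2 * l s).
- by move=> n; apply: measurable_funM => //; exact: (measurableT_comp (mf_ n) mh).
- by apply: measurable_funM => //; exact: (measurableT_comp mf mh).
- by apply: aeW => s _; apply: cvgMr_tmp; exact: cf.
- exact: (quadratic_moment u).1.
- by apply: aeW => s n Ts; rewrite normrM (ger0_norm (l0 Ts)) ler_wpM2r// l0.
Qed.

Let mcos_scaled n : measurable_fun setT (fun x : R => n%:R * (cos (x * rsqrt n) - 1)).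
Proof.
apply: measurable_funM => //; apply: measurable_funB => //.
by apply: (measurableT_comp mcos); exact: measurable_funM.
Qed.

Let msin_scaled n : measurable_fun setT (fun x : R => n%:R * (sin (x * rsqrt n) - x * rsqrt n)).
Proof.
apply: measurable_funM => //; apply: measurable_funB; last exact: measurable_funM.
by apply: (measurableT_comp msin); exact: measurable_funM.
Qed.

Lemma cvg_log_modulus u : log_modulus u @ \oo --> - (u *m G *m u^T) 0 0 / 2.
Proof.
rewrite -(quadratic_moment u).2.
have -> : - (\int[leb]_(s in T) (h u s ^+ 2 * l s)) / 2 =
    \int[leb]_(s in T) (- (h u s ^+ 2 / 2) * l s).
  rewrite mulNr mulrC -mulNr -RintegralZl//; last exact: (quadratic_moment u).1.
  by apply: eq_Rintegral => s _; ring.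
apply: (@cvg_scaled (fun n x => n%:R * (cos (x * rsqrt n) - 1)) (fun x => - (x ^+ 2 / 2))).
- exact: mcos_scaled.
- by apply: measurableT_comp => //; apply: measurable_funM => //; exact: exprn_measurable.
- by move=> n x; exact: ler_abs_cos_scaled.
- exact: cvg_cos_scaled.
Qed.

Lemma cvg_phase u : phase u @ \oo --> (0 : R).
Proof.
have -> : (0 : R) = \int[leb]_(s in T) (cst 0 (h u s) * l s).
  by under eq_Rintegral do rewrite mul0r; rewrite Rintegral_cst// mul0r.
apply: (@cvg_scaled (fun n x => n%:R * (sin (x * rsqrt n) - x * rsqrt n)) (cst 0)).
- exact: msin_scaled.
- exact: measurable_cst.
- by move=> n x; exact: ler_abs_sin_scaled.
- exact: cvg_sin_scaled.
Qed.

Lemma cvg_centered_charfun u :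
  (fun n => \int[P]_w cos (dot u (centered n w))) @ \oo --> expR (- (u *m G *m u^T) 0 0 / 2) /\
  (fun n => \int[P]_w sin (dot u (centered n w))) @ \oo --> (0 : R).
Proof.
have ce : (fun n => expR (log_modulus u n)) @ \oo --> expR (- (u *m G *m u^T) 0 0 / 2).
  by apply: (cvg_comp _ _ (@cvg_log_modulus u)); exact: continuous_expR.
have cc : (fun n => cos (phase u n)) @ \oo --> cos (0 : R).
  by apply: (cvg_comp _ _ (@cvg_phase u)); exact: continuous_cos.
have cs : (fun n => sin (phase u n)) @ \oo --> sin (0 : R).
  by apply: (cvg_comp _ _ (@cvg_phase u)); exact: continuous_sin.
have := cvgM ce cc; have := cvgM ce cs; rewrite cos0 sin0 mulr1 mulr0 => c2 c1; split.
- by rewrite (funext (fun n => (centered_charfun u n).1)); exact: c1.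
- by rewrite (funext (fun n => (centered_charfun u n).2)); exact: c2.
Qed.

(** The factor 2 is the price of bounding the scaled cosine by x^2: it gives |[log_modulus]| <= t^2
    u G u^T, while [one_sub_charfun_le] asks for half of its parameter. Any constant independent of
    n suffices for tightness. *)
Lemma centered_truncated_moment u n (K : R) :
  \int[P]_w Num.min (dot u (centered n w) ^+ 2) (K ^+ 2) <= 2 * (u *m G *m u^T) 0 0.
Proof.
apply: truncated_second_moment.
  exact: (measurable_fun_comp_rV (@continuous_dot R d u) (centered_measurable n)).
move=> t; set v := (u *m G *m u^T) 0 0.
have -> : \int[P]_w cos (dot u (centered n w) * t) = \int[P]_w cos (dot (t *: u) (centered n w)).
  by apply: eq_Rintegral => w _; rewrite dotZl mulrC.
have vt : ((t *: u) *m G *m (t *: u)^T) 0 0 = t ^+ 2 * v.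
  by rewrite -!scalemxAl linearZ/= -scalemxAr scalerA mxE -expr2.
have [qI qE] := quadratic_moment (t *: u).
have v0 : 0 <= t ^+ 2 * v by rewrite mulr_ge0 ?sqr_ge0 ?quadratic_moment_ge0.
have bnd (f : R -> R) : measurable_fun setT f -> (forall x, `|f x| <= x ^+ 2) ->
    `|\int[leb]_(s in T) (f (h (t *: u) s) * l s)| <= t ^+ 2 * v.
  move=> mf fx; rewrite -vt -qE.
  have mfl : measurable_fun T (fun s => f (h (t *: u) s) * l s).
    by apply: measurable_funM => //; exact: (measurableT_comp mf (measurable_dot_g _)).
  have fI : leb.-integrable T (EFin \o (fun s => f (h (t *: u) s) * l s)).
    apply: le_integrable qI => //; first exact/measurable_EFinP.
    move=> s Ts; rewrite lee_fin [leLHS]normrM [leRHS]normrM ler_wpM2r//.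
    by rewrite (le_trans (fx _))// ler_norm.
  apply: (@le_trans _ _ (\int[leb]_(s in T) `|f (h (t *: u) s) * l s|)).
    exact: le_normr_Rintegral.
  apply: le_Rintegral => //.
    exact: integrable_norm.
  by move=> s Ts; rewrite normrM (ger0_norm (l0 Ts)) ler_wpM2r// l0.
rewrite (centered_charfun _ _).1.
have A0 : log_modulus (t *: u) n <= 0.
  have -> : log_modulus (t *: u) n =
      - 1 * \int[leb]_(s in T) ((n%:R * (1 - cos (h (t *: u) s * rsqrt n))) * l s).
    rewrite -RintegralZl//; first by apply: eq_Rintegral => s _; ring.
    apply: (@scaled_integrable (fun x => n%:R * (1 - cos (x * rsqrt n))) (n%:R * rsqrt n)) => [|x].
      apply: measurable_funM => //; apply: measurable_funB => //.
      by apply: (measurableT_comp mcos); exact: measurable_funM.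
    rewrite normrM normr_nat -mulrA ler_wpM2l// distrC (le_trans (ler_abs_cosB1_id _))//.
    by rewrite normrM mulrC (ger0_norm (rsqrt_ge0 n)).
  rewrite mulN1r oppr_le0; apply: Rintegral_ge0 => s Ts.
  apply: mulr_ge0; last exact: l0.
  apply: mulr_ge0 => //.
have A1 := bnd _ (mcos_scaled n) (ler_abs_cos_scaled n).
have C1 := bnd _ (msin_scaled n) (ler_abs_sin_scaled n).
have -> : t ^+ 2 * (2 * v) = 2 * (t ^+ 2 * v) by ring.
apply: one_sub_charfun_le => //.
- by move: A1; rewrite -/(log_modulus (t *: u) n) ler_norml => /andP[A1 _]; rewrite mulNr mulrAC divff ?mul1r.
- by apply: (le_trans C1); rewrite ler_peMl// ler1n.
Qed.

(** Chebyshev's inequality with truncated squares: if the sup norm exceeds K, some coordinate does,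
    and its truncated square is already K^2. Truncation keeps every variable bounded, so no second
    moment is needed. *)
Lemma centered_tail n (K : R) : 0 < K ->
  (P [set w | (K < `|centered n w|)%R] <= ((\sum_i 2 * G i i) / K ^+ 2)%:E)%E.
Proof.
move=> K0; set A := [set w | _].
have mA : measurable A.
  rewrite -[A]setTI; exact: (centered_measurable n measurableT (measurable_norm_gt K)).
have mmin i : measurable_fun setT (fun w => Num.min (centered n w 0 i ^+ 2) (K ^+ 2)).
  apply: measurable_minr => //; apply: measurable_funX.
  exact: (measurable_fun_coord i (centered_measurable n)).
have m0 i w : 0 <= Num.min (centered n w 0 i ^+ 2) (K ^+ 2) by rewrite le_min !sqr_ge0.
have minI i : P.-integrable setT (EFin \o (fun w => Num.min (centered n w 0 i ^+ 2) (K ^+ 2))).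
  apply: (@bounded_integrable _ _ _ P _ _ (K ^+ 2)) => // w.
  by rewrite ger0_norm// ge_min lexx orbT.
have [sI sE] := @Rintegral_sum _ _ _ P setT _ (index_enum 'I_d)
  (fun i w => Num.min (centered n w 0 i ^+ 2) (K ^+ 2)) measurableT minI.
have iI : P.-integrable setT (EFin \o (\1_A : Omega -> R)).
  apply: (@bounded_integrable _ _ _ P _ _ 1) => //.
  by move=> x; rewrite indicE; case: (_ \in _); rewrite ?normr1 ?normr0.
have cI : P.-integrable setT (EFin \o (fun w => K ^+ 2 * \1_A w)) by exact: integrable_scale.
have -> : P A = (fine (P A))%:E by rewrite fineK// fin_num_measure.
rewrite lee_fin ler_pdivlMr ?exprn_gt0// mulrC -probability_indic// -RintegralZl//.
apply: (@le_trans _ _ (\int[P]_w (\sum_i Num.min (centered n w 0 i ^+ 2) (K ^+ 2)))).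
  apply: le_Rintegral => // w _; rewrite indicE; have [Aw|Aw] := pselect (A w).
    rewrite mem_set// mulr1.
    have [i Ki] : exists i, K < `|centered n w 0 i|.
      apply: contrapT => nK; move: Aw; rewrite /A/= ltNge => /negP; apply.
      apply: ler_mxnorm; first exact: ltW.
      by move=> i; rewrite leNgt; apply/negP => Ki; apply: nK; exists i.
    rewrite (bigD1 i)//= ler_wpDr//; first by apply: sumr_ge0 => j _; exact: m0.
    rewrite le_min lexx andbT -(real_normK (num_real (centered n w 0 i))).
    by rewrite ler_pXn2r// ?nnegrE ?ltW// (lt_trans K0).
  by rewrite memNset// mulr0; apply: sumr_ge0 => j _; exact: m0.
rewrite sE; apply: ler_sum => i _.
have := centered_truncated_moment (delta_mx 0 i) n K.
under eq_Rintegral do rewrite dot_delta.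
move=> /le_trans; apply; rewrite ler_wpM2l//.
have -> : ((delta_mx 0 i : 'rV[R]_d) *m G *m (delta_mx 0 i : 'rV[R]_d)^T) 0 0 = G i i.
  rewrite -[LHS]/(dot (delta_mx 0 i *m G) (delta_mx 0 i)) dotE (bigD1 i)//= big1.
    rewrite addr0 [X in _ * X]mxE !eqxx mulr1 [LHS]mxE (bigD1 i)//= big1.
      by rewrite addr0 [X in X * _]mxE !eqxx mul1r.
    by move=> k ki; rewrite [X in X * _]mxE (negbTE ki) mul0r.
  by move=> k ki; rewrite [X in _ * X]mxE (negbTE ki) mulr0.
by [].
Qed.

End empirical_moments.

(** * The delta method *)

Section delta_method.
Context {R : realType} {d : nat}.
Local Notation V := 'rV[R]_d.

Lemma ler_abs_cosB (a b : R) : `|cos a - cos b| <= `|a - b|.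
Proof.
have -> : cos a - cos b = - 2 * (sin ((a + b) / 2) * sin ((a - b) / 2)).
  have -> : cos a = cos ((a + b) / 2 + (a - b) / 2) by congr cos; field.
  have -> : cos b = cos ((a + b) / 2 - (a - b) / 2) by congr cos; field.
  by rewrite cosD cosB; ring.
rewrite normrM normrN normr_nat normrM.
apply: (@le_trans _ _ (2 * (1 * `|(a - b) / 2|))).
  by rewrite ler_wpM2l// ler_pM// ?sin_max// ler_abs_sin.
by rewrite mul1r normrM (@ger0_norm _ 2^-1)// mulrC divfK.
Qed.

Lemma ler_abs_sinB (a b : R) : `|sin a - sin b| <= `|a - b|.
Proof.
have E x : sin x = cos (x - pi / 2) by rewrite cosB cos_pihalf sin_pihalf; ring.
rewrite !E (le_trans (ler_abs_cosB _ _))//.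
by rewrite (_ : a - pi / 2 - (b - pi / 2) = a - b)//; ring.
Qed.

Lemma enorm_le (x : V) : enorm x <= Num.sqrt d%:R * `|x|.
Proof.
rewrite (_ : `|x| = Num.sqrt (`|x| ^+ 2)); last by rewrite sqrtr_sqr normr_id.
rewrite /enorm -sqrtrM// ler_wsqrtr//.
apply: (@le_trans _ _ (\sum_(i < d) `|x| ^+ 2)).
  apply: ler_sum => i _; rewrite -[leLHS]real_normK ?num_real//.
  by rewrite ler_pXn2r ?nnegrE// ler_abs_coord.
by rewrite sumr_const card_ord -[leLHS]mulr_natl.
Qed.

Lemma differentiable_ball (H : V -> V) (m : V) (e : R) : differentiable H m -> 0 < e ->
  exists2 D : R, 0 < D & forall x, `|x| < D -> `|H (x + m) - H m - 'd H m x| <= e * `|x|.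
Proof.
move=> dH e0; have /eqaddoP/(_ e e0)/nbhs_ballP[D /= D0 h] := diff_locally dH.
exists D => // x xD; have := h x; rewrite -ball_normE/= sub0r normrN => /(_ xD).
by rewrite /= opprD addrA.
Qed.

Lemma dotC (x y : V) : dot x y = dot y x.
Proof. by rewrite !dotE; apply: eq_bigr => i _; rewrite mulrC. Qed.

(** Links the matrix of partial derivatives to the differential: by duality [partials] acts on the
    frequency u, and so turns a characteristic function of W_n at u into one of Y_n at u J. *)
Lemma dot_differential (H : V -> V) (m u x : V) : differentiable H m ->
  dot u ('d H m x) = dot (u *m partials H m) x.
Proof.
move=> dH; have lin (a : R) (y z : V) :
    dot u ('d H m (a *: y + z)) = a * dot u ('d H m y) + dot u ('d H m z).
  by rewrite linearP dotDr dotZr.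
have -> := @linear_dot R d (fun x => dot u ('d H m x)) lin x.
rewrite dotC; congr (dot _ x); apply/rowP => k; rewrite [LHS]mxE dotE [RHS]mxE.
apply: eq_bigr => i _; congr (_ * _); rewrite -deriveE// [RHS]mxE derive_mx.
  by rewrite mxE.
exact: diff_derivable.
Qed.

Lemma differential_bound (H : V -> V) (m : V) : differentiable H m ->
  exists2 C : R, 0 <= C & forall x, `|'d H m x| <= C * `|x|.
Proof.
move=> dH; pose c (i : 'I_d) : R := \sum_k `|(delta_mx 0 i *m partials H m : V) 0 k|.
have c0 i : 0 <= c i by apply: sumr_ge0.
exists (\sum_i c i); first by apply: sumr_ge0.
move=> x; apply: ler_mxnorm; first by rewrite mulr_ge0// sumr_ge0.
move=> i; rewrite -dot_delta dot_differential// (le_trans (ler_abs_dot _ _))//.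
by rewrite ler_wpM2r// [leRHS](bigD1 i)//= lerDl sumr_ge0.
Qed.

Context {dO : measure_display} {Omega : measurableType dO} (P : probability Omega R).
Variables (Y W : nat -> Omega -> V) (L : V -> V) (J : 'M[R]_d).
Hypothesis mY : forall n, measurable_fun setT (Y n : Omega -> borel_rV R d).
Hypothesis mW : forall n, measurable_fun setT (W n : Omega -> borel_rV R d).
Hypothesis tightY : forall e : R, 0 < e -> exists2 K : R, 0 < K &
  forall n, (P [set w | (K < `|Y n w|)%R] <= e%:E)%E.
Hypothesis LJ : forall u x, dot u (L x) = dot (u *m J) x.
Hypothesis L_bounded : exists2 C : R, 0 <= C & forall x, `|L x| <= C * `|x|.
(** Uniform in the sample point on |Y_n| <= K, as a pointwise Taylor estimate provides; outside
    these events nothing is said about [W], which is where arbitrary values of the estimator may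
    occur. *)
Hypothesis WLY : forall K e : R, 0 < K -> 0 < e ->
  \forall n \near \oo, forall w, `|Y n w| <= K -> `|W n w - L (Y n w)| <= e.

Let mnorm (Z : nat -> Omega -> V) n K :
  (forall n, measurable_fun setT (Z n : Omega -> borel_rV R d)) ->
  measurable [set w | K < `|Z n w|].
Proof.
by move=> mZ; have := mZ n measurableT _ (@measurable_norm_gt R d K); rewrite setTI.
Qed.

Lemma delta_tight (e : R) : 0 < e -> exists2 K : R, 0 < K &
  \forall n \near \oo, (P [set w | (K < `|W n w|)%R] <= e%:E)%E.
Proof.
move=> e0; have [K K0 hK] := tightY e0; have [C C0 LC] := L_bounded.
(* On |Y_n| <= K, W_n is within 1 of L (Y_n), whose norm is at most C K. *)
exists (C * K + 1); first by rewrite ltr_wpDl// mulr_ge0// ltW.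
have near1 := WLY K0 (@ltr01 R); near=> n.
apply: (le_trans _ (hK n)); apply: le_measure; rewrite ?inE; try exact: mnorm.
move=> w /=; apply: contraTT; rewrite -!leNgt => YK.
have h : `|W n w - L (Y n w)| <= 1 by move: YK; move: w; near: n.
rewrite -(subrK (L (Y n w)) (W n w)) addrC (le_trans (ler_normD _ _))// lerD//.
by rewrite (le_trans (LC _))// ler_wpM2l.
Unshelve. all: by end_near. Qed.

Lemma delta_trig (f : R -> R) (u : V) (l : R) : continuous f -> (forall x, `|f x| <= 1) ->
  (forall a b, `|f a - f b| <= `|a - b|) ->
  (fun n => \int[P]_w f (dot (u *m J) (Y n w))) @ \oo --> l ->
  (fun n => \int[P]_w f (dot u (W n w))) @ \oo --> l.
Proof.
move=> cf f1 fL cl.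
have mf (Z : nat -> Omega -> V) n v :
    (forall n, measurable_fun setT (Z n : Omega -> borel_rV R d)) ->
    measurable_fun setT (fun w => f (dot v (Z n w))).
  move=> mZ; apply: (@measurable_fun_comp_rV _ _ _ _ (Z n) (fun x => f (dot v x))) => // x.
  by apply: continuous_comp; [exact: continuous_dot|exact: cf].
(* The 1 in [S] keeps it positive when u = 0. Budget: e / 4 on |Y_n| <= K, e / 4 from a tail of mass
   e / 8 with |f| <= 1, and e / 2 from the assumed limit. *)
apply/cvgrPdist_le => e e0; pose S := \sum_i `|u 0 i| + 1.
have S0 : 0 < S by rewrite ltr_wpDl// sumr_ge0.
have e80 : 0 < e / 8 by rewrite divr_gt0.
have eS0 : 0 < e / (4 * S) by rewrite divr_gt0// mulr_gt0.
have [K K0 hK] := tightY e80; have nearW' := WLY K0 eS0.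
have e20 : 0 < e / 2 by rewrite divr_gt0.
have /cvgrPdist_le/(_ _ e20) nearl := cl.
near=> n.
have hW : forall w, `|Y n w| <= K -> `|W n w - L (Y n w)| <= e / (4 * S) by near: n.
have close : `|\int[P]_w f (dot u (W n w)) - \int[P]_w f (dot (u *m J) (Y n w))| <=
    e / 4 + 2 * 1 * (e / 8).
  apply: (@Rintegral_close _ _ _ P [set w | K < `|Y n w|]) => //; try exact: mf.
  - exact: mnorm.
  - by rewrite divr_ge0// ltW.
  - move=> w /= /negP; rewrite -leNgt => YK; rewrite (le_trans (fL _ _))//.
    rewrite -LJ -(mulN1r (dot _ (L _))) -dotZr -dotDr scaleN1r (le_trans (ler_abs_dot _ _))//.
    apply: (@le_trans _ _ (S * (e / (4 * S)))).
      by rewrite ler_pM// ?sumr_ge0// ?hW// lerDl.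
    have -> // : S * (e / (4 * S)) = e / 4 by field; rewrite gt_eqF.
have : `|l - \int[P]_w f (dot (u *m J) (Y n w))| <= e / 2 by near: n.
move=> hl; rewrite (le_trans (ler_distD (\int[P]_w f (dot (u *m J) (Y n w))) _ _))//.
rewrite distrC in close; move: close hl; set a := `|_ - _|; set b := `|_ - _|; lra.
Unshelve. all: by end_near. Qed.

End delta_method.

(** * Consistency and asymptotic normality of the estimator *)

Theorem theorem2p1 (R : realType) (d : nat) (d_gt0 : (0 < d)%N)
    (T : set R) (T_itv : observation_interval T)
    (Theta : set 'rV[R]_d)
    (Theta_open : open Theta) (Theta_convex : convex_set Theta)
    (Theta_bounded : bounded_set Theta)
    (lam : 'rV[R]_d -> R -> R)
    (lam_intensity : forall theta, Theta theta -> intensity T (lam theta))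
    (dO : measure_display) (Omega : measurableType dO)
    (P : 'rV[R]_d -> probability Omega R)
    (X : nat -> Omega -> cumulative R R)
    (X_poisson : forall theta, Theta theta ->
       iid_poisson_processes (P theta) T (lam theta) X)
    (g : R -> 'rV[R]_d)
    (g_meas : forall k, measurable_fun T (fun s => g s 0 k))
    (g_finite : forall theta, Theta theta -> moments_finite T g lam theta)
    (H : 'rV[R]_d -> 'rV[R]_d)
    (H_inverse : inverse_on Theta (moment T g lam) H)
    (dom_open : open (moment T g lam @` Theta))
    (thetan : nat -> Omega -> 'rV[R]_d)
    (thetan_mme : moment_estimator T g (moment T g lam @` Theta) H X thetan)
    (identifiable : forall nu : R, 0 < nu ->
       forall theta0, Theta theta0 ->
       (0 < ereal_inf
              ((fun theta =>
                  (enorm (moment T g lam theta - moment T g lam theta0))%:E) @`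
               [set theta | Theta theta /\ (nu < enorm (theta - theta0))%R]))%E)
    (H_C1 : continuously_differentiable (moment T g lam @` Theta) H) :
  forall theta0, Theta theta0 ->
    cvg_in_probability (P theta0) thetan theta0 /\
    exists2 mu : probability (borel_rV R d) R,
      multivariate_normal mu 0 (limit_cov T g lam H theta0)
    & cvg_in_distribution (P theta0)
        (fun n w => Num.sqrt n%:R *: (thetan n w - theta0)) mu.
Proof.
move=> theta0 Th0; set P0 := P theta0; set M := moment T g lam theta0.
pose U := moment T g lam @` Theta.
have UM : U M by exists theta0.
have HM : H M = theta0 by have [_ _ uniq] := H_inverse M UM; rewrite -(uniq _ Th0).
have dH : differentiable H M by have [] := H_C1 _ UM.
have lI := lam_intensity _ Th0; have iidX := X_poisson _ Th0; have gfin := g_finite _ Th0.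
pose G := moment_cov T g lam theta0.
pose Y := centered (T := T) lam theta0 g X.
pose W n w : 'rV[R]_d := Num.sqrt n%:R *: (thetan n w - theta0).
have mY n : measurable_fun setT (Y n : Omega -> borel_rV R d).
  exact: (centered_measurable T_itv lI iidX g_meas).
have mtheta n : measurable_fun setT (thetan n : Omega -> borel_rV R d) by have [] := thetan_mme n.
have mcoord n k : measurable_fun setT (fun w => thetan n w 0 k - theta0 0 k).
  apply: measurable_funB; last exact: measurable_cst.
  exact: (measurable_fun_coord k (mtheta n)).
have mW n : measurable_fun setT (W n : Omega -> borel_rV R d).
  apply: measurable_fun_rV => k.
  rewrite (_ : (fun w => _) = fun w => Num.sqrt n%:R * (thetan n w 0 k - theta0 0 k)).
    by apply: measurable_funM => //; exact: measurable_cst.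
  by apply/funext => w; rewrite !mxE.
have tightY e : 0 < e -> exists2 K : R, 0 < K &
    forall n, (P0 [set w | (K < `|Y n w|)%R] <= e%:E)%E.
  (* This K satisfies v <= e K, and K >= 1 gives e K <= e K^2, as the tail bound v / K^2
     requires. *)
  move=> e0; pose v := \sum_i 2 * G i i; pose K := `|v| / e + 1.
  have K1 : 1 <= K by rewrite lerDr divr_ge0// ltW.
  have K0 : 0 < K by rewrite (lt_le_trans _ K1).
  exists K => // n; apply: (le_trans (centered_tail T_itv lI iidX g_meas gfin n K0)).
  rewrite lee_fin ler_pdivrMr ?exprn_gt0// (le_trans (ler_norm _))// -/v.
  apply: (@le_trans _ _ (e * K)).
    by rewrite /K mulrDr mulr1 mulrC divfK ?gt_eqF// lerDl ltW.
  by rewrite ler_pM2l// expr2 ler_peMl// ltW.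
have WLY K e : 0 < K -> 0 < e ->
    \forall n \near \oo, forall w, `|Y n w| <= K -> `|W n w - 'd H M (Y n w)| <= e.
  (* The accuracy e / K is chosen because the remainder, multiplied by sqrt n, is at most (e / K)
     |Y_n| <= e. *)
  move=> K0 e0; have eK0 : 0 < e / K by rewrite divr_gt0.
  have [D D0 hD] := differentiable_ball dH eK0.
  (* Openness of the domain: once K / sqrt n < D', the event |Y_n| <= K puts a_n in it, and the
     estimator is H (a_n) there. *)
  have /nbhs_ballP[D' /= D'0 hD'] : nbhs M U by exact: open_nbhs_nbhs.
  have small : \forall n \near \oo, K * rsqrt n < Num.min D D'.
    have c0 : (fun n => K * rsqrt n : R) @ \oo --> (0 : R).
      by rewrite -[X in _ --> X](mulr0 K); apply: cvgMl_tmp; exact: cvg_rsqrt.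
    by apply: (cvgr_lt _ c0); rewrite lt_min D0 D'0.
  near=> n => w YK.
  have n0 : (0 < n)%N by near: n; exact: nbhs_infty_gt.
  have : K * rsqrt n < Num.min D D' by near: n.
  rewrite lt_min => /andP[nD nD'].
  pose x := empirical_moment T g X n w - M.
  have Yx : Y n w = Num.sqrt n%:R *: x by [].
  have sn : rsqrt n * Num.sqrt n%:R = 1 :> R.
    by rewrite sqrtr_nat mulrCA -expr2 rsqrt_sqrM.
  have xY : `|x| = rsqrt n * `|Y n w|.
    by rewrite Yx normrZ (ger0_norm (sqrtr_ge0 _)) mulrA sn mul1r.
  have xK : `|x| <= K * rsqrt n by rewrite xY mulrC ler_wpM2r// rsqrt_ge0.
  have Ux : U (empirical_moment T g X n w).
    by apply: hD'; rewrite -ball_normE/= distrC (le_lt_trans xK).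
  have -> : W n w - 'd H M (Y n w) = Num.sqrt n%:R *: (H (x + M) - H M - 'd H M x).
    have [_ /(_ w Ux) E] := thetan_mme n.
    by rewrite Yx linearZ/= -scalerBr HM subrK -E.
  rewrite normrZ (ger0_norm (sqrtr_ge0 _)).
  apply: (@le_trans _ _ (Num.sqrt n%:R * (e / K * `|x|))).
    by rewrite ler_wpM2l ?sqrtr_ge0// hD// (le_lt_trans xK).
  rewrite xY mulrCA [Num.sqrt _ * _]mulrA [Num.sqrt _ * _]mulrC sn mul1r.
  by rewrite mulrAC ler_pdivrMr// ler_pM2l.
have LJ u x := dot_differential u x dH.
have LB := differential_bound dH.
have tightW := delta_tight mY mW tightY LB WLY.
split.
  (* Since thetan - theta0 = W_n / sqrt n, tightness of W_n gives consistency; sqrt d converts the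
     sup norm to the Euclidean one. *)
  move=> e e0.
  have mE n : measurable [set w | e < enorm (thetan n w - theta0)].
    have me : measurable_fun setT (fun w => enorm (thetan n w - theta0)).
      have ms : measurable_fun setT (fun w => \sum_(i < d) (thetan n w 0 i - theta0 0 i) ^+ 2).
        by apply: measurable_sum => i; exact: measurable_funX.
      apply: (eq_measurable_fun (fun w =>
          Num.sqrt (\sum_(i < d) (thetan n w 0 i - theta0 0 i) ^+ 2))) => [w _|].
        by rewrite /enorm; congr Num.sqrt; apply: eq_bigr => i _; rewrite !mxE.
      apply: (measurableT_comp _ ms); apply: continuous_measurable_fun.
      exact: sqrt_continuous.
    have := me measurableT `]e, +oo[%classic (measurable_itv _); rewrite setTI.
    by congr measurable; apply/seteqP; split => w /=; rewrite in_itv/= andbT.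
  apply/fine_cvgP; split; first by apply: nearW => n; exact: fin_num_measure.
  apply/cvgrPdist_le => r r0; have [K K0 hK] := tightW r r0.
  have c0 : (fun n => Num.sqrt d%:R * K * rsqrt n : R) @ \oo --> (0 : R).
    by rewrite -[X in _ --> X](mulr0 (Num.sqrt d%:R * K)); apply: cvgMl_tmp; exact: cvg_rsqrt.
  have small : \forall n \near \oo, Num.sqrt d%:R * K * rsqrt n <= e.
    by apply: (cvgr_le _ c0).
  near=> n; rewrite sub0r normrN ger0_norm ?fine_ge0// -lee_fin fineK ?fin_num_measure//.
  have n0 : (0 < n)%N by near: n; exact: nbhs_infty_gt.
  have hn : Num.sqrt d%:R * K * rsqrt n <= e by near: n.
  have hP : (P0 [set w | (K < `|W n w|)%R] <= r%:E)%E by near: n.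
  apply: (le_trans _ hP); apply: le_measure; rewrite ?inE//.
    by have := mW n measurableT _ (@measurable_norm_gt R d K); rewrite setTI.
  move=> w /=; apply: contraTT; rewrite -!leNgt => WK.
  apply: (le_trans (enorm_le _)); apply: le_trans hn; rewrite -mulrA ler_wpM2l ?sqrtr_ge0//.
  have -> : thetan n w - theta0 = rsqrt n *: W n w.
    by rewrite /W scalerA sqrtr_nat mulrCA -expr2 rsqrt_sqrM// scale1r.
  by rewrite normrZ (ger0_norm (rsqrt_ge0 n)) mulrC ler_wpM2r// rsqrt_ge0.
pose J := partials H M.
(* The limit of the characteristic function of Y_n at u J is therefore that of N(0, D) at u. *)
have DE (u : 'rV[R]_d) : u *m limit_cov T g lam H theta0 *m u^T = (u *m J) *m G *m (u *m J)^T.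
  by rewrite /limit_cov trmx_mul !mulmxA.
have GT : G^T = G.
  by apply/matrixP => i k; rewrite !mxE; apply: eq_Rintegral => s _; rewrite [g s 0 k * _]mulrC.
have [||mu normal_mu mu_char] := @multivariate_normal_exists R d (limit_cov T g lam H theta0).
- by rewrite /limit_cov !trmx_mul trmxK GT mulmxA.
- by move=> u; rewrite DE; exact: (quadratic_moment_ge0 T_itv lI gfin).
exists mu => //; apply: (@cvg_in_distribution_trig R d dO Omega P0 W mu mW) => [u|u|//].
- rewrite (mu_char u).1 DE.
  have [cc _] := cvg_centered_charfun T_itv lI iidX g_meas gfin (u *m J).
  exact: (delta_trig mY mW tightY LJ WLY (@continuous_cos R) (@cos_max R) (@ler_abs_cosB R) cc).
- rewrite (mu_char u).2.
  have [_ cs] := cvg_centered_charfun T_itv lI iidX g_meas gfin (u *m J).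
  exact: (delta_trig mY mW tightY LJ WLY (@continuous_sin R) (@sin_max R) (@ler_abs_sinB R) cs).
Unshelve. all: by end_near. Qed.
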